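(* Let $M=\Gamma\backslash G$ be a $6$-dimensional nilmanifold. Then $M$ admits invariant mean convex closed $\mathrm{SL}(3,\mathbb{C})$-structures if and only if the Lie algebra $\mathfrak{g}$ of $G$ is not isomorphic to any of the six Lie algebras $\mathfrak{g}_1=(0,0,e^{12},e^{13},e^{14}+e^{23},e^{34}-e^{25})$, $\mathfrak{g}_2=(0,0,e^{12},e^{13},e^{14},e^{34}-e^{25})$, $\mathfrak{g}_4=(0,0,e^{12},e^{13},e^{14}+e^{23},e^{24}+e^{15})$, $\mathfrak{g}_9=(0,0,0,e^{12},e^{14}-e^{23},e^{15}+e^{34})$, $\mathfrak{g}_{12}=(0,0,0,e^{12},e^{14},e^{15}+e^{24})$, $\mathfrak{g}_{34}=(0,0,0,0,0,0)$.
   Context: A nilmanifold $\Gamma\backslash G$ is a compact quotient of a connected, simply connected, nilpotent (real) Lie group $G$ by a lattice $\Gamma$. A structure on $\Gamma\backslash G$ is invariant if it is induced by a left-invariant one on $G$ (equivalently, it is given by the corresponding structure on the Lie algebra $\mathfrak g$, with $d$ the Chevalley–Eilenberg differential). Notation for Lie algebras: $(\epsilon^1,\dots,\epsilon^6)$ denotes the $6$-dimensional real Lie algebra whose dual has a basis $(e^1,\dots,e^6)$ with $de^k=\epsilon^k$; $e^{ij\cdots k}=e^i\wedge e^j\wedge\cdots\wedge e^k$. Definite $3$-forms. Let $V$ be an oriented real $6$-dimensional vector space with positive volume form $\nu\in\Lambda^6V^*$. Let $A:\Lambda^5V^*\to V\otimes\Lambda^6V^*$ be the canonical isomorphism: $A(\xi)=v\otimes\nu$,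 where $\alpha\wedge\xi=\alpha(v)\,\nu$ for all $\alpha\in V^*$. For $\rho\in\Lambda^3V^*$ set $K_\rho(v)=A((\iota_v\rho)\wedge\rho)$, regarded as an endomorphism of $V$ using $\nu$, and $\lambda(\rho)=\frac16\operatorname{Tr}(K_\rho^2)$. The form $\rho$ is stable if $\lambda(\rho)\ne0$, and definite if $\lambda(\rho)<0$; in the definite case $J_\rho=-\frac{1}{\sqrt{-\lambda(\rho)}}K_\rho$ is a complex structure on $V$. $J_\rho$ acts on forms by $(J_\rho\alpha)(v_1,\dots,v_k)=\alpha(J_\rho v_1,\dots,J_\rho v_k)$, and $\hat\rho:=J_\rho\rho$; then $\rho+i\hat\rho$ is of type $(3,0)$. An $\mathrm{SL}(3,\mathbb C)$-structure on an oriented $6$-manifold is a $3$-form $\rho$ that is definite at each point; it is closed if $d\rho=0$. In that case $d\hat\rho$ is a real $(2,2)$-form with respect to $J_\rho$. A real $(2,2)$-form $\gamma$ on a $3$-dimensional complex vector space is semi-positive if for every $(1,0)$-form $\alpha$ one has $\gamma\wedge i\alpha\wedge\bar\alpha=\lambda\tau$ with $\lambda\ge0$, where $\tau$ is a volume form positive for the orientation induced by the complex structure. A closed $\mathrm{SL}(3,\mathbb C)$-structure $\rho$ is mean convex if $d\hat\rho$ is, at each point, a non-zero semi-positive $(2,2)$-form with respect to $J_\rho$. *)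

(* Defs.v *)
From HB Require Import structures.
From mathcomp Require Import all_boot all_order all_fingroup all_algebra.
From mathcomp Require Import complex.
From mathcomp Require Import all_classical all_reals all_analysis.
Set Implicit Arguments.
Unset Strict Implicit.
Unset Printing Implicit Defensive.
Import Order.TTheory GRing.Theory Num.Theory numFieldNormedType.Exports.
Local Open Scope ring_scope.
Local Open Scope complex_scope.
Local Open Scope classical_set_scope.

(* Lie algebra structures on R^6 = 'rV[R]_6. *)
Definition bracket (R : realType) : Type :=
  'rV[R]_6 -> 'rV[R]_6 -> 'rV[R]_6.

Section LieAlgebra.
Variable R : realType.
Local Notation V := 'rV[R]_6.
Implicit Types br : bracket R.

Definition is_lie_bracket br : Prop :=
  [/\ forall (a : R) (x y z : V), br (a *: x + y) z = a *: br x z + br y z,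
      forall (a : R) (x y z : V), br x (a *: y + z) = a *: br x y + br x z,
      forall x : V, br x x = 0
    & forall x y z : V, br x (br y z) + br y (br z x) + br z (br x y) = 0].

Fixpoint lower_central br (n : nat) : {vspace V} :=
  if n is m.+1 then
    <<[seq br x y | x <- vbasis {:V}, y <- vbasis (lower_central br m)]>>%VS
  else {:V}%VS.

Definition nilpotent_lie br : Prop := exists n : nat, lower_central br n = 0%VS.

Definition lie_isomorphic (br br' : bracket R) : Prop :=
  exists f : {linear V -> V},
    bijective f /\ forall x y : V, f (br x y) = br' (f x) (f y).

(* The connected, simply connected Lie group with nilpotent Lie algebra
   (V, br) is V itself with the Baker-Campbell-Hausdorff product (exp is then
   the identity, the unit is 0 and x^-1 = - x).  A nilpotent Lie algebra of
   dimension 6 has step at most 5, so the series stops at degree 5. *)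
Definition bch br (x y : V) : V :=
  x + y + 2%:R^-1 *: br x y
  + 12%:R^-1 *: (br x (br x y) + br y (br y x))
  - 24%:R^-1 *: br y (br x (br x y))
  - 720%:R^-1 *: (br y (br y (br y (br y x))) + br x (br x (br x (br x y))))
  + 360%:R^-1 *: (br x (br y (br y (br y x))) + br y (br x (br x (br x y))))
  + 120%:R^-1 *: (br y (br x (br y (br x y))) + br x (br y (br x (br y x)))).

(* Discrete subgroup Gamma of (V, bch br) such that Gamma\V is compact, i.e.
   such that the Gamma-translates of some compact set cover V. *)
Definition is_lattice br (Gamma : set V) : Prop :=
  [/\ Gamma 0,
      forall x y : V, Gamma x -> Gamma y -> Gamma (bch br x y),
      forall x : V, Gamma x -> Gamma (- x),
      forall x : V, Gamma x -> exists2 U, nbhs x U & U `&` Gamma = [set x]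
    & exists2 C : set V, compact C &
        forall x : V, exists g c, [/\ Gamma g, C c & x = bch br g c]].

End LieAlgebra.

(* A K-valued k-form on R^6 is a function of k vectors, given as the rows of
   a k x 6 matrix; the predicate [is_kform] below states that it is multilinear
   and alternating. *)
Definition kform (R : realType) (K : Type) (k : nat) : Type := 'M[R]_(k, 6) -> K.

Section Forms.
Variable R : realType.
Local Notation V := 'rV[R]_6.

Definition is_kform (k : nat) (w : kform R R k) : Prop :=
  (forall (i : 'I_k) (A B C : 'M[R]_(k, 6)) (b c : R),
      row i A = b *: row i B + c *: row i C ->
      row' i B = row' i A -> row' i C = row' i A ->
      w A = b * w B + c * w C)
  /\ (forall (A : 'M[R]_(k, 6)) (i j : 'I_k),
      i != j -> row i A = row j A -> w A = 0).

(* Normalised so that e^{12}(e_1, e_2) = 1. *)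
Definition wedge (K : fieldType) (p q : nat)
    (a : kform R K p) (b : kform R K q) : kform R K (p + q) :=
  fun M => (p`! * q`!)%:R^-1 *
    \sum_(s : 'S_(p + q)) (-1) ^+ s *
       (a (usubmx (row_perm s M)) * b (dsubmx (row_perm s M))).

(* e^k of the standard dual basis, numbered from 1 to 6. *)
Definition e1 (k : nat) : kform R R 1 := fun M => M 0 (inord k.-1).
Definition e2 (i j : nat) : kform R R 2 := wedge (e1 i) (e1 j).

Definition contract (k : nat) (v : V) (w : kform R R k.+1) : kform R R k :=
  fun M => w (col_mx v M).

Definition pullback (K : Type) (k : nat) (J : 'M[R]_6) (w : kform R K k) :
    kform R K k :=
  fun M => w (M *m J).

(* Chevalley-Eilenberg differential:
     (d w)(x_0,...,x_(k+1))
       = sum_(i < j) (-1)^(i+j) w([x_i,x_j], x_0,..,^x_i,..,^x_j,..,x_(k+1)).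
   For i < j, the i-th row of row' j M is x_i. *)
Definition ce_d (br : bracket R) (k : nat) (w : kform R R k.+1) :
    kform R R k.+2 :=
  fun M => \sum_(j < k.+2) \sum_(i < k.+1 | (i < j)%N)
    (-1) ^+ (i + j) *
      w (col_mx (br (row i (row' j M)) (row j M)) (row' i (row' j M))).

Definition is_volume_form (nu : kform R R 6) : Prop :=
  is_kform nu /\ nu 1%:M != 0.

(* A(xi) = v (x) nu with a /\ xi = a(v) nu for every 1-form a: the k-th
   coordinate of v is obtained by taking a = e^k and evaluating at the
   standard frame. *)
Definition A_iso (nu : kform R R 6) (xi : kform R R 5) : V :=
  \row_(k < 6) (wedge (e1 k.+1) xi (1%:M : 'M[R]_6) / nu 1%:M).

(* Endomorphisms are matrices acting on row vectors, v |-> v *m K. *)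
Definition K_of (nu : kform R R 6) (rho : kform R R 3) : 'M[R]_6 :=
  lin1_mx (fun v : V => A_iso nu (wedge (contract v rho) rho)).

Definition lambda_of (nu : kform R R 6) (rho : kform R R 3) : R :=
  6%:R^-1 * \tr (K_of nu rho *m K_of nu rho).

Definition definite (nu : kform R R 6) (rho : kform R R 3) : Prop :=
  lambda_of nu rho < 0.

Definition J_of (nu : kform R R 6) (rho : kform R R 3) : 'M[R]_6 :=
  - ((Num.sqrt (- lambda_of nu rho))^-1 *: K_of nu rho).

Definition hat (nu : kform R R 6) (rho : kform R R 3) : kform R R 3 :=
  pullback (J_of nu rho) rho.

Definition complexify (k : nat) (w : kform R R k) : kform R R[i] k :=
  fun M => (w M)%:C.

Definition is_form10 (J : 'M[R]_6) (a : kform R R[i] 1) : Prop :=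
  (forall (c : R) (x y : V), a (c *: x + y) = c%:C * a x + a y)
  /\ (forall x : V, a (x *m J) = ('i)%C * a x).

(* Positive for the orientation for which (v1, J v1, v2, J v2, v3, J v3) is
   an oriented basis whenever (v1, v2, v3) is a complex basis. *)
Definition positive_volume (J : 'M[R]_6) (tau : kform R R 6) : Prop :=
  is_volume_form tau /\
  forall v1 v2 v3 : V,
    let M : 'M[R]_6 :=
      col_mx v1 (col_mx (v1 *m J) (col_mx v2 (col_mx (v2 *m J)
        (col_mx v3 (v3 *m J))))) in
    M \in unitmx -> 0 < tau M.

Definition semi_positive (J : 'M[R]_6) (g : kform R R 4) : Prop :=
  exists tau : kform R R 6, positive_volume J tau /\
  forall a : kform R R[i] 1, is_form10 J a ->
  exists l : R, 0 <= l /\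
  forall M : 'M[R]_6,
    wedge (complexify g)
      (wedge (fun x => ('i)%C * a x : R[i]) (fun x => (a x)^*)) M
    = (l * tau M)%:C.

(* Invariant structures, i.e. structures on the Lie algebra (R^6, br) with the
   orientation of nu.  When ce_d br rho = 0, the form ce_d br (hat nu rho) is
   automatically of type (2,2) for J_of nu rho. *)
Definition closed_SL3C (br : bracket R) (nu : kform R R 6) (rho : kform R R 3) :
    Prop :=
  [/\ is_kform rho, definite nu rho & forall M, ce_d br rho M = 0].

Definition mean_convex (br : bracket R) (nu : kform R R 6) (rho : kform R R 3) :
    Prop :=
  [/\ closed_SL3C br nu rho,
      exists M, ce_d br (hat nu rho) M != 0
    & semi_positive (J_of nu rho) (ce_d br (hat nu rho))].

(* The bracket on R^6 with d e^k = eps_k, that is e^k([x, y]) = - eps_k(x, y). *)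
Definition bracket_of (eps : seq (kform R R 2)) : bracket R :=
  fun x y => \row_(k < 6) - nth (fun=> 0) eps k (col_mx x y).

Local Notation "0" := (fun=> 0%R) : form_scope.
Local Notation "a + b" := (fun M => a M + b M)%R : form_scope.
Local Notation "a - b" := (fun M => a M - b M)%R : form_scope.
Delimit Scope form_scope with form.

Definition g1 : bracket R := bracket_of
  [:: 0; 0; e2 1 2; e2 1 3; e2 1 4 + e2 2 3; e2 3 4 - e2 2 5]%form.
Definition g2 : bracket R := bracket_of
  [:: 0; 0; e2 1 2; e2 1 3; e2 1 4; e2 3 4 - e2 2 5]%form.
Definition g4 : bracket R := bracket_of
  [:: 0; 0; e2 1 2; e2 1 3; e2 1 4 + e2 2 3; e2 2 4 + e2 1 5]%form.
Definition g9 : bracket R := bracket_of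
  [:: 0; 0; 0; e2 1 2; e2 1 4 - e2 2 3; e2 1 5 + e2 3 4]%form.
Definition g12 : bracket R := bracket_of
  [:: 0; 0; 0; e2 1 2; e2 1 4; e2 1 5 + e2 2 4]%form.
Definition g34 : bracket R := bracket_of [:: 0; 0; 0; 0; 0; 0]%form.

End Forms.

(* Main.v *)
(* Only if.  Mean convexity is invariant under isomorphism, so one works on the
   six brackets themselves.  For a closed definite rho, hat rho is a multiple of
   rho(K ., ., .), so gamma = d (hat rho) is polynomial in the coefficients of
   rho, and semi-positivity makes the quadratic form
   Q(al) = gamma /\ al /\ (al o J) semidefinite.  There are e^a, e^b with
   Q(e^a) = 0 for which the polar form Q(e^a, e^b) is a single monomial, which
   must therefore vanish; after one or two such steps K has a row or a column
   with no off-diagonal entry, and then lambda = K_ii^2 >= 0, a contradiction.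
   For g_34 one has d = 0.

   If.  A nilpotent Lie algebra of dimension 6 has an abelian ideal W of
   dimension 4, or an abelian ideal of dimension 3 that is its own centralizer.
   In the first case the bracket is given by two commuting nilpotent
   endomorphisms of W and a vector [e1, e2] of W; in the second one it depends
   on two parameters.  Changes of basis bring the bracket either to one of the
   six exceptional ones or to one with a coframe z_k = f_k + i f_(k+3)
   (k = 0, 1, 2) such that d Re(z0 /\ z1 /\ z2) = 0 and
   d Im(z0 /\ z1 /\ z2) = kap f_0 /\ f_1 /\ f_3 /\ f_4 with kap <> 0.  For
   rho = Re(z0 /\ z1 /\ z2) this gives Q(al) = +- kap (al_2^2 + al_5^2), and the
   sign is absorbed by replacing rho by - rho. *)
Require Import Defs.
From HB Require Import structures.
From mathcomp Require Import all_boot all_order all_fingroup all_algebra.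
From mathcomp Require Import complex.
From mathcomp Require Import all_classical all_reals.
From mathcomp Require Import ring lra zify.
Set Implicit Arguments.
Unset Strict Implicit.
Unset Printing Implicit Defensive.
Import Order.TTheory GRing.Theory Num.Theory.
Local Open Scope ring_scope.

(** * Alternating forms *)

(** Definiteness and semi-positivity involve J, hence the square root of - lambda. The identities
    K^2 = lambda and rho(K x, y, z) = rho(x, K y, z) remove it: J and hat rho become scalar
    multiples of K and rho(K ., ., .), and nonzero scalars do not affect whether a quadratic form is
    semidefinite. The obstructions are thus polynomial conditions on the 20 coefficients of rho, and
    the orientation enters them only through an unknown nonzero factor.

    The obstacle is the size of these polynomials. Forms, brackets and sums are therefore mirrored
    by functions of natural numbers and by lists of structure constants that reduce by computation,
    so that each verification ends in [ring] or [field].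

    For existence the form is fixed once and for all and the bracket is moved instead: a single
    criterion on structure constants is checked in an adapted basis. The parameters of the abelian
    ideal are carried through the changes of basis, and the tree of cases follows which of them
    vanish. Where the criterion fails by an accidental equality such as p q = 1, rescaling or
    changing the sign of one basis vector restores it. *)

Section Kforms.
Variable R : realType.
Implicit Types (k : nat).

Lemma kform_lin k (w : kform R R k) (wk : is_kform w) (i : 'I_k)
    (A B C : 'M[R]_(k, 6)) (b c : R) :
  row i A = b *: row i B + c *: row i C ->
  row' i B = row' i A -> row' i C = row' i A -> w A = b * w B + c * w C.
Proof. by case: wk => [+ _]; apply. Qed.

Definition setrow k (i : 'I_k) (x : 'rV[R]_6) (M : 'M[R]_(k, 6)) : 'M[R]_(k, 6) :=
  \matrix_(j, l) if j == i then x 0 l else M j l.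

Lemma row_setrow k (i : 'I_k) x M : row i (setrow i x M) = x.
Proof. by apply/rowP=> l; rewrite !mxE eqxx. Qed.

Lemma row'_setrow k (i : 'I_k) x M : row' i (setrow i x M) = row' i M.
Proof. by apply/matrixP=> a b; rewrite !mxE eq_sym (negbTE (neq_lift _ _)). Qed.

Lemma setrow_id k (i : 'I_k) M : setrow i (row i M) M = M.
Proof. by apply/matrixP=> a b; rewrite !mxE; case: eqP => [->|]. Qed.

Lemma setrow_neq k (i j : 'I_k) x M : j != i -> row j (setrow i x M) = row j M.
Proof. by move=> ji; apply/rowP=> l; rewrite !mxE (negbTE ji). Qed.

Lemma kform_setrow k (w : kform R R k) (wk : is_kform w) (i : 'I_k) M b c x y :
  w (setrow i (b *: x + c *: y) M)
  = b * w (setrow i x M) + c * w (setrow i y M).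
Proof.
by apply: (kform_lin wk (i := i)); rewrite ?row_setrow ?row'_setrow.
Qed.

Lemma kform_alt k (w : kform R R k) (wk : is_kform w) (i j : 'I_k) M :
  i != j -> row i M = row j M -> w M = 0.
Proof. by case: wk => _; apply. Qed.

Lemma kform_tperm k (w : kform R R k) (wk : is_kform w) (i j : 'I_k) M :
  i != j -> w (row_perm (tperm i j) M) = - w M.
Proof.
move=> ij; pose x := row i M; pose y := row j M.
pose D u v := w (setrow i u (setrow j v M)).
have Dxy : D x y = w M by rewrite /D /x /y setrow_id setrow_id.
have Dyx : D y x = w (row_perm (tperm i j) M).
  rewrite /D; congr w; apply/matrixP=> a b; rewrite !mxE.
  case: eqP => [->|ai]; first by rewrite tpermL.
  by case: eqP => [->|aj]; [rewrite tpermR|rewrite tpermD // eq_sym; apply/eqP].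
have D0 u : D u u = 0.
  apply: (kform_alt wk (i := i) (j := j)) => //.
  by rewrite row_setrow setrow_neq 1?eq_sym // row_setrow.
have DDl u v z : D (u + v) z = D u z + D v z.
  rewrite /D -[u + v]addr0 -(scale1r (u + v)).
  have -> : 1 *: (u + v) + 0 = 1 *: u + 1 *: v :> 'rV_6 by rewrite !scale1r addr0.
  by rewrite kform_setrow // !mul1r.
have swap u v : setrow i u (setrow j v M) = setrow j v (setrow i u M).
  apply/matrixP=> a b; rewrite !mxE.
  by case: eqP => // ->; rewrite (negbTE ij).
have DDr u v z : D z (u + v) = D z u + D z v.
  rewrite /D !swap -[u + v]addr0 -(scale1r (u + v)).
  have -> : 1 *: (u + v) + 0 = 1 *: u + 1 *: v :> 'rV_6 by rewrite !scale1r addr0.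
  by rewrite kform_setrow // !mul1r.
have := D0 (x + y); rewrite DDl !DDr !D0 add0r addr0 Dxy Dyx => /eqP.
by rewrite addr_eq0 => /eqP ->; rewrite opprK.
Qed.

Lemma kform_perm k (w : kform R R k) (wk : is_kform w) (s : 'S_k) M :
  w (row_perm s M) = (-1) ^+ s * w M.
Proof.
case: (prod_tpermP s) => ts -> /=; elim: ts M => [|t ts IH] M /=.
  by rewrite big_nil odd_perm1 mul1r row_perm1.
case/andP=> tn /IH {}IH; rewrite big_cons row_permM kform_tperm // IH.
by rewrite odd_permM odd_tperm tn addTb signrN mulNr.
Qed.

Definition bas k (f : {ffun 'I_k -> 'I_6}) : 'M[R]_(k, 6) :=
  \matrix_(i, j) (j == f i)%:R.

Lemma kform_expand k (w : kform R R k) (wk : is_kform w) M :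
  w M = \sum_(f : {ffun 'I_k -> 'I_6}) (\prod_i M i (f i)) * w (bas f).
Proof.
have rowE (x : 'rV[R]_6) : x = \sum_j x 0 j *: delta_mx 0 j by apply: row_sum_delta.
have sumrow i N (I : finType) (F : I -> R) (X : I -> 'rV[R]_6) :
    w (setrow i (\sum_j F j *: X j) N) = \sum_j F j * w (setrow i (X j) N).
  have w0 : w (setrow i 0 N) = 0.
    by have := kform_setrow wk i N 0 0 0 0; rewrite !scale0r addr0 !mul0r addr0.
  elim/big_ind2: _ => // [x a y b ha hb|j _].
    by have := kform_setrow wk i N 1 1 a b; rewrite !scale1r !mul1r ha hb.
  by have := kform_setrow wk i N (F j) 0 (X j) 0; rewrite scaler0 addr0 mul0r addr0.
pose mixrow (l : seq 'I_k) (f : {ffun 'I_k -> 'I_6}) : 'M[R]_(k, 6) :=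
  \matrix_(i, j) if i \in l then (j == f i)%:R else M i j.
(* Off [l] the value of [f] is pinned to [ord0], so that each choice of columns for the rows already
   expanded is counted once. *)
pose fam (l : seq 'I_k) (f : {ffun 'I_k -> 'I_6}) :=
  [forall i, (i \notin l) ==> (f i == ord0)].
suff /(_ (enum 'I_k) (enum_uniq _)) H : forall l, uniq l ->
    w M = \sum_(f | fam l f) (\prod_(i <- l) M i (f i)) * w (mixrow l f).
  rewrite H; apply: eq_big => [f|f _].
    by apply/forallP=> i; rewrite mem_enum.
  rewrite big_enum /=; congr (_ * w _).
  by apply/matrixP=> i j; rewrite !mxE mem_enum.
elim=> [_|i l IH /= /andP[il lu]].
  rewrite (big_pred1 [ffun=> ord0]).
    rewrite big_nil mul1r; congr w; apply/matrixP=> i j; rewrite !mxE /=.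
    by [].
  move=> f; apply/forallP/eqP => [H|-> i]; last by rewrite ffunE eqxx implybT.
  by apply/ffunP=> i; rewrite ffunE; apply/eqP/(implyP (H i)).
rewrite IH //.
pose upd (f : {ffun 'I_k -> 'I_6}) (j : 'I_6) : {ffun 'I_k -> 'I_6} :=
  [ffun a => if a == i then j else f a].
transitivity (\sum_(f | fam l f) \sum_(j : 'I_6)
    (\prod_(a <- i :: l) M a (upd f j a)) * w (mixrow (i :: l) (upd f j))).
  apply: eq_bigr => f fl.
  rewrite -(setrow_id i (mixrow l f)) (_ : row i (mixrow l f) = row i M); last first.
    by apply/rowP=> b; rewrite !mxE (negbTE il).
  rewrite [row i M]rowE sumrow mulr_sumr; apply: eq_bigr => j _.
  rewrite big_cons !mxE ffunE eqxx mulrA [_ * M i j]mulrC; congr (_ * _ * w _).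
    apply: eq_big_seq => a al; rewrite ffunE; case: eqP => // ai.
    by rewrite -ai al in il.
  apply/matrixP=> a b; rewrite !mxE in_cons ffunE.
  by case: eqP => //= _; rewrite eqxx.
rewrite pair_big_dep /=.
rewrite (reindex_onto (fun p : {ffun 'I_k -> 'I_6} * 'I_6 => upd p.1 p.2)
   (fun f => (upd f ord0, f i))) /=.
  apply: eq_bigl => -[f j] /=; rewrite andbT.
  apply/idP/andP => [fl|[H /eqP[<- _]]].
    split; last first.
      apply/eqP; congr (_, _); last by rewrite ffunE eqxx.
      apply/ffunP=> a; rewrite !ffunE.
      by case: eqP => // ->; apply/esym/eqP/(implyP (forallP fl i)).
    apply/forallP=> a; apply/implyP; rewrite in_cons negb_or ffunE => /andP[ai al].
    by rewrite (negbTE ai); apply: (implyP (forallP fl a)).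
  apply/forallP=> a; apply/implyP=> al; rewrite ffunE; case: (altP (a =P i)) => [//|ai].
  by apply: (implyP (forallP H a)); rewrite in_cons negb_or ai.
move=> f fl; apply/ffunP=> a; rewrite !ffunE; case: eqP => // -> //.
Qed.

Lemma kform_inj0 k (w : kform R R k) (wk : is_kform w) (f : {ffun 'I_k -> 'I_6}) :
  ~~ injectiveb f -> w (bas f) = 0.
Proof.
case/injectivePn=> i [j ij fij]; apply: (kform_alt wk ij).
by apply/rowP=> b; rewrite !mxE fij.
Qed.

(** Only injective index maps survive in the expansion, and they are the permutations of the Leibniz
    formula. *)
Lemma kform_top (w : kform R R 6) (wk : is_kform w) (M : 'M[R]_6) :
  w M = \det M * w 1%:M.
Proof.
rewrite kform_expand // /determinant mulr_suml.
rewrite (bigID (fun f : {ffun 'I_6 -> 'I_6} => injectiveb f)) /= addrC big1 ?add0r; last first.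
  by move=> f /(kform_inj0 wk) ->; rewrite mulr0.
rewrite (reindex (fun s : 'S_6 => pval s)) /=; last first.
  pose g (f : {ffun 'I_6 -> 'I_6}) : 'S_6 := insubd (1%g : 'S_6) f.
  exists g => [s _|f fi]; last by rewrite /g insubdK.
  by apply: val_inj; rewrite /g insubdK //; apply: (valP s).
apply: eq_big => [s|s _]; first exact: (valP s).
have -> : bas (pval s) = row_perm s 1%:M.
  by apply/matrixP=> i j; rewrite !mxE -pvalE eq_sym.
rewrite kform_perm // mulrCA mulrA; congr (_ * _ * _).
by apply: eq_bigr => i _; rewrite -pvalE.
Qed.

(** Sorting the indices of a tuple of basis vectors costs only a sign. *)
Lemma kform_incr0 k (w : kform R R k) (wk : is_kform w) :
  (forall f : {ffun 'I_k -> 'I_6},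
     (forall i j : 'I_k, (i < j)%N -> (f i < f j)%N) -> w (bas f) = 0) ->
  forall M, w M = 0.
Proof.
move=> w0 M; rewrite kform_expand // big1 // => f _.
case: (boolP (injectiveb f)) => [/injectiveP fi|/(kform_inj0 wk) ->]; last first.
  by rewrite mulr0.
pose t := [tuple f i | i < k].
pose r := (fun x y : 'I_6 => x <= y)%N.
have st : size (sort r t) == k by rewrite size_sort size_tuple.
have /tuple_permP[s es] : perm_eq (sort r t) t by rewrite perm_sort.
pose g : {ffun 'I_k -> 'I_6} := [ffun i => f (s i)].
have gE i : g i = nth ord0 (sort r t) i.
  rewrite es -tnth_nth tnth_mktuple ffunE [RHS]tnth_mktuple //.
have -> : w (bas f) = (-1) ^+ s * w (bas g).
  have -> : bas g = row_perm s (bas f) by apply/matrixP=> i j; rewrite !mxE ffunE.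
  by rewrite kform_perm // mulrA -signr_addb addbb mul1r.
rewrite w0 ?mulr0 // => i j ij.
have ss : sorted r (sort r t) by apply: sort_sorted => x y; exact: leq_total.
have rt : transitive r by move=> y x z; exact: leq_trans.
have le : (g i <= g j)%N.
  rewrite !gE; apply: (sorted_leq_nth rt (fun x => leqnn x) ord0 ss); rewrite ?inE ?(eqP st) //.
  exact: ltnW.
rewrite ltn_neqAle le andbT; apply/negP => /eqP/val_inj.
rewrite !ffunE => /fi/perm_inj ije; by rewrite ije ltnn in ij.
Qed.

End Kforms.

(** * Wedge products and pullbacks of alternating forms *)

Section Wedge.
Variable R : realType.

Lemma usub_row_perm (p q n : nat) (s : 'S_(p + q)) (M : 'M[R]_(p + q, n)) :
  usubmx (row_perm s M) = \matrix_(i, j) M (s (lshift q i)) j.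
Proof. by apply/matrixP=> i j; rewrite !mxE. Qed.

Lemma dsub_row_perm (p q n : nat) (s : 'S_(p + q)) (M : 'M[R]_(p + q, n)) :
  dsubmx (row_perm s M) = \matrix_(i, j) M (s (rshift p i)) j.
Proof. by apply/matrixP=> i j; rewrite !mxE. Qed.

Lemma wedge_kform (p q : nat) (a : kform R R p) (b : kform R R q) :
  is_kform a -> is_kform b -> is_kform (wedge a b).
Proof.
move=> ak bk; split.
  move=> i A B C x y Ai Bi Ci; rewrite /wedge !mulr_sumr -big_split /=.
  apply: eq_bigr => s _.
  have AE l j : A l j = if l == i then x * B i j + y * C i j else B l j.
    case: (altP (l =P i)) => [->|li].
      by have /rowP/(_ j) := Ai; rewrite !mxE.
    rewrite eq_sym in li; have [l' ll' _] := unlift_some li.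
    by have /matrixP/(_ l' j) := Bi; rewrite !mxE -ll'.
  have BC l j : l != i -> C l j = B l j.
    move=> li; rewrite eq_sym in li; have [l' ll' _] := unlift_some li.
    have /matrixP/(_ l' j) := Bi; have /matrixP/(_ l' j) := Ci.
    by rewrite !mxE -ll' => -> ->.
  rewrite !usub_row_perm !dsub_row_perm.
  have lin c e P Q : c * (e * (x * P + y * Q)) = x * (c * (e * P)) + y * (c * (e * Q)).
    by ring.
  rewrite -lin; congr (_ * (_ * _)).
  (* For each permutation [s], row [i] is an argument of exactly one of the two factors. *)
  case: (split_ordP (s^-1 i)%g) => l el.
    have el' : s (lshift q l) = i by rewrite -el permKV.
    have sne m : s (rshift p m) != i.
      by rewrite -el' (inj_eq perm_inj) eq_sym eq_lrshift.
    have bE (X : 'M[R]_(p + q, 6)) : (forall l0 j, l0 != i -> X l0 j = B l0 j) ->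
        b (\matrix_(i0, j) X (s (rshift p i0)) j) =
        b (\matrix_(i0, j) B (s (rshift p i0)) j).
      by move=> H; congr b; apply/matrixP=> u v; rewrite !mxE H.
    rewrite !(bE A) ?(bE C) //; last by move=> l0 j /negbTE h; rewrite AE h.
    rewrite (kform_lin ak (i := l) (B := \matrix_(i0, j) B (s (lshift q i0)) j)
       (C := \matrix_(i0, j) C (s (lshift q i0)) j) (b := x) (c := y)).
    - by rewrite mulrDl !mulrA.
    - by apply/rowP=> j; rewrite !mxE el' AE eqxx.
    - apply/matrixP=> u v; rewrite !mxE AE ifN //.
      by rewrite -el' (inj_eq perm_inj) (inj_eq (@lshift_inj _ _)) eq_sym neq_lift.
    - apply/matrixP=> u v; rewrite !mxE AE ifN ?BC //.
        by rewrite -el' (inj_eq perm_inj) (inj_eq (@lshift_inj _ _)) eq_sym neq_lift.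
      by rewrite -el' (inj_eq perm_inj) (inj_eq (@lshift_inj _ _)) eq_sym neq_lift.
  have el' : s (rshift p l) = i by rewrite -el permKV.
  have sne m : s (lshift q m) != i.
    by rewrite -el' (inj_eq perm_inj) eq_lrshift.
  have aE (X : 'M[R]_(p + q, 6)) : (forall l0 j, l0 != i -> X l0 j = B l0 j) ->
      a (\matrix_(i0, j) X (s (lshift q i0)) j) =
      a (\matrix_(i0, j) B (s (lshift q i0)) j).
    by move=> H; congr a; apply/matrixP=> u v; rewrite !mxE H.
  rewrite !(aE A) ?(aE C) //; last by move=> l0 j /negbTE h; rewrite AE h.
  rewrite (kform_lin bk (i := l) (B := \matrix_(i0, j) B (s (rshift p i0)) j)
     (C := \matrix_(i0, j) C (s (rshift p i0)) j) (b := x) (c := y)).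
  - by rewrite mulrDr !mulrA ![_ * x]mulrC ![_ * y]mulrC -!mulrA.
  - by apply/rowP=> j; rewrite !mxE el' AE eqxx.
  - apply/matrixP=> u v; rewrite !mxE AE ifN //.
    by rewrite -el' (inj_eq perm_inj) (inj_eq (@rshift_inj _ _)) eq_sym neq_lift.
  - apply/matrixP=> u v; rewrite !mxE AE ifN ?BC //.
      by rewrite -el' (inj_eq perm_inj) (inj_eq (@rshift_inj _ _)) eq_sym neq_lift.
    by rewrite -el' (inj_eq perm_inj) (inj_eq (@rshift_inj _ _)) eq_sym neq_lift.
move=> M i j ij Mij; rewrite /wedge.
set S := \sum_s _; suff S0 : S = - S.
  have : S + S = 0 by rewrite {1}S0 addNr.
  by rewrite -mulr2n => /eqP; rewrite mulrn_eq0 /= => /eqP ->; rewrite mulr0.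
(* Composing with the transposition of the two equal rows flips every sign and keeps every value. *)
rewrite {1}/S (reindex_inj (mulIg (tperm i j))) /= -sumrN; apply: eq_bigr => s _.
have -> : row_perm (s * tperm i j) M = row_perm s M.
  apply/matrixP=> u v; rewrite !mxE permM.
  have /rowP/(_ v) := Mij; rewrite !mxE => e.
  by case: tpermP => [->|->|].
by rewrite odd_permM odd_tperm ij addbT signrN mulNr.
Qed.

Lemma pullback_kform k (P : 'M[R]_6) (w : kform R R k) :
  is_kform w -> is_kform (pullback P w).
Proof.
move=> [wl wa]; split=> [i A B C b c Ai Bi Ci|M i j ij Mij]; rewrite /pullback.
  apply: (wl i).
  - by rewrite !row_mul Ai mulmxDl !scalemxAl.
  - by rewrite !row'Esub -!mul_rowsub_mx -!row'Esub Bi.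
  - by rewrite !row'Esub -!mul_rowsub_mx -!row'Esub Ci.
by apply: (wa _ i j) => //; rewrite !row_mul Mij.
Qed.

End Wedge.

(** * Peeling arguments off a wedge product *)

Section Peel.
Variable R : realType.
Local Notation V := 'rV[R]_6.

(** A permutation amounts to the image of [i0] and a permutation of the rest. Iterating this splits
    the sum in a wedge product one argument at a time. *)
Lemma sum_lift_perm (K : nmodType) n (i0 : 'I_n.+1) (F : 'S_n.+1 -> K) :
  \sum_s F s = \sum_i \sum_(t : 'S_n) F (lift_perm i0 i t).
Proof.
rewrite pair_bigA /= (reindex (fun p : 'I_n.+1 * 'S_n => lift_perm i0 p.1 p.2)) //.
apply: onW_bij; apply: inj_card_bij.
  move=> [i s] [j t] /= /permP st.
  have ij : i = j by have := st i0; rewrite !lift_perm_id.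
  congr (_, _) => //; apply/permP=> k.
  by have := st (lift i0 k); rewrite !lift_perm_lift ij => /lift_inj.
by rewrite card_prod card_ord !card_Sn factS.
Qed.

(** With the arguments of a form in a list, deleting a row becomes an operation on lists that
    computes. *)
Definition mxl k (l : seq V) : 'M[R]_(k, 6) := \matrix_(i, j) (nth 0 l i) 0 j.

Lemma row_mxl k (i : 'I_k) l : row i (mxl k l) = nth 0 l i.
Proof. by apply/rowP=> j; rewrite !mxE. Qed.

Lemma row'_mxl k (i : 'I_k.+1) l : size l = k.+1 ->
  row' i (mxl k.+1 l) = mxl k (take i l ++ drop i.+1 l).
Proof.
move=> sl; apply/matrixP=> a b; rewrite !mxE nth_cat size_takel ?sl ?(ltnW (ltn_ord i)) //=.
congr (_ _ _); rewrite /bump; case: ltnP => [ai|ia]; first by rewrite nth_take.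
by rewrite nth_drop addSn subnKC.
Qed.

Lemma col_mxl k (x : V) l : col_mx x (mxl k l) = mxl (1 + k) (x :: l).
Proof.
apply/matrixP=> a b; case: (split_ordP a) => c ->.
  by rewrite col_mxEu !mxE /= !ord1.
by rewrite col_mxEd !mxE.
Qed.

Lemma mxl_rows k (M : 'M[R]_(k, 6)) : M = mxl k [seq row i M | i <- enum 'I_k].
Proof.
apply/matrixP=> i j; rewrite mxE (nth_map i) ?size_enum_ord //.
by rewrite nth_ord_enum mxE.
Qed.

Lemma wedge1 q (a : kform R R 1) (b : kform R R q) (bk : is_kform b) M :
  wedge a b M = \sum_(i < q.+1) (-1) ^+ i * (a (row i M) * b (row' i (M : 'M_(q.+1, 6)))).
Proof.
rewrite /wedge (@sum_lift_perm _ q ord0) mulr_sumr; apply: eq_bigr => i _.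
rewrite (eq_bigr (fun=> (-1) ^+ i * (a (row i M) * b (row' i (M : 'M_(q.+1, 6)))))); last first.
  move=> t _.
  have -> : usubmx (row_perm (lift_perm ord0 i t) M : 'M_(1 + q, _)) = row i M.
    apply/matrixP=> u v; rewrite !mxE !ord1 (_ : lshift q 0 = ord0) ?lift_perm_id //.
    exact: val_inj.
  have -> : dsubmx (row_perm (lift_perm ord0 i t) M : 'M_(1 + q, _)) = row_perm t (row' i (M : 'M_(q.+1, 6))).
    apply/matrixP=> u v; rewrite !mxE (_ : rshift 1 u = lift ord0 u) ?lift_perm_lift //.
    exact: val_inj.
  rewrite (kform_perm bk) odd_lift_perm /=; move: (odd_perm t) => o.
  rewrite !signr_addb !signr_odd.
  set e := (-1) ^+ o; have ee : e * e = 1 by rewrite -signr_addb addbb.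
  move: (a _) (b _) ((-1) ^+ i) => A B x.
  by transitivity (e * e * (x * (A * B))); [ring|rewrite ee mul1r].
rewrite sumr_const card_Sn (_ : 1`! = 1)%N // mul1n -(mulr_natl (_ * _)) mulKf //.
by rewrite pnatr_eq0 -lt0n fact_gt0.
Qed.

Lemma wedge11 (K : fieldType) (a b : kform R K 1) M :
  wedge a b M = a (row ord0 M) * b (row ord_max M) - a (row ord_max M) * b (row ord0 M).
Proof.
have S1 (F : 'S_1 -> K) : \sum_t F t = F 1%g.
  by rewrite (big_pred1 1%g) // => t; rewrite (permS1 t) /= eqxx.
rewrite /wedge (_ : (1`! * 1`!)%N = 1%N) // invr1 mul1r (@sum_lift_perm _ 1 ord0).
rewrite !big_ord_recl big_ord0 /= addr0 !S1 !odd_lift_perm odd_perm1 /= expr0 expr1 mul1r mulN1r.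
have r0 (t : 'S_(1 + 1)) : usubmx (row_perm t M) = row (t ord0) M.
  by apply/matrixP=> i j; rewrite !mxE !ord1; congr (M (t _) _); apply: val_inj.
have r1 (t : 'S_(1 + 1)) : dsubmx (row_perm t M) = row (t ord_max) M.
  by apply/matrixP=> i j; rewrite !mxE !ord1; congr (M (t _) _); apply: val_inj.
have om : ord_max = lift ord0 ord0 :> 'I_2 by apply: val_inj.
rewrite !r0 !r1 om !lift_perm_id !lift_perm_lift !perm1.
by congr (_ * b (row _ _) - a (row _ _) * b (row _ _)); apply: val_inj.
Qed.

(** Only the permutations of the arguments of [b] are collapsed; both orders of the arguments of [a]
    remain in the double sum, whence the factor 1/2. *)
Lemma wedge2 q (a : kform R R 2) (b : kform R R q) (bk : is_kform b) M :
  wedge a b M = 2%:R^-1 * \sum_(i < q.+2) \sum_(j < q.+1) (-1) ^+ (i + j) *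
    (a (mxl 2 [:: row i M; row j (row' i (M : 'M_(q.+2, 6)))])
     * b (row' j (row' i (M : 'M_(q.+2, 6))))).
Proof.
rewrite /wedge (@sum_lift_perm _ q.+1 ord0) !mulr_sumr; apply: eq_bigr => i _.
rewrite (@sum_lift_perm _ q ord0) !mulr_sumr; apply: eq_bigr => j _.
set N := row' i (M : 'M_(q.+2, 6)); set X := a (mxl 2 _) * _.
rewrite (eq_bigr (fun=> (-1) ^+ (i + j) * X)); last first.
  move=> t _.
  have -> : usubmx (row_perm (lift_perm ord0 i (lift_perm ord0 j t)) M : 'M_(2 + q, _)) = mxl 2 [:: row i M; row j N].
    apply/matrixP=> u v; rewrite !mxE; case: u => [[|[|//]] u2] /=; rewrite mxE.
      by rewrite (_ : @lshift 2 q _ = (ord0 : 'I_(q.+2))) ?lift_perm_id //; exact: val_inj.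
    rewrite (_ : @lshift 2 q _ = lift (ord0 : 'I_(q.+2)) ord0) ?lift_perm_lift ?lift_perm_id ?mxE //.
    exact: val_inj.
  have -> : dsubmx (row_perm (lift_perm ord0 i (lift_perm ord0 j t)) M : 'M_(2 + q, _)) = row_perm t (row' j N).
    apply/matrixP=> u v; rewrite !mxE.
    by rewrite (_ : @rshift 2 q u = lift ord0 (lift ord0 u)) ?lift_perm_lift //; exact: val_inj.
  rewrite (kform_perm bk) !odd_lift_perm /=; move: (odd_perm t) => o.
  rewrite !signr_addb !signr_odd exprD /X.
  set e := (-1) ^+ o; have ee : e * e = 1 by rewrite -signr_addb addbb.
  move: (a _) (b _) ((-1) ^+ i) ((-1) ^+ j) => A B x y.
  by transitivity (e * e * (x * y * (A * B))); [ring|rewrite ee mul1r].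
rewrite sumr_const card_Sn -(mulr_natl (_ * _)) natrM invfM -mulrA mulKf //.
by rewrite pnatr_eq0 -lt0n fact_gt0.
Qed.

(** The 2-form occupies the last two slots, so the peeling starts at [ord_max]: the parities of
    [5 + i] and [4 + j] account for the minus sign. *)
Lemma wedge2r (a : kform R R 4) (b : kform R R 2) (ak : is_kform a) (M : 'M[R]_6) :
  wedge a b M = 2%:R^-1 * \sum_(i < 6) \sum_(j < 5) - (-1) ^+ (i + j) *
    (a (row' j (row' i M)) * b (mxl 2 [:: row j (row' i M); row i M])).
Proof.
rewrite /wedge (@sum_lift_perm _ 5 ord_max) !mulr_sumr; apply: eq_bigr => i _.
rewrite (@sum_lift_perm _ 4 ord_max) !mulr_sumr; apply: eq_bigr => j _.
set N := row' i M; set X := a _ * b (mxl 2 _).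
rewrite (eq_bigr (fun=> - (-1) ^+ (i + j) * X)); last first.
  move=> t _.
  have -> : dsubmx (row_perm (lift_perm ord_max i (lift_perm ord_max j t)) M : 'M_(4 + 2, _))
      = mxl 2 [:: row j N; row i M].
    apply/matrixP=> u v; rewrite !mxE; case: u => [[|[|//]] u2] /=; rewrite mxE.
      rewrite (_ : @rshift 4 2 _ = lift ord_max ord_max) ?lift_perm_lift ?lift_perm_id ?mxE //.
      exact: val_inj.
    by rewrite (_ : @rshift 4 2 _ = ord_max) ?lift_perm_id //; exact: val_inj.
  have -> : usubmx (row_perm (lift_perm ord_max i (lift_perm ord_max j t)) M : 'M_(4 + 2, _))
      = row_perm t (row' j N).
    apply/matrixP=> u v; rewrite !mxE.
    rewrite (_ : @lshift 4 2 u = lift ord_max (lift ord_max u)) ?lift_perm_lift //.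
    by apply: val_inj; rewrite /= /bump; have := ltn_ord u; lia.
  rewrite (kform_perm ak) !odd_lift_perm /=; move: (odd_perm t) => o.
  rewrite !signr_addb !signr_odd exprD /X.
  set e := (-1) ^+ o; have ee : e * e = 1 by rewrite -signr_addb addbb.
  rewrite signrN signr_odd; move: (a _) (b _) ((-1) ^+ i) ((-1) ^+ j) => A B x y.
  by transitivity (e * e * (- (x * y) * (A * B))); [ring|rewrite ee mul1r].
rewrite sumr_const card_Sn -(mulr_natl (_ * _)) natrM [_ * (2`!)%:R]mulrC invfM -mulrA mulKf //.
by rewrite pnatr_eq0.
Qed.

End Peel.

(** * Coordinates *)

Section Coefs.
Variable R : realType.
Local Notation V := 'rV[R]_6.

(** Indices are natural numbers so that expressions in them reduce by computation; an index of 6 or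
    more gives the zero vector. *)
Definition ev (n : nat) : V := \row_j (j == n :> nat)%:R.
Definition bm k (l : seq nat) : 'M[R]_(k, 6) := mxl k (map ev l).
Definition del (i : nat) (T : Type) (l : seq T) := take i l ++ drop i.+1 l.
(** Unlike a big operator, this sum unfolds under [/=] into explicit terms that [ring] can read. *)
Definition fsum (n : nat) (F : nat -> R) : R := foldr (fun i s => F i + s) 0 (iota 0 n).
Definition coef k (w : kform R R k) (l : seq nat) : R := w (bm k l).

Lemma fsumE n F : fsum n F = \sum_(i < n) F i.
Proof.
rewrite /fsum -(big_mkord xpredT F) unlock /reducebig /index_iota subn0.
by elim: (iota 0 n) => //= i s ->.
Qed.

Lemma row_bm k (i : 'I_k) l : size l = k -> row i (bm k l) = ev (nth 0%N l i).
Proof. by move=> sl; rewrite row_mxl (nth_map 0%N) ?sl. Qed.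

Lemma row'_bm k (i : 'I_k.+1) l : size l = k.+1 -> row' i (bm k.+1 l) = bm k (del i l).
Proof.
by move=> sl; rewrite row'_mxl ?size_map // /bm /del map_cat map_take map_drop.
Qed.

Lemma size_del (T : Type) i (l : seq T) n : (i < n.+1)%N -> size l = n.+1 -> size (del i l) = n.
Proof.
by move=> lt sl; rewrite size_cat size_drop sl size_takel ?sl 1?ltnW // subSS subnKC.
Qed.

Lemma bm1 : bm 6 (iota 0 6) = 1%:M.
Proof.
apply/matrixP=> i j; rewrite !mxE (nth_map 0%N) ?size_iota // mxE nth_iota //.
by rewrite add0n eq_sym.
Qed.

Lemma ev_delta (i : 'I_6) : ev i = delta_mx 0 i.
Proof. by apply/rowP=> j; rewrite !mxE eqxx. Qed.

(* The alternating extension of a function given on increasing triples. *)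
Definition nf (r : seq nat -> R) (l : seq nat) : R :=
  if l is [:: a; b; c] then
    match Nat.compare a b, Nat.compare b c, Nat.compare a c with
    | Lt, Lt, _ => r [:: a; b; c]
    | Lt, Gt, Lt => - r [:: a; c; b]
    | Lt, Gt, Gt => r [:: c; a; b]
    | Gt, _, Lt => - r [:: b; a; c]
    | Gt, Lt, Gt => r [:: b; c; a]
    | Gt, Gt, _ => - r [:: c; b; a]
    | _, _, _ => 0
    end
  else 0.

Lemma mxl_alt k (w : kform R R k) (wk : is_kform w) (i j : 'I_k) l :
  i != j -> nth 0 l i = nth 0 l j -> w (mxl k l) = 0.
Proof. by move=> ij e; apply: (kform_alt wk ij); rewrite !row_mxl. Qed.

Lemma mxl_swap k (w : kform R R k) (wk : is_kform w) (i j : 'I_k) l l' :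
  i != j -> nth 0 l' i = nth 0 l j -> nth 0 l' j = nth 0 l i ->
  (forall a : 'I_k, a != i -> a != j -> nth 0 l' a = nth 0 l a) ->
  w (mxl k l') = - w (mxl k l).
Proof.
move=> ij e1 e2 e3; rewrite -(kform_tperm wk (mxl k l) ij); congr w.
apply/matrixP=> a b; rewrite !mxE; congr (_ _ _).
case: (tpermP i j a) => [->|->|ai aj]; rewrite ?e1 ?e2 //.
by rewrite e3 //; apply/eqP.
Qed.

Section Three.
Variables (w : kform R R 3) (wk : is_kform w).
Let T x y z := w (mxl 3 [:: x; y; z]).

Lemma w3_swap01 x y z : T y x z = - T x y z.
Proof.
apply: (mxl_swap wk (i := ord0) (j := inord 1)); rewrite ?inordK //.
  by rewrite -val_eqE /= inordK.
case=> [[|[|[|//]]] h] //=; rewrite -!val_eqE /= ?inordK //.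
Qed.
Lemma w3_swap12 x y z : T x z y = - T x y z.
Proof.
apply: (mxl_swap wk (i := inord 1) (j := inord 2)); rewrite ?inordK //.
  by rewrite -val_eqE /= !inordK.
case=> [[|[|[|//]]] h] //=; rewrite -!val_eqE /= ?inordK //.
Qed.
Lemma w3_eq01 x z : T x x z = 0.
Proof.
apply: (mxl_alt wk (i := ord0) (j := inord 1)); rewrite ?inordK //.
by rewrite -val_eqE /= inordK.
Qed.
Lemma w3_eq12 x z : T x z z = 0.
Proof.
apply: (mxl_alt wk (i := inord 1) (j := inord 2)); rewrite ?inordK //.
by rewrite -val_eqE /= !inordK.
Qed.
Lemma w3_eq02 x z : T x z x = 0.
Proof. by rewrite w3_swap12 w3_eq01 oppr0. Qed.

Lemma w3_lin0 b c x x' y z : T (b *: x + c *: x') y z = b * T x y z + c * T x' y z.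
Proof.
apply: (kform_lin wk (i := ord0)); rewrite ?row_mxl ?row'_mxl //.
Qed.
Lemma w3_lin1 b c x y y' z : T x (b *: y + c *: y') z = b * T x y z + c * T x y' z.
Proof. by rewrite w3_swap01 w3_lin0 !(w3_swap01 _ x); ring. Qed.
Lemma w3_lin2 b c x y z z' : T x y (b *: z + c *: z') = b * T x y z + c * T x y z'.
Proof. by rewrite w3_swap12 w3_lin1 !(w3_swap12 x _ y); ring. Qed.

Lemma w3_sum0 (n : nat) (F : 'I_n -> R) (X : 'I_n -> V) y z :
  T (\sum_i F i *: X i) y z = \sum_i F i * T (X i) y z.
Proof.
have T0 : T 0 y z = 0.
  by have := w3_lin0 0 0 0 0 y z; rewrite !scale0r addr0 !mul0r addr0.
elim/big_ind2: _ => // [x a x' b <- <-|i _].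
  by have := w3_lin0 1 1 a b y z; rewrite !scale1r !mul1r.
by have := w3_lin0 (F i) 0 (X i) 0 y z; rewrite scaler0 addr0 mul0r addr0.
Qed.

Lemma coefE l : size l = 3 -> coef w l = nf (coef w) l.
Proof.
case: l => [|a [|b [|c [|//]]]] // _; rewrite /nf /coef /bm /=.
case: (PeanoNat.Nat.compare_spec a b) => [->|ab|ab];
  case: (PeanoNat.Nat.compare_spec b c) => [e|bc|bc];
  case: (PeanoNat.Nat.compare_spec a c) => [e'|ac|ac];
  rewrite ?e ?e'; try (by exfalso; lia);
  rewrite -1?[w (mxl 3 [:: _; _; ev c])]/(T _ _ _) -?[w (mxl 3 [:: _; _; _])]/(T _ _ _);
  rewrite ?w3_eq01 ?w3_eq12 ?w3_eq02 //.
- by rewrite w3_swap12.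
- by rewrite w3_swap12 w3_swap01 opprK.
- by rewrite w3_swap01.
- by rewrite w3_swap01 w3_swap12 opprK.
- by rewrite w3_swap01 w3_swap12 w3_swap01 opprK.
Qed.

End Three.

Lemma contractE k (v : V) (w : kform R R k.+1) M :
  Defs.contract v w M =
  w (\matrix_(i < k.+1, j < 6) if unlift ord0 i is Some i' then M i' j else v 0 j).
Proof.
rewrite /Defs.contract; congr w; apply/matrixP=> i j; rewrite [RHS]mxE.
case: unliftP => [i'|] ->.
  have -> : lift ord0 i' = @rshift 1 k i' by exact: val_inj.
  exact: (@col_mxEd _ 1 k 6 v M i' j).
have -> : ord0 = @lshift 1 k ord0 by exact: val_inj.
exact: (@col_mxEu _ 1 k 6 v M ord0 j).
Qed.

Lemma contract_kform k (v : V) (w : kform R R k.+1) :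
  is_kform w -> is_kform (Defs.contract v w).
Proof.
move=> wk; split=> [i A B C b c Ai Bi Ci|M i j ij Mij]; rewrite !contractE.
  have E (X Y : 'M[R]_(k, 6)) : row' i X = row' i Y -> forall a d, a != i -> X a d = Y a d.
    move=> XY a d; rewrite eq_sym => /unlift_some[a' -> _].
    by move/matrixP: XY => /(_ a' d); rewrite !mxE.
  apply: (kform_lin wk (i := lift ord0 i)).
  - apply/rowP=> d; rewrite !mxE liftK.
    by have /rowP/(_ d) := Ai; rewrite !mxE.
  - apply/matrixP=> a d; rewrite !mxE; case: unliftP => // a' e.
    rewrite (E _ _ Bi) //; apply/eqP=> ai; have := neq_lift (lift ord0 i) a.
    by rewrite e ai eqxx.
  - apply/matrixP=> a d; rewrite !mxE; case: unliftP => // a' e.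
    rewrite (E _ _ Ci) //; apply/eqP=> ai; have := neq_lift (lift ord0 i) a.
    by rewrite e ai eqxx.
apply: (kform_alt wk (i := lift ord0 i) (j := lift ord0 j)).
  by rewrite (inj_eq lift_inj).
apply/rowP=> d; rewrite !mxE !liftK.
by have /rowP/(_ d) := Mij; rewrite !mxE.
Qed.

Lemma contract_bm k (w : kform R R k.+1) i l : Defs.contract (ev i) w (bm k l) = coef w (i :: l).
Proof. by rewrite /Defs.contract /bm col_mxl. Qed.

Lemma wedge1_bm (k : nat) (xi : kform R R 5) (xk : is_kform xi) : (k < 6)%N ->
  wedge (e1 k.+1) xi (1%:M : 'M_6) = (-1) ^+ k * coef xi (del k (iota 0 6)).
Proof.
move=> k6; rewrite wedge1 // -bm1.
have rI (i : 'I_6) : row i (bm 6 (iota 0 6)) = ev i by rewrite row_bm ?nth_iota.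
have rI' (i : 'I_6) : row' i (bm 6 (iota 0 6)) = bm 5 (del i (iota 0 6)) by rewrite row'_bm.
set N := bm 6 _ in rI rI' *; set D := del k _.
rewrite (bigD1 (Ordinal k6)) //= big1 => [|i ik].
  by rewrite addr0 rI rI' /e1 !mxE inordK // eqxx mul1r.
rewrite rI /e1 !mxE inordK // eq_sym -(inj_eq val_inj) in ik *.
by rewrite (_ : (k == i :> nat) = false) ?mul0r ?mulr0 //; exact: negbTE.
Qed.

Lemma wedge2_bm q (a : kform R R 2) (b : kform R R q) (bk : is_kform b) l : size l = q.+2 ->
  wedge a b (bm (2 + q) l) = 2%:R^-1 * fsum q.+2 (fun i => fsum q.+1 (fun j =>
    (-1) ^+ (i + j) * (coef a [:: nth 0%N l i; nth 0%N (del i l) j] *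
                       coef b (del j (del i l))))).
Proof.
move=> sl; rewrite wedge2 // fsumE; congr (_ * _); apply: eq_bigr => i _.
rewrite fsumE; apply: eq_bigr => j _.
have sd := size_del (ltn_ord i) sl.
by rewrite row'_bm // row'_bm // !row_bm.
Qed.

(** The entry [(i, k)] of K before division by the volume of the standard frame: the top coefficient
    of e^k /\ (e_i contracted with rho) /\ rho, expanded over the frame without e_k. *)
Definition Kc (r : seq nat -> R) (i k : nat) : R :=
  let S := del k (iota 0 6) in
  (-1) ^+ k * (2%:R^-1 * fsum 5 (fun a => fsum 4 (fun b =>
    (-1) ^+ (a + b) * (r [:: i; nth 0%N S a; nth 0%N (del a S) b] *
                       r (del b (del a S)))))).

Lemma K_entry nu (w : kform R R 3) (wk : is_kform w) (i k : 'I_6) :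
  K_of nu w i k = Kc (coef w) i k / nu 1%:M.
Proof.
rewrite /K_of mxE /A_iso mxE -ev_delta wedge1_bm //; last first.
  exact: (@wedge_kform _ 2 3 _ _ (contract_kform _ wk) wk).
congr (_ * _ / _); rewrite /coef wedge2_bm ?size_del //; last first.
  by rewrite (@size_del _ k _ 5) // size_iota.
congr (_ * _); rewrite !fsumE; apply: eq_bigr => a _; rewrite !fsumE.
by apply: eq_bigr => b _; rewrite {1}/coef contract_bm.
Qed.

End Coefs.

(** * The Chevalley-Eilenberg differential of a 3-form *)

Section Differential.
Variable R : realType.
Local Notation V := 'rV[R]_6.

(** The Jacobi identity is kept apart, because the bracket read off an arbitrary table of structure
    constants satisfies just these conditions. *)
Definition bilinear_alt (br : bracket R) : Prop :=
  [/\ forall (a : R) (x y z : V), br (a *: x + y) z = a *: br x z + br y z,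
      forall (a : R) (x y z : V), br x (a *: y + z) = a *: br x y + br x z
    & forall x : V, br x x = 0].

Lemma lie_bilin br : is_lie_bracket br -> bilinear_alt br.
Proof. by case. Qed.

Section Br.
Variables (br : bracket R) (brP : bilinear_alt br).

Lemma brDl x y z : br (x + y) z = br x z + br y z.
Proof. by case: brP => l _ _; have := l 1 x y z; rewrite !scale1r. Qed.
Lemma brDr x y z : br x (y + z) = br x y + br x z.
Proof. by case: brP => _ l _; have := l 1 x y z; rewrite !scale1r. Qed.
Lemma br0l z : br 0 z = 0.
Proof. by have := brDl 0 0 z; rewrite addr0 => /eqP; rewrite -subr_eq subrr => /eqP. Qed.
Lemma br0r z : br z 0 = 0.
Proof. by have := brDr z 0 0; rewrite addr0 => /eqP; rewrite -subr_eq subrr => /eqP. Qed.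
Lemma brZl a x z : br (a *: x) z = a *: br x z.
Proof. by case: brP => l _ _; have := l a x 0 z; rewrite addr0 br0l addr0. Qed.
Lemma brZr a x z : br x (a *: z) = a *: br x z.
Proof. by case: brP => _ l _; have := l a x z 0; rewrite addr0 br0r addr0. Qed.
Lemma brxx x : br x x = 0.
Proof. by case: brP. Qed.
Lemma brC x y : br y x = - br x y.
Proof.
have := brxx (x + y); rewrite brDl !brDr !brxx add0r addr0 addrC => /eqP.
by rewrite addr_eq0 => /eqP.
Qed.
Lemma brNl x z : br (- x) z = - br x z.
Proof. by rewrite -scaleN1r brZl scaleN1r. Qed.
Lemma brNr x z : br x (- z) = - br x z.
Proof. by rewrite -scaleN1r brZr scaleN1r. Qed.

Section D3.
Variables (w : kform R R 3) (wk : is_kform w).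
Let T x y z := w (mxl 3 [:: x; y; z]).

Definition ce4 (x0 x1 x2 x3 : V) : R :=
  - T (br x0 x1) x2 x3 + T (br x0 x2) x1 x3 - T (br x0 x3) x1 x2
  - T (br x1 x2) x0 x3 + T (br x1 x3) x0 x2 - T (br x2 x3) x0 x1.

Lemma ce_d4 l : size l = 4 -> ce_d br w (mxl 4 l) =
  ce4 (nth 0 l 0) (nth 0 l 1) (nth 0 l 2) (nth 0 l 3).
Proof.
case: l => [|x0 [|x1 [|x2 [|x3 [|//]]]]] // _; rewrite /ce_d /ce4.
under eq_bigr => j _ do rewrite big_mkcond /=.
under eq_bigr => j _ do under eq_bigr => i _ do
  rewrite row'_mxl // row'_mxl ?size_cat ?size_drop ?size_takel ?(ltnW (ltn_ord j)) //
    ?subSS ?subnKC -1?ltnS // col_mxl !row_mxl.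
by rewrite !(big_ord_recl, big_ord0) /= /bump /= /T; ring.
Qed.


Lemma ce_d4M M : ce_d br w M =
  ce4 (row ord0 M) (row (inord 1) M) (row (inord 2) M) (row (inord 3) M).
Proof.
have -> : M = mxl 4 [:: row ord0 M; row (inord 1) M; row (inord 2) M; row (inord 3) M].
  apply/matrixP=> i j; rewrite !mxE.
  case: i => [[|[|[|[|//]]]] h] /=; rewrite mxE; congr (M _ _); apply: val_inj;
    by rewrite /= ?inordK.
by rewrite ce_d4 // !row_mxl !inordK.
Qed.

Lemma ce_d_kform : is_kform (ce_d br w).
Proof.
have T01 := w3_swap01 wk; have T12 := w3_swap12 wk.
have E01 := w3_eq01 wk; have E12 := w3_eq12 wk; have E02 := w3_eq02 wk.
have ord4 (P : 'I_4 -> Type) : P ord0 -> P (inord 1) -> P (inord 2) -> P (inord 3) ->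
    forall i, P i.
  move=> P0 P1 P2 P3 [[|[|[|[|//]]]] h].
  - by rewrite (_ : Ordinal h = ord0) //; exact: val_inj.
  - by rewrite (_ : Ordinal h = inord 1) //; apply: val_inj; rewrite /= inordK.
  - by rewrite (_ : Ordinal h = inord 2) //; apply: val_inj; rewrite /= inordK.
  - by rewrite (_ : Ordinal h = inord 3) //; apply: val_inj; rewrite /= inordK.
split.
  move=> i A B C b c Ai Bi Ci; rewrite !ce_d4M.
  have E (X Y : 'M[R]_(4, 6)) : row' i X = row' i Y -> forall a, a != i -> row a X = row a Y.
    move=> XY a; rewrite eq_sym => /unlift_some[a' -> _]; apply/rowP=> d.
    by move/matrixP: XY => /(_ a' d); rewrite !mxE.
  have {}Bi := E _ _ Bi; have {}Ci := E _ _ Ci.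
  have L0 := w3_lin0 wk; have L1 := w3_lin1 wk; have L2 := w3_lin2 wk.
  have bl x y z : br (b *: x + c *: y) z = b *: br x z + c *: br y z.
    by rewrite brDl !brZl.
  have bL x y z : br z (b *: x + c *: y) = b *: br z x + c *: br z y.
    by rewrite brDr !brZr.
  move: i Ai Bi Ci {E}; apply: ord4 => Ai Bi Ci.
  - have ne : forall m : 'I_4, (m != 0%N :> nat) -> m != ord0 by move=> m; rewrite -val_eqE.
    have B1 : row (inord 1) B = row (inord 1) A by apply/Bi/ne; rewrite ?inordK.
    have C1 : row (inord 1) C = row (inord 1) A by apply/Ci/ne; rewrite ?inordK.
    have B2 : row (inord 2) B = row (inord 2) A by apply/Bi/ne; rewrite ?inordK.
    have C2 : row (inord 2) C = row (inord 2) A by apply/Ci/ne; rewrite ?inordK.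
    have B3 : row (inord 3) B = row (inord 3) A by apply/Bi/ne; rewrite ?inordK.
    have C3 : row (inord 3) C = row (inord 3) A by apply/Ci/ne; rewrite ?inordK.
    rewrite B1 C1 B2 C2 B3 C3 Ai.
    by rewrite /ce4 ?bl ?bL /T !(L0, L1, L2); ring.
  - have ne : forall m : 'I_4, (m != 1%N :> nat) -> m != (inord 1) by move=> m; rewrite -val_eqE /= inordK.
    have B0 : row ord0 B = row ord0 A by apply/Bi/ne; rewrite ?inordK.
    have C0 : row ord0 C = row ord0 A by apply/Ci/ne; rewrite ?inordK.
    have B2 : row (inord 2) B = row (inord 2) A by apply/Bi/ne; rewrite ?inordK.
    have C2 : row (inord 2) C = row (inord 2) A by apply/Ci/ne; rewrite ?inordK.
    have B3 : row (inord 3) B = row (inord 3) A by apply/Bi/ne; rewrite ?inordK.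
    have C3 : row (inord 3) C = row (inord 3) A by apply/Ci/ne; rewrite ?inordK.
    rewrite B0 C0 B2 C2 B3 C3 Ai.
    by rewrite /ce4 ?bl ?bL /T !(L0, L1, L2); ring.
  - have ne : forall m : 'I_4, (m != 2%N :> nat) -> m != (inord 2) by move=> m; rewrite -val_eqE /= inordK.
    have B0 : row ord0 B = row ord0 A by apply/Bi/ne; rewrite ?inordK.
    have C0 : row ord0 C = row ord0 A by apply/Ci/ne; rewrite ?inordK.
    have B1 : row (inord 1) B = row (inord 1) A by apply/Bi/ne; rewrite ?inordK.
    have C1 : row (inord 1) C = row (inord 1) A by apply/Ci/ne; rewrite ?inordK.
    have B3 : row (inord 3) B = row (inord 3) A by apply/Bi/ne; rewrite ?inordK.
    have C3 : row (inord 3) C = row (inord 3) A by apply/Ci/ne; rewrite ?inordK.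
    rewrite B0 C0 B1 C1 B3 C3 Ai.
    by rewrite /ce4 ?bl ?bL /T !(L0, L1, L2); ring.
  - have ne : forall m : 'I_4, (m != 3%N :> nat) -> m != (inord 3) by move=> m; rewrite -val_eqE /= inordK.
    have B0 : row ord0 B = row ord0 A by apply/Bi/ne; rewrite ?inordK.
    have C0 : row ord0 C = row ord0 A by apply/Ci/ne; rewrite ?inordK.
    have B1 : row (inord 1) B = row (inord 1) A by apply/Bi/ne; rewrite ?inordK.
    have C1 : row (inord 1) C = row (inord 1) A by apply/Ci/ne; rewrite ?inordK.
    have B2 : row (inord 2) B = row (inord 2) A by apply/Bi/ne; rewrite ?inordK.
    have C2 : row (inord 2) C = row (inord 2) A by apply/Ci/ne; rewrite ?inordK.
    rewrite B0 C0 B1 C1 B2 C2 Ai.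
    by rewrite /ce4 ?bl ?bL /T !(L0, L1, L2); ring.
have TN x y z : T (- x) y z = - T x y z.
  by have := w3_lin0 wk (-1) 0 x 0 y z; rewrite scaler0 addr0 scaleN1r mul0r addr0 mulN1r.
have E0 x y : T x y y = 0 by exact: E12.
have T0 y z : T 0 y z = 0 by have := TN 0 y z; rewrite oppr0; lra.
have S x y z : T x z y = - T x y z by exact: T12.
have sym M (i j : 'I_4) : (i < j)%N -> row i M = row j M -> ce_d br w M = 0.
  rewrite ce_d4M /ce4.
  elim/ord4: i; elim/ord4: j; rewrite /= ?inordK // => _ ->;
    set x := row (inord _) M; rewrite ?brxx ?E0 ?T0.
  - by ring.
  - by rewrite (brC x) TN !(S _ x); ring.
  - by rewrite (brC x (row (inord 1) M)) (brC x (row (inord 2) M)) !TN !(S _ x); ring.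
  - by ring.
  - by rewrite (brC x (row (inord 2) M)) TN !(S _ x); ring.
  - by ring.
move=> M i j; rewrite neq_ltn => /orP[ij|ij] e; first exact: (sym M i j).
exact: (sym M j i).
Qed.

Lemma ce_d_coef l : size l = 4 -> coef (ce_d br w) l =
  ce4 (ev R (nth 0 l 0)) (ev R (nth 0 l 1)) (ev R (nth 0 l 2)) (ev R (nth 0 l 3)).
Proof. by case: l => [|a [|b [|c [|d [|//]]]]] // _; rewrite /coef /bm ce_d4. Qed.

End D3.
End Br.
End Differential.

(** * Invariance under isomorphism *)

Section Transport.
Variable R : realType.
Local Notation V := 'rV[R]_6.

Lemma wedge_pullback (K : fieldType) p q (P : 'M[R]_6) (a : kform R K p) (b : kform R K q) :
  wedge (pullback P a) (pullback P b) = pullback P (wedge a b).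
Proof.
apply: funext => M; rewrite /pullback /wedge; congr (_ * _); apply: eq_bigr => s _.
have -> : row_perm s (M *m P) = row_perm s M *m P.
  by apply/matrixP=> i j; rewrite !mxE; apply: eq_bigr => l _; rewrite !mxE.
congr (_ * (a _ * b _)); apply/matrixP=> i j; rewrite !mxE;
  by apply: eq_bigr => l _; rewrite !mxE.
Qed.

Lemma row'_mul m n p (i : 'I_m) (A : 'M[R]_(m, n)) (B : 'M_(n, p)) :
  row' i (A *m B) = row' i A *m B.
Proof. by rewrite !row'Esub mul_rowsub_mx. Qed.

Lemma wedge_suml p q n (c : 'I_n -> R) (a : 'I_n -> kform R R p) (b : kform R R q) :
  wedge (fun M => \sum_k c k * a k M) b = fun M => \sum_k c k * wedge (a k) b M.
Proof.
apply: funext => M; rewrite /wedge; under [RHS]eq_bigr do rewrite mulrCA mulr_sumr.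
rewrite -mulr_sumr; congr (_ * _); rewrite exchange_big /=; apply: eq_bigr => s _.
rewrite mulr_suml mulr_sumr; apply: eq_bigr => k _.
by rewrite [RHS]mulrCA -mulrA.
Qed.

Lemma wedge_sumr p q n (c : 'I_n -> R) (a : kform R R p) (b : 'I_n -> kform R R q) :
  wedge a (fun M => \sum_k c k * b k M) = fun M => \sum_k c k * wedge a (b k) M.
Proof.
apply: funext => M; rewrite /wedge; under [RHS]eq_bigr do rewrite mulrCA mulr_sumr.
rewrite -mulr_sumr; congr (_ * _); rewrite exchange_big /=; apply: eq_bigr => s _.
rewrite !mulr_sumr; apply: eq_bigr => k _.
by rewrite [RHS]mulrCA; congr (_ * _); exact: mulrCA.
Qed.

Section Iso.
Variables (br br' : bracket R) (P : 'M[R]_6).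
Hypothesis Pu : P \in unitmx.
Hypothesis brP : forall x y, br (x *m P) (y *m P) = br' x y *m P.

Lemma ce_d_pullback k (w : kform R R k.+1) :
  ce_d br' (pullback P w) = pullback P (ce_d br w).
Proof.
apply: funext => M; rewrite /ce_d /pullback; apply: eq_bigr => j _.
apply: eq_bigr => i _; congr (_ * w _).
apply: (eq_trans (@mul_col_mx _ 1 k 6 6 _ _ P)).
by rewrite -brP !row'_mul !row_mul.
Qed.

(** Numerator and denominator of [A_iso] are top forms and both acquire the factor [\det P]; what
    remains is the change of coframe. *)
Lemma A_iso_pullback nu (xi : kform R R 5) : is_volume_form nu -> is_kform xi ->
  A_iso (pullback P nu) (pullback P xi) *m P = A_iso nu xi.
Proof.
move=> [nuk nu1] xik.
have top (l : 'I_6) : wedge (pullback P (@e1 R l.+1)) (pullback P xi) (1%:M : 'M_6)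
    = \det P * wedge (@e1 R l.+1) xi (1%:M : 'M_6).
  rewrite wedge_pullback /pullback mul1mx kform_top //.
  apply: (@wedge_kform _ 1 5) => //; split=> [i A B C b c Ai _ _|M i j].
    by rewrite /e1; have /rowP/(_ (inord l)) := Ai; rewrite !mxE !ord1.
  by rewrite !ord1 eqxx.
have nuP : pullback P nu 1%:M = \det P * nu 1%:M by rewrite /pullback mul1mx kform_top.
have dP : \det P != 0 by rewrite -unitfE -unitmxE.
apply/rowP=> l; rewrite !mxE.
transitivity (wedge (pullback P (@e1 R l.+1)) (pullback P xi) (1%:M : 'M_6) /
    pullback P nu 1%:M); last first.
  by rewrite top nuP invfM mulrACA divff // mul1r.
have -> : pullback P (e1 l.+1) = fun M => \sum_k P k l * @e1 R k.+1 M.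
  apply: funext => M; rewrite /pullback /e1 mxE /= inord_val; apply: eq_bigr => k _.
  by rewrite inord_val mulrC.
rewrite wedge_suml mulr_suml; apply: eq_bigr => k _.
by rewrite !mxE; ring.
Qed.

Lemma contract_sum (w : kform R R 3) (u : V) M : is_kform w ->
  Defs.contract u w M = \sum_l u 0 l * Defs.contract (delta_mx 0 l) w M.
Proof.
move=> wk; pose l := [seq row i M | i <- enum 'I_2].
have H (x : V) : Defs.contract x w M = w (mxl 3 (x :: l)).
  by rewrite /Defs.contract {1}(mxl_rows M); congr w; exact: col_mxl.
under eq_bigr do rewrite H.
rewrite H {1}(row_sum_delta u) /l !enum_ordSl.
have -> : enum 'I_0 = [::] by apply: size0nil; rewrite size_enum_ord.
exact: (w3_sum0 wk).
Qed.

Lemma A_contractE nu (w : kform R R 3) (u : V) : is_kform w ->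
  A_iso nu (wedge (Defs.contract u w) w) = u *m K_of nu w.
Proof.
move=> wk; apply/rowP=> k; rewrite !mxE.
have -> : Defs.contract u w = fun M => \sum_l u 0 l * Defs.contract (delta_mx 0 l) w M.
  by apply: funext => M; apply: contract_sum.
rewrite wedge_suml (@wedge_sumr 1 5) mulr_suml; apply: eq_bigr => l _.
rewrite -mulrA; congr (_ * _); rewrite /K_of mxE /A_iso mxE.
done.
Qed.

Lemma K_of_pullback nu (w : kform R R 3) : is_volume_form nu -> is_kform w ->
  K_of (pullback P nu) (pullback P w) = P *m K_of nu w *m invmx P.
Proof.
move=> nuv wk; apply: (canRL (mulmxK Pu)); apply/row_matrixP=> i.
rewrite !row_mul; set v := row i P.
rewrite -A_contractE // -(A_iso_pullback nuv); last first.
  exact: (@wedge_kform _ 2 3 _ _ (contract_kform _ wk) wk).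
congr (_ *m _); rewrite -(@wedge_pullback R 2 3).
have -> : row i (K_of (pullback P nu) (pullback P w)) =
    delta_mx 0 i *m K_of (pullback P nu) (pullback P w) by rewrite rowE.
rewrite -A_contractE; last exact: pullback_kform.
congr (A_iso _ (@wedge R R 2 3 _ _)); apply: funext => M.
rewrite /Defs.contract /pullback; congr w.
by apply: (eq_trans (@mul_col_mx _ 1 2 6 6 _ _ P)); rewrite -rowE.
Qed.

Lemma lambda_of_pullback nu (w : kform R R 3) : is_volume_form nu -> is_kform w ->
  lambda_of (pullback P nu) (pullback P w) = lambda_of nu w.
Proof.
move=> nuv wk; rewrite /lambda_of K_of_pullback //; congr (_ * _).
by rewrite !mulmxA mulmxKV // -!mulmxA mxtrace_mulC !mulmxA mulmxKV // -mulmxA mulmxK.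
Qed.

Lemma J_of_pullback nu (w : kform R R 3) : is_volume_form nu -> is_kform w ->
  J_of (pullback P nu) (pullback P w) = P *m J_of nu w *m invmx P.
Proof.
move=> nuv wk; rewrite /J_of lambda_of_pullback // K_of_pullback //.
by rewrite mulmxN mulNmx -scalemxAr -scalemxAl.
Qed.

Lemma hat_pullback nu (w : kform R R 3) : is_volume_form nu -> is_kform w ->
  hat (pullback P nu) (pullback P w) = pullback P (hat nu w).
Proof.
move=> nuv wk; apply: funext => M; rewrite /hat /pullback J_of_pullback //.
by congr w; rewrite !mulmxA mulmxKV.
Qed.

Lemma volume_pullback nu : is_volume_form nu -> is_volume_form (pullback P nu).
Proof.
move=> [nuk nu1]; split; first exact: pullback_kform.
by rewrite /pullback mul1mx kform_top // mulf_neq0 // -unitfE -unitmxE.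
Qed.

Lemma mean_convex_pullback nu w : is_volume_form nu -> mean_convex br nu w ->
  mean_convex br' (pullback P nu) (pullback P w).
Proof.
move=> nuv [[wk wd wc] [M0 M0P] [tau [[tauv taup] sp]]]; split.
- split; first exact: pullback_kform.
    by rewrite /definite lambda_of_pullback.
  by move=> M; rewrite ce_d_pullback; exact: wc.
- exists (M0 *m invmx P); rewrite hat_pullback // ce_d_pullback /pullback.
  by rewrite mulmxKV.
exists (pullback P tau); rewrite (J_of_pullback nuv wk) (hat_pullback nuv wk) ce_d_pullback.
split.
  split=> [|v1 v2 v3 /= Mu]; first exact: volume_pullback.
  set J := J_of nu w; have := taup (v1 *m P) (v2 *m P) (v3 *m P).
  have JE v : v *m (P *m J *m invmx P) *m P = v *m P *m J by rewrite !mulmxA mulmxKV.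
  rewrite /= -!JE -!mul_col_mx unitmx_mul Mu Pu; exact.
(* Composition with the inverse of [P] turns a (1,0)-form for the transported structure into one for
   J. *)
move=> a [al aJ]; have [] := sp (fun x => a (x *m invmx P)).
  split=> [c x y|x].
    by rewrite mulmxDl -scalemxAl al.
  have <- := aJ (x *m invmx P); congr a.
  by rewrite !mulmxA mulmxKV.
move=> l [l0 lE]; exists l; split=> // M; rewrite -[RHS]lE.
pose G := complexify (ce_d br (hat nu w)).
pose X : kform R R[i] 1 := fun x => 'i%C * a (x *m invmx P).
pose Y : kform R R[i] 1 := fun x => (a (x *m invmx P))^*%C.
have XP : (fun x => 'i%C * a x) = pullback P X.
  by apply: funext => x; rewrite /X /pullback mulmxK.
have YP : (fun x => (a x)^*%C) = pullback P Y.
  by apply: funext => x; rewrite /Y /pullback mulmxK.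
transitivity (pullback P (@wedge R R[i] 4 (1 + 1) G (@wedge R R[i] 1 1 X Y)) M) => //.
by rewrite XP YP -(@wedge_pullback R[i] 4 (1 + 1)) -(@wedge_pullback R[i] 1 1).
Qed.

End Iso.

Lemma mean_convex_iso (br br' : bracket R) : lie_isomorphic br br' ->
  (exists nu rho, is_volume_form nu /\ mean_convex br nu rho) ->
  exists nu rho, is_volume_form nu /\ mean_convex br' nu rho.
Proof.
move=> [f [fb fbr]] [nu [rho [nuv mc]]].
pose Q := lin1_mx f; have fE x : f x = x *m Q by rewrite mul_rV_lin1.
have Qu : Q \in unitmx.
  rewrite -row_free_unit; apply: inj_row_free => v v0; apply: (bij_inj fb).
  by rewrite !fE v0 mul0mx.
exists (pullback (invmx Q) nu), (pullback (invmx Q) rho); split.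
  by apply: volume_pullback => //; rewrite unitmx_inv.
apply: (@mean_convex_pullback br); rewrite ?unitmx_inv // => x y.
apply: (can_inj (mulmxK Qu)); rewrite -[RHS]mulmxA mulVmx // mulmx1.
by rewrite -fE fbr !fE !mulmxKV.
Qed.

End Transport.

(** * Semi-positivity as a condition on a quadratic form *)

Section SemiPos.
Variable R : realType.
Local Notation V := 'rV[R]_6.
Local Notation C := R[i].
Local Open Scope complex_scope.

Definition lf (al : 'cV[R]_6) (x : V) : R := (x *m al) 0 0.

(* The 2-form [al /\ (al o J)]. *)
Definition areaJ (J : 'M[R]_6) (al : 'cV[R]_6) : kform R R 2 := fun M =>
  lf al (row ord0 M) * lf (J *m al) (row ord_max M)
  - lf al (row ord_max M) * lf (J *m al) (row ord0 M).

Lemma lfD al x y : lf al (x + y) = lf al x + lf al y.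
Proof. by rewrite /lf mulmxDl mxE. Qed.
Lemma lfZ al c x : lf al (c *: x) = c * lf al x.
Proof. by rewrite /lf -scalemxAl mxE. Qed.
Lemma lf_mul J al x : lf (J *m al) x = lf al (x *m J).
Proof. by rewrite /lf mulmxA. Qed.

Lemma complexify_wedge p q (a : kform R R p) (b : kform R R q) M :
  wedge (complexify a) (complexify b) M = (wedge a b M)%:C.
Proof.
rewrite /wedge /complexify (rmorphM (real_complex R)) (fmorphV (real_complex R)).
rewrite (rmorph_nat (real_complex R)) (rmorph_sum (real_complex R)); congr (_ * _).
apply: eq_bigr => s _.
by rewrite (rmorphM (real_complex R)) (rmorph_sign (real_complex R)) (rmorphM (real_complex R)).
Qed.

Lemma wedgeZr p q c (a : kform R R p) (b : kform R R q) M :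
  wedge a (fun N => c * b N) M = c * wedge a b M.
Proof.
rewrite /wedge [RHS]mulrCA; congr (_ * _); rewrite mulr_sumr.
by apply: eq_bigr => s _; rewrite [RHS]mulrCA; congr (_ * _); rewrite mulrCA.
Qed.

(** The form al - i (al o J), the only one of type (1,0) with real part [al]; it makes real
    covectors parametrize all (1,0)-forms. *)
Definition form10_of (J : 'M[R]_6) (al : 'cV[R]_6) : kform R C 1 :=
  fun x => lf al x +i* (- lf (J *m al) x).

Lemma form10_ofP J al : J *m J = - 1%:M -> is_form10 J (form10_of J al).
Proof.
move=> JJ; split=> [c x y|x]; rewrite /form10_of.
  by rewrite !lfD !lfZ; simpc.
rewrite !lf_mul -mulmxA JJ mulmxN mulmx1; simpc.
apply/eqP; rewrite eq_complex /=.
by rewrite -[- x]scaleN1r lfZ mulN1r !opprK !eqxx.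
Qed.

Lemma form10E J (a : kform R C 1) : is_form10 J a ->
  exists al, a = form10_of J al.
Proof.
move=> [al aJ]; pose u : 'cV[R]_6 := \col_k complex.Re (a (delta_mx 0 k)).
have a0 : a 0 = 0 by have := al (-1) 0 0; rewrite scaler0 addr0 (rmorphN1 (real_complex R)) mulN1r addNr.
have ReE x : complex.Re (a x) = lf u x.
  rewrite {1}(row_sum_delta x) /lf mxE.
  have -> : a (\sum_j x 0 j *: delta_mx 0 j) = \sum_j (x 0 j)%:C * a (delta_mx 0 j).
    elim/big_rec2: _ => [//|k y1 y2 _ <-]; exact: al.
  rewrite raddf_sum; apply: eq_bigr => k _; rewrite mxE.
  by case: (a _) => p q /=; rewrite mul0r subr0.
exists u; apply: funext => x; have := ReE (x *m J); rewrite aJ.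
rewrite /form10_of lf_mul => <-; rewrite -ReE.
by case: (a x) => p q; apply/eqP; rewrite eq_complex /= mul0r mul1r sub0r opprK !eqxx.
Qed.

(** For a = al - i be with be = al o J one has a /\ conj a = 2 i al /\ be, whence the factor -2. *)
Lemma form10_wedge J al :
  wedge (fun x => 'i * form10_of J al x) (fun x => (form10_of J al x)^*)
  = complexify (fun N => -2%:R * areaJ J al N) :> kform R C 2.
Proof.
apply: funext => N; rewrite (@wedge11 R) /form10_of /areaJ /complexify.
move: (lf _ _) (lf _ _) (lf _ _) (lf _ _) => p q s t.
by apply/eqP; rewrite eq_complex /=; apply/andP; split; apply/eqP; ring.
Qed.

Lemma semi_posE J (g : kform R R 4) al (M : 'M[R]_6) :
  wedge (complexify g) (wedge (fun x => 'i * form10_of J al x)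
     (fun x => (form10_of J al x)^*)) M
  = (-2%:R * wedge g (areaJ J al) M)%:C.
Proof. by rewrite form10_wedge complexify_wedge wedgeZr. Qed.

Lemma areaJ_kform J al : is_kform (areaJ J al).
Proof.
have e0 (A B : 'M[R]_(2,6)) : row' ord0 B = row' ord0 A -> row ord_max B = row ord_max A.
  move=> e; apply/rowP=> j; have /matrixP/(_ 0 j) := e; rewrite !mxE.
  by rewrite (_ : lift _ _ = ord_max) //; apply: val_inj.
have e1 (A B : 'M[R]_(2,6)) : row' ord_max B = row' ord_max A -> row ord0 B = row ord0 A.
  move=> e; apply/rowP=> j; have /matrixP/(_ 0 j) := e; rewrite !mxE.
  by rewrite (_ : lift _ _ = ord0) //; apply: val_inj.
split=> [i A B C0 b c|M i j].
  case: i => [[|[|//]] h].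
    rewrite (_ : Ordinal h = ord0); last exact: val_inj.
    by move=> Ai /e0 Bi /e0 Ci; rewrite /areaJ Bi Ci Ai !lfD !lfZ; ring.
  rewrite (_ : Ordinal h = ord_max); last exact: val_inj.
  by move=> Ai /e1 Bi /e1 Ci; rewrite /areaJ Bi Ci Ai !lfD !lfZ; ring.
move=> ij Mij; rewrite /areaJ.
suff -> : row ord0 M = row ord_max M by rewrite subrr.
have o2 (k : 'I_2) : k = ord0 \/ k = ord_max.
  by case: k => [[|[|//]] h]; [left|right]; apply: val_inj.
by case: (o2 i) (o2 j) ij Mij => [] -> [] ->.
Qed.

(** [tau] is positive for the orientation of J, which need not be that of the standard frame. Its
    value there therefore survives as a nonzero factor [e] of unknown sign. *)
Lemma semi_pos_elim J (g : kform R R 4) : J *m J = - 1%:M -> semi_positive J g ->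
  exists2 e : R, e != 0 & forall al, 0 <= e * wedge g (areaJ J al) (1%:M : 'M_6).
Proof.
move=> JJ [tau [[[_ tau1] _] sp]]; exists (- tau 1%:M); first by rewrite oppr_eq0.
move=> al; have [l [l0 /(_ 1%:M)]] := sp _ (form10_ofP al JJ).
rewrite semi_posE => /(congr1 (@complex.Re R)) /= e.
have -> : wedge g (areaJ J al) (1%:M : 'M_6) = - 2^-1 * (l * tau 1%:M) by rewrite -e; field.
have -> : - tau 1%:M * (- 2^-1 * (l * tau 1%:M)) = 2^-1 * l * tau 1%:M ^+ 2 by ring.
by apply: mulr_ge0; [apply: mulr_ge0; rewrite ?invr_ge0 | apply: sqr_ge0].
Qed.

Lemma semi_pos_intro J (g : kform R R 4) tau : is_kform g -> positive_volume J tau ->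
  (forall al, 0 <= - tau 1%:M * wedge g (areaJ J al) (1%:M : 'M_6)) -> semi_positive J g.
Proof.
move=> gk taup sp; exists tau; split=> // a /form10E[al ->].
have [[tauk tau1] _] := taup.
exists (- 2%:R * wedge g (areaJ J al) (1%:M : 'M_6) / tau 1%:M); split.
  have -> : -2%:R * wedge g (areaJ J al) (1%:M : 'M_6) / tau 1%:M =
     2%:R * (- tau 1%:M * wedge g (areaJ J al) (1%:M : 'M_6)) * (tau 1%:M)^-1 ^+ 2.
    by field.
  by apply: mulr_ge0; [apply: mulr_ge0; rewrite ?invr_ge0 | apply: sqr_ge0].
move=> M; rewrite semi_posE; congr (_%:C).
rewrite (kform_top (wedge_kform gk (areaJ_kform J al))) (kform_top tauk M).
by field.
Qed.

End SemiPos.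

(** * The quadratic form and the endomorphism K in coordinates *)

Section Quad.
Variable R : realType.
Local Notation V := 'rV[R]_6.

(** The top coefficient of g /\ al /\ be, in the shape produced by [wedge2r]. *)
Definition Qc (g : seq nat -> R) (al be : nat -> R) : R :=
  2%:R^-1 * fsum 6 (fun i => fsum 5 (fun j =>
    let x := nth 0%N (del i (iota 0 6)) j in
    - (-1) ^+ (i + j) * (g (del j (del i (iota 0 6))) * (al x * be i - al i * be x)))).

Lemma lf_ev (al : 'cV[R]_6) (i : 'I_6) : lf al (ev R i) = al i 0.
Proof.
rewrite /lf mxE (bigD1 i) //= big1 ?addr0 => [|j ji]; first by rewrite mxE eqxx mul1r.
by rewrite mxE (inj_eq val_inj) (negbTE ji) mul0r.
Qed.

Lemma Q_coef (g : kform R R 4) (gk : is_kform g) J al :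
  wedge g (areaJ J al) (1%:M : 'M_6) =
  Qc (coef g) (fun k => al (inord k) 0) (fun k => (J *m al) (inord k) 0).
Proof.
rewrite wedge2r // -bm1 /Qc fsumE; congr (_ * _); apply: eq_bigr => i _.
rewrite fsumE; apply: eq_bigr => j _.
have sI : size (iota 0 6) = 6 by [].
have sd := size_del (ltn_ord i) sI.
have rI (k : 'I_6) : row k (bm R 6 (iota 0 6)) = ev R k by rewrite row_bm // nth_iota.
rewrite row'_bm // row'_bm // row_bm // rI /areaJ !row_mxl /=.
set x := nth 0%N _ _; have x6 : (x < 6)%N.
  have : x \in iota 0 6.
    have : x \in del i (iota 0 6) by rewrite mem_nth // sd.
    by rewrite mem_cat => /orP[/mem_take|/mem_drop].
  by rewrite mem_iota.
have -> : x = Ordinal x6 by [].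
by rewrite !lf_ev !inord_val.
Qed.

(* [Kc] on the coefficients of an alternating form, with each shuffle
   counted once. *)
Definition Kp (r : seq nat -> R) (i k : nat) : R :=
  let S := del k (iota 0 6) in
  let t a b := r [:: i; nth 0%N S a; nth 0%N S b] * r (del a (del b S)) in
  let u := t 0%N 1%N - t 0%N 2%N + t 0%N 3%N - t 0%N 4%N + t 1%N 2%N
         - t 1%N 3%N + t 1%N 4%N + t 2%N 3%N - t 2%N 4%N + t 3%N 4%N in
  if odd k then - u else u.

Lemma Kc_Kp r i k : (i < 6)%N -> (k < 6)%N -> Kc (nf r) i k = Kp (nf r) i k.
Proof.
do 6?[case: i => [|i]]; rewrite // => _;
  do 6?[case: k => [|k]]; rewrite // => _; rewrite /Kc /Kp /fsum /=; by field.
Qed.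

(* The polynomial identities K^2 = lambda and rho(K x, y, z) = rho(x, K y, z). *)
Section Identities.
Variable r : seq nat -> R.
Let K := Kp (nf r).

Lemma Kp_offdiag i j : (i < 6)%N -> (j < 6)%N -> i != j ->
  fsum 6 (fun m => K i m * K m j) = 0.
Proof.
rewrite /K; do 6?[case: i => [|i]]; rewrite // => _;
  do 6?[case: j => [|j]]; rewrite // => _ _; rewrite /Kp /fsum /=; ring.
Qed.

Lemma Kp_diag i : (i < 6)%N ->
  fsum 6 (fun m => K i m * K m i) = fsum 6 (fun m => K 0%N m * K m 0%N).
Proof.
by rewrite /K; do 6?[case: i => [|i]]; rewrite // => _; rewrite /Kp /fsum /=; ring.
Qed.

Lemma Kp_sym i j l : (i < 6)%N -> (j < 6)%N -> (l < 6)%N ->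
  fsum 6 (fun m => K i m * nf r [:: m; j; l]) =
  fsum 6 (fun m => K j m * nf r [:: i; m; l]).
Proof.
(* rho(K e_i, e_j, e_l), which is skew in the last two arguments, so that
   only a few triples have to be expanded. *)
pose B i j l := fsum 6 (fun m => K i m * nf r [:: m; j; l]).
have diag a c : (a < 6)%N -> (c < 6)%N -> B a a c = 0.
  rewrite /B /K; do 6?[case: a => [|a]]; rewrite // => _;
  do 6?[case: c => [|c]]; rewrite // => _; rewrite /Kp /fsum /=; ring.
have low a b c : (a < 6)%N -> (b < 6)%N -> (c < 6)%N -> (a < b)%N && (a < c)%N && (b != c) ->
    B a b c = - B b a c.
  rewrite /B /K; do 6?[case: a => [|a]]; rewrite // => _; do 6?[case: b => [|b]]; rewrite // => _;
  do 6?[case: c => [|c]]; rewrite // => _ _; rewrite /Kp /fsum /=; ring.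
have nf_swap a b c : (a < 6)%N -> (b < 6)%N -> (c < 6)%N ->
    (nf r [:: a; b; c] = - nf r [:: b; a; c]) * (nf r [:: a; b; c] = - nf r [:: a; c; b]).
  by do 6?[case: a => [|a]]; rewrite // => _; do 6?[case: b => [|b]]; rewrite // => _;
    do 6?[case: c => [|c]]; rewrite // => _; rewrite /= ?oppr0 ?opprK.
have fN a (F G : nat -> R) : (forall m, (m < 6)%N -> F m = - G m) ->
    fsum 6 (fun m => K a m * F m) = - fsum 6 (fun m => K a m * G m).
  by move=> FG; rewrite !fsumE -sumrN; apply: eq_bigr => m _; rewrite FG // mulrN.
move=> i6 j6 l6; have skew a b c : (a < 6)%N -> (b < 6)%N -> (c < 6)%N -> B a b c = - B a c b.
  by move=> a6 b6 c6; apply: fN => m m6; rewrite -(nf_swap _ _ _ m6 b6 c6).2.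
have -> : fsum 6 (fun m => K j m * nf r [:: i; m; l]) = - B j i l.
  by apply: fN => m m6; rewrite -(nf_swap _ _ _ i6 m6 l6).1.
rewrite -/(B i j l).
have [<-|ij] := eqVneq i j; first by rewrite diag ?oppr0.
have same a b : (a < 6)%N -> (b < 6)%N -> B a b b = 0.
  by move=> a6 b6; have := skew a b b a6 b6 b6; lra.
have [<-|il] := eqVneq i l; first by rewrite skew // diag // same ?oppr0.
have [<-|jl] := eqVneq j l; first by rewrite same // skew // diag ?oppr0.
have [/andP[a b]|] := boolP ((i < j) && (i < l))%N; first by apply: low; rewrite ?a ?b.
have [/andP[a b] _|] := boolP ((j < i) && (j < l))%N.
  by rewrite (low j i l) ?opprK ?a ?b.
(* The least index is now [l]. Skewness brings it into the second slot, [low] into the first one and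
   back: B i j l = - B i l j = B l i j = - B l j i = B j l i = - B j i l. *)
move=> n1 n2; have /andP[a b] : (l < i)%N && (l < j)%N by lia.
have := low l i j l6 i6 j6; have := low l j i l6 j6 i6.
rewrite a b ij (eq_sym j) ij => /(_ isT) e1 /(_ isT) e2.
by have := skew i j l i6 j6 l6; have := skew j i l j6 i6 l6; have := skew l i j l6 i6 j6; lra.
Qed.
End Identities.

End Quad.

(** * Definite forms: the square of K, the complex structure J and hat rho *)

Section Definite.
Variable R : realType.
Local Notation V := 'rV[R]_6.

Lemma eq_fsum n (F G : nat -> R) : (forall i, (i < n)%N -> F i = G i) -> fsum n F = fsum n G.
Proof. by move=> FG; rewrite !fsumE; apply: eq_bigr => i _; apply: FG. Qed.

Lemma fsumZ n c (F : nat -> R) : fsum n (fun i => c * F i) = c * fsum n F.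
Proof. by rewrite !fsumE mulr_sumr. Qed.

Lemma K_entry_poly nu (w : kform R R 3) (wk : is_kform w) (i k : 'I_6) :
  K_of nu w i k = Kp (nf (coef w)) i k / nu 1%:M.
Proof.
rewrite K_entry // -Kc_Kp //; congr (_ / _); rewrite /Kc; congr (_ * (_ * _)).
apply: eq_fsum => a a5; apply: eq_fsum => b b4; rewrite -!coefE //.
rewrite (@size_del _ _ _ 3) //; apply: (@size_del _ _ _ 4) => //.
exact: (@size_del _ _ _ 5).
Qed.

(* Coefficients of rho(K ., ., .), which is a multiple of hat rho. *)
Definition Hc (r : seq nat -> R) (l : seq nat) : R :=
  if l is [:: a; b; c] then fsum 6 (fun m => Kp r a m * r [:: m; b; c]) else 0.

(* [ce_d] in coordinates, for the structure constants c. *)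
Definition Dc (c : nat -> nat -> nat -> R) (r : seq nat -> R) (l : seq nat) : R :=
  if l is [:: x; y; z; t] then
    let T a b u v := fsum 6 (fun m => c a b m * r [:: m; u; v]) in
    - T x y z t + T x z y t - T x t y z - T y z x t + T y t x z - T z t x y
  else 0.

Lemma coef_sum0 (w : kform R R 3) (wk : is_kform w) (u : V) b c :
  w (mxl 3 [:: u; ev R b; ev R c]) = fsum 6 (fun m => u 0 (inord m) * coef w [:: m; b; c]).
Proof.
rewrite {1}(row_sum_delta u) (w3_sum0 wk) fsumE; apply: eq_bigr => m _.
by rewrite inord_val -ev_delta.
Qed.

Lemma ce_d_Dc br (brP : bilinear_alt br) c (w : kform R R 3) (wk : is_kform w) l :
  (forall a b m, (a < 6)%N -> (b < 6)%N -> (m < 6)%N ->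
    br (ev R a) (ev R b) 0 (inord m) = c a b m) ->
  size l = 4 -> all (fun i => i < 6)%N l -> coef (ce_d br w) l = Dc c (coef w) l.
Proof.
move=> cP; case: l => [|x [|y [|z [|t [|//]]]]] //= _ /and5P[x6 y6 z6 t6 _].
rewrite ce_d_coef // /ce4 /= !(coef_sum0 wk) /Dc.
have E a b u v : (a < 6)%N -> (b < 6)%N ->
    fsum 6 (fun m => br (ev R a) (ev R b) 0 (inord m) * coef w [:: m; u; v]) =
    fsum 6 (fun m => c a b m * coef w [:: m; u; v]).
  by move=> a6 b6; apply: eq_fsum => m m6; rewrite cP.
by rewrite !E.
Qed.

Section OneForm.
Variables (nu : kform R R 6) (w : kform R R 3).
Hypotheses (nuv : is_volume_form nu) (wk : is_kform w).
Let K := K_of nu w.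
Let r := nf (coef w).
Let n1 := nu 1%:M.

Lemma nu1_neq0 : n1 != 0. Proof. by case: nuv. Qed.

Lemma KK_entry (i j : 'I_6) :
  (K *m K) i j = n1^-2 * fsum 6 (fun m => Kp r i m * Kp r m j).
Proof.
rewrite mxE fsumE mulr_sumr; apply: eq_bigr => m _.
by rewrite /K !K_entry_poly // -/r -/n1; field; exact: nu1_neq0.
Qed.

(** The six diagonal entries of K^2 agree, so a sixth of the trace is any one of them. *)
Lemma lambda_poly i : (i < 6)%N ->
  lambda_of nu w = n1^-2 * fsum 6 (fun m => Kp r i m * Kp r m i).
Proof.
move=> i6; rewrite /lambda_of /mxtrace -/K.
under eq_bigr => j _ do rewrite KK_entry Kp_diag //.
by rewrite sumr_const card_ord -(Kp_diag _ i6) -mulr_natl; field; exact: nu1_neq0.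
Qed.

Lemma K_sq : K *m K = (lambda_of nu w)%:M.
Proof.
apply/matrixP=> i j; rewrite KK_entry !mxE; case: (altP (i =P j)) => [->|ij].
  by rewrite mulr1n (lambda_poly (ltn_ord j)).
by rewrite mulr0n Kp_offdiag ?mulr0.
Qed.

Lemma K_sym x y z : w (mxl 3 [:: x *m K; y; z]) = w (mxl 3 [:: x; y *m K; z]).
Proof.
have L0 := w3_sum0 wk.
have L1 (n : nat) (F : 'I_n -> R) (X : 'I_n -> V) a b :
    w (mxl 3 [:: a; \sum_i F i *: X i; b]) = \sum_i F i * w (mxl 3 [:: a; X i; b]).
  rewrite (w3_swap01 wk) L0 -sumrN; apply: eq_bigr => i _.
  by rewrite (w3_swap01 wk) mulrN opprK.
have L2 (n : nat) (F : 'I_n -> R) (X : 'I_n -> V) a b :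
    w (mxl 3 [:: a; b; \sum_i F i *: X i]) = \sum_i F i * w (mxl 3 [:: a; b; X i]).
  rewrite (w3_swap12 wk) L1 -sumrN; apply: eq_bigr => i _.
  by rewrite (w3_swap12 wk) mulrN opprK.
have E (u : V) : u *m K = \sum_i u 0 i *: (delta_mx 0 i *m K).
  rewrite {1}(row_sum_delta u) mulmx_suml; apply: eq_bigr => i _.
  by rewrite -scalemxAl.
pose S (v : V) := \sum_j v 0 j *: (delta_mx 0 j : V).
have SE v : v = S v by exact: row_sum_delta.
have -> : [:: x *m K; y; z] = [:: \sum_i x 0 i *: (delta_mx 0 i *m K); S y; S z].
  by rewrite -E -!SE.
have -> : [:: x; y *m K; z] = [:: S x; \sum_i y 0 i *: (delta_mx 0 i *m K); S z].
  by rewrite -E -!SE.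
rewrite /S.
rewrite !L0; apply: eq_bigr => i _; congr (_ * _).
rewrite !L1; apply: eq_bigr => j _; congr (_ * _).
rewrite !L2; apply: eq_bigr => l _; congr (_ * _).
have D (a : 'I_6) : delta_mx 0 a *m K = \sum_m K a m *: (delta_mx 0 m : V).
  rewrite -rowE {1}(row_sum_delta (row a K)).
  by apply: eq_bigr => m _; rewrite mxE.
rewrite !D L0 L1.
have := Kp_sym (coef w) (ltn_ord i) (ltn_ord j) (ltn_ord l); rewrite -/r !fsumE => e.
transitivity (n1^-1 * \sum_(m < 6) Kp r i m * r [:: nat_of_ord m; nat_of_ord j; nat_of_ord l]).
  rewrite mulr_sumr; apply: eq_bigr => m _; rewrite /K K_entry_poly // -/r -/n1.
  by rewrite -!ev_delta /r -coefE // [RHS]mulrA [_^-1 * _]mulrC.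
rewrite e mulr_sumr; apply: eq_bigr => m _; rewrite /K K_entry_poly // -/r -/n1.
by rewrite -!ev_delta /r -coefE // mulrA [_^-1 * _]mulrC.
Qed.

Hypothesis wd : definite nu w.
Let s := Num.sqrt (- lambda_of nu w).

Lemma s_gt0 : 0 < s. Proof. by rewrite sqrtr_gt0 oppr_gt0. Qed.

Lemma s_sq : s ^+ 2 = - lambda_of nu w.
Proof. by rewrite sqr_sqrtr // oppr_ge0 ltW. Qed.

Lemma J_sq : J_of nu w *m J_of nu w = - 1%:M.
Proof.
rewrite /J_of -/K -/s mulmxN mulNmx opprK -scalemxAl -scalemxAr K_sq scalerA.
rewrite -[lambda_of _ _]opprK -s_sq -(scalemx1 _ (- s ^+ 2)) scalerA.
have -> : s^-1 * s^-1 * - s ^+ 2 = -1 by field; rewrite gt_eqF // s_gt0.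
by rewrite scaleN1r.
Qed.

(** By definition hat rho is - s^-3 rho(K x, K y, K z). Since K can be moved between the slots and
    K^2 = - s^2, two of the three factors K cancel. *)
Lemma hat_one x y z : hat nu w (mxl 3 [:: x; y; z]) = s^-1 * w (mxl 3 [:: x *m K; y; z]).
Proof.
have sN : s != 0 by rewrite gt_eqF // s_gt0.
have c0 := w3_lin0 wk; have c1 := w3_lin1 wk; have c2 := w3_lin2 wk.
have JE (v : V) : v *m J_of nu w = - s^-1 *: (v *m K) + 0 *: v.
  by rewrite /J_of -/K -/s scale0r addr0 mulmxN -scalemxAr scaleNr.
have -> : hat nu w (mxl 3 [:: x; y; z]) =
    w (mxl 3 [:: x *m J_of nu w; y *m J_of nu w; z *m J_of nu w]).
  rewrite /hat /pullback; congr w; apply/row_matrixP=> i; rewrite row_mul !row_mxl.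
  by case: i => [[|[|[|//]]] h].
rewrite !JE c0 c1 c2 !mul0r !addr0 -K_sym (w3_swap12 wk) -K_sym -mulmxA K_sq.
rewrite (w3_swap12 wk) opprK mul_mx_scalar.
have -> : lambda_of nu w *: (x *m K) = lambda_of nu w *: (x *m K) + 0 *: x.
  by rewrite scale0r addr0.
rewrite c0 mul0r addr0 -[lambda_of nu w]opprK -s_sq.
field; done.
Qed.

End OneForm.
End Definite.

(** * Mean convexity as a system of polynomial conditions *)

Section Poly.
Variable R : realType.
Local Notation V := 'rV[R]_6.

Lemma Dc_scale c k (r r' : seq nat -> R) l : all (fun i => i < 6)%N l ->
  (forall x y z, (x < 6)%N -> (y < 6)%N -> (z < 6)%N -> r [:: x; y; z] = k * r' [:: x; y; z]) ->
  Dc c r l = k * Dc c r' l.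
Proof.
move=> + H; case: l => [|x [|y [|z [|t [|? ?]]]]] /=; rewrite ?mulr0 //.
move=> /and5P[x6 y6 z6 t6 _].
have E a b u v : (u < 6)%N -> (v < 6)%N ->
    fsum 6 (fun m => c a b m * r [:: m; u; v]) = k * fsum 6 (fun m => c a b m * r' [:: m; u; v]).
  by move=> u6 v6; rewrite -fsumZ; apply: eq_fsum => m m6; rewrite H // mulrCA.
by rewrite !E //; ring.
Qed.

Lemma Qc_scale (g g' : seq nat -> R) al al' be be' k k' :
  (forall l, size l = 4 -> all (fun i => i < 6)%N l -> g l = k * g' l) ->
  (forall i, (i < 6)%N -> al i = al' i) ->
  (forall i, (i < 6)%N -> be i = k' * be' i) ->
  Qc g al be = k * k' * Qc g' al' be'.
Proof.
move=> gE aE bE; rewrite /Qc mulrCA; congr (_ * _); rewrite -fsumZ; apply: eq_fsum => i i6.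
rewrite -fsumZ; apply: eq_fsum => j j5.
have aI : all (fun i => i < 6)%N (iota 0 6) by [].
have adel m (l : seq nat) : all (fun i => i < 6)%N l -> all (fun i => i < 6)%N (del m l).
  by move=> /allP H; apply/allP=> y; rewrite mem_cat => /orP[/mem_take|/mem_drop]; apply: H.
have sd : size (del i (iota 0 6)) = 5 by rewrite (@size_del _ _ _ 5).
have sd2 : size (del j (del i (iota 0 6))) = 4 by rewrite (@size_del _ _ _ 4).
rewrite (gE _ sd2 (adel _ _ (adel _ _ aI))) (bE i i6) (aE i i6).
set x := nth _ _ _; have x6 : (x < 6)%N.
  by have /allP := adel i _ aI; apply; rewrite mem_nth // sd.
by rewrite (bE x x6) (aE x x6); ring.
Qed.

(** All square roots and denominators are collected in the one factor [e], of which only the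
    non-vanishing is retained. *)
Lemma mean_convex_poly br c nu (w : kform R R 3) :
  bilinear_alt br ->
  (forall a b m, (a < 6)%N -> (b < 6)%N -> (m < 6)%N ->
    br (ev R a) (ev R b) 0 (inord m) = c a b m) ->
  is_volume_form nu -> mean_convex br nu w ->
  exists r e, let q := nf r in
  [/\ e != 0,
      forall l, size l = 4 -> all (fun i => i < 6)%N l -> Dc c q l = 0,
      forall i, (i < 6)%N -> fsum 6 (fun m => Kp q i m * Kp q m i) < 0
    & forall al, 0 <= e * Qc (Dc c (Hc q)) al
                        (fun k => fsum 6 (fun m => Kp q k m * al m))].
Proof.
move=> brP cP nuv [[wk wd wc] _ sp].
have n0 : nu 1%:M != 0 by case: nuv.
have s0 := s_gt0 wd.
have JJ := J_sq nuv wk wd.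
have [e0 e0N Q0] := semi_pos_elim JJ sp.
pose s := Num.sqrt (- lambda_of nu w); pose n1 := nu 1%:M; pose q := nf (coef w).
have hk : is_kform (hat nu w) by apply: pullback_kform.
(* The first s^-1 / n1 comes from hat rho, the negated one from J = - s^-1 K. *)
exists (coef w), (e0 * (s^-1 / n1 * (- (s^-1 / n1)))); rewrite -/q; split.
- by rewrite !(mulf_neq0, oppr_eq0, invr_eq0) // gt_eqF.
- move=> l sl al; rewrite (@Dc_scale c 1 _ (coef w)) //.
    by rewrite mul1r -(ce_d_Dc brP wk cP) // /coef.
  by move=> x y z _ _ _; rewrite mul1r /q -coefE.
- move=> i i6; have := wd; rewrite /definite (lambda_poly nuv wk i6) -/q.
  by rewrite pmulr_rlt0 // invr_gt0 exprn_even_gt0.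
have hE x y z : (x < 6)%N -> (y < 6)%N -> (z < 6)%N ->
    coef (hat nu w) [:: x; y; z] = s^-1 / n1 * Hc q [:: x; y; z].
  move=> x6 y6 z6; rewrite /coef /bm /= (hat_one nuv wk wd) -/s (coef_sum0 wk) -mulrA.
  congr (_ * _); rewrite -fsumZ; apply: eq_fsum => m m6.
  rewrite -(inordK x6) ev_delta -rowE mxE inordK // K_entry_poly // !inordK //.
  rewrite -[X in _ = _ * (_ * X)]/(q [:: m; y; z]).
  rewrite (_ : q [:: m; y; z] = coef w [:: m; y; z]) -/q -/n1; last by rewrite /q -coefE.
  by move: (coef w _) (Kp _ _ _) => X Y; ring.
move=> al; have := Q0 (\col_k al k).
have gk : is_kform (ce_d br (hat nu w)) by apply: ce_d_kform.
rewrite Q_coef // (@Qc_scale _ (Dc c (Hc q)) _ al _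
  (fun k => fsum 6 (fun m => Kp q k m * al m)) (s^-1 / n1) (- (s^-1 / n1))).
- by rewrite !mulrA.
- move=> l sl al6; rewrite (ce_d_Dc brP hk cP) //; apply: Dc_scale => //.
- by move=> i i6; rewrite mxE inordK.
move=> i i6; rewrite mxE -[inord i]/(inord i : 'I_6) fsumE mulr_sumr.
apply: eq_bigr => m _.
have -> : J_of nu w (inord i) m = - (s^-1 * K_of nu w (inord i) m).
  by rewrite /J_of mxE [X in - X]mxE.
by rewrite K_entry_poly // mxE inordK // -/q -/n1; ring.
Qed.

End Poly.

(** * Brackets given by tables of structure constants *)

Section Structure.
Variable R : realType.
Local Notation V := 'rV[R]_6.
Local Notation table := (seq (nat * nat * (nat * R))).

(* A list of quadruples ((i, j), (k, s)), meaning [e_i, e_j] has e_k-coordinate s. *)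
Fixpoint sc (L : seq (nat * nat * (nat * R))) (a b m : nat) : R :=
  if L is (ij, (k, s)) :: L' then
    (if Nat.eqb m k then
       if (Nat.eqb a ij.1 && Nat.eqb b ij.2)%bool then s
       else if (Nat.eqb a ij.2 && Nat.eqb b ij.1)%bool then - s else 0
     else 0) + sc L' a b m
  else 0.

(** The contraction of [sc] with [r] without a sum over [m]: after unfolding, only the table entries
    that match [a] and [b] leave a term, which keeps the polynomials small. *)
Fixpoint sT (L : seq (nat * nat * (nat * R))) (r : seq nat -> R) (a b u v : nat) : R :=
  if L is (ij, (k, s)) :: L' then
    if (Nat.eqb a ij.1 && Nat.eqb b ij.2)%bool then s * r [:: k; u; v] + sT L' r a b u v
    else if (Nat.eqb a ij.2 && Nat.eqb b ij.1)%bool then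
      sT L' r a b u v - s * r [:: k; u; v]
    else sT L' r a b u v
  else 0.

Lemma sTE L r a b u v : all (fun q => q.2.1 < 6)%N L ->
  fsum 6 (fun m => sc L a b m * r [:: m; u; v]) = sT L r a b u v.
Proof.
elim: L => [_|[ij [k s]] L IH /= /andP[k6 /IH {}IH]].
  by rewrite fsumE big1 // => i _; rewrite mul0r.
have D x : fsum 6 (fun m => ((if Nat.eqb m k then x else 0) + sc L a b m) * r [:: m; u; v])
    = x * r [:: k; u; v] + sT L r a b u v.
  rewrite -IH !fsumE -[X in X * _ + _]/x.
  under eq_bigr => m _ do rewrite mulrDl.
  rewrite big_split /=; congr (_ + _).
  rewrite (bigD1 (Ordinal k6)) //= PeanoNat.Nat.eqb_refl big1 ?addr0 // => m mk.
  case: PeanoNat.Nat.eqb_spec => [e|]; last by rewrite mul0r.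
  by case/eqP: mk; apply: val_inj.
case: (_ && _); first exact: D.
case: (_ && _); first by rewrite D addrC mulNr.
by rewrite D mul0r add0r.
Qed.

Definition Ds L r (l : seq nat) : R :=
  if l is [:: x; y; z; t] then
    - sT L r x y z t + sT L r x z y t - sT L r x t y z
    - sT L r y z x t + sT L r y t x z - sT L r z t x y
  else 0.

Lemma DcE L r l : all (fun q => q.2.1 < 6)%N L -> Dc (sc L) r l = Ds L r l.
Proof.
by move=> L6; case: l => [|x [|y [|z [|t [|? ?]]]]] //; rewrite /Dc /Ds !sTE.
Qed.

Lemma e2E i j (x y : V) : @e2 R i j (col_mx x y) =
  x 0 (inord i.-1) * y 0 (inord j.-1) - y 0 (inord i.-1) * x 0 (inord j.-1).
Proof.
have r0 : row ord0 (col_mx x y) = x.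
  apply/rowP=> k; rewrite mxE.
  have -> : ord0 = @lshift 1 1 ord0 by exact: val_inj.
  exact: (@col_mxEu _ 1 1 6 x y ord0 k).
have r1 : row ord_max (col_mx x y) = y.
  apply/rowP=> k; rewrite mxE.
  have -> : ord_max = @rshift 1 1 ord0 by exact: val_inj.
  exact: (@col_mxEd _ 1 1 6 x y ord0 k).
by rewrite /e2 (@wedge11 R) r0 r1.
Qed.

Lemma evE (a k : nat) : (k < 6)%N -> ev R a 0 (inord k) = (Nat.eqb a k)%:R.
Proof.
move=> k6; rewrite mxE inordK //; congr (_%:R).
by case: PeanoNat.Nat.eqb_spec => [->|/eqP/negbTE]; rewrite ?eqxx // eq_sym => ->.
Qed.

Lemma quad_lin (e X Y : R) : e != 0 -> (forall t, 0 <= e * (t * X + t ^+ 2 * Y)) -> X = 0.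
Proof.
move=> e0 H; apply/eqP/negP => /negP X0.
have u0 : e * X != 0 by rewrite mulf_neq0.
(* At t = - e X / d the assumed nonnegative value equals (e X)^2 / d^2 times e Y - d, which is
   negative because d exceeds the absolute value of e Y. *)
pose d := `|e * Y| + 1; have d0 : 0 < d by rewrite ltr_wpDl.
have := H (- (e * X) / d).
have -> : e * (- (e * X) / d * X + (- (e * X) / d) ^+ 2 * Y) =
    (e * X) ^+ 2 / d ^+ 2 * (e * Y - d) by field; rewrite gt_eqF.
rewrite leNgt => /negP; apply.
have q0 : 0 < (e * X) ^+ 2 by rewrite exprn_even_gt0.
have q1 : 0 < d ^+ 2 by rewrite exprn_gt0.
rewrite pmulr_rlt0; last by rewrite divr_gt0.
by rewrite /d subr_lt0; apply: le_lt_trans (ler_norm _) _; rewrite ltrDl.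
Qed.

Definition entry (i j k : nat) (s : R) : nat * nat * (nat * R) := ((i, j), (k, s)).

Definition coord (x : V) (i : nat) : R := x 0 (inord i).

(** Acts on coordinate functions instead of vectors, so that an isomorphism between two tables
    becomes a list of polynomial identities. *)
Fixpoint tc (L : table) (x y : nat -> R) (m : nat) : R :=
  if L is (ij, (k, s)) :: L' then
    (if Nat.eqb m k then s * (x ij.1 * y ij.2 - x ij.2 * y ij.1) else 0) + tc L' x y m
  else 0.

Definition tbr (L : table) : bracket R := fun x y => \row_m tc L (coord x) (coord y) m.

Lemma tbr_bil L : bilinear_alt (tbr L).
Proof.
split=> [c x y z|c x y z|x]; apply/rowP=> m; rewrite !mxE;
  elim: L => [|[ij [k s]] L IH] /=; rewrite ?mulr0 ?addr0 // IH;
  case: ifP => _; rewrite /coord ?mxE; ring.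
Qed.

Lemma coord_ev a i : (i < 6)%N -> coord (ev R a) i = (Nat.eqb a i)%:R.
Proof. exact: evE. Qed.

Lemma tbr_sc L a b m : all (fun q => (q.1.1 < q.1.2) && (q.1.2 < 6))%N L ->
  (m < 6)%N -> tbr L (ev R a) (ev R b) 0 (inord m) = sc L a b m.
Proof.
move=> + m6; rewrite mxE inordK //; elim: L => [//|[[i j] [k s]] L IH] /= /andP[/andP[ij j6] /IH ->].
congr (_ + _); case: ifP => // _; rewrite !coord_ev ?(ltn_trans ij) //.
have ij' : ~ i = j by lia.
case: (PeanoNat.Nat.eqb_spec a i) => ai; case: (PeanoNat.Nat.eqb_spec b j) => bj;
  case: (PeanoNat.Nat.eqb_spec a j) => aj; case: (PeanoNat.Nat.eqb_spec b i) => bi /=;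
  first [by case: ij'; congruence | rewrite ?mulr1 ?mulr0 ?mul0r ?subr0 ?sub0r ?oppr0 ?mulr0 ?mulrN1 ?mulr1 //].
Qed.

(* Coefficient of g /\ e_a /\ u in top degree. *)
Definition Pc (g : seq nat -> R) (a : nat) (u : nat -> R) : R :=
  fsum 6 (fun j => match Nat.compare a j with
    | Lt => - (-1) ^+ (a + j) * (g (del a (del j (iota 0 6))) * u j)
    | Eq => 0
    | Gt => (-1) ^+ (a + j) * (g (del j (del a (iota 0 6))) * u j) end).

(** The covector e^a + t e^b, along which the quadratic form is a polynomial of degree 2 in [t]. *)
Definition pt a b (t : R) : nat -> R :=
  fun k => if Nat.eqb k a then 1 else if Nat.eqb k b then t else 0.

Lemma Qc_pt a b g (K : nat -> nat -> R) t : (a < 6)%N -> (b < 6)%N -> a != b ->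
  Qc g (pt a b t) (fun k => fsum 6 (fun m => K k m * pt a b t m)) =
  Pc g a (K ^~ a) + t * (Pc g a (K ^~ b) + Pc g b (K ^~ a)) + t ^+ 2 * Pc g b (K ^~ b).
Proof.
do 6?[case: a => [|a]]; rewrite // => _; do 6?[case: b => [|b]]; rewrite // => _ _;
  rewrite /Qc /Pc /pt /fsum /=; by field.
Qed.

(* A semidefinite quadratic form which vanishes at e^a has no cross term with e^a. *)
Lemma polar_zero L nu (w : kform R R 3) :
  all (fun q => (q.1.1 < q.1.2) && (q.1.2 < 6))%N L -> all (fun q => q.2.1 < 6)%N L ->
  is_volume_form nu -> mean_convex (tbr L) nu w ->
  exists r K h g, let q := nf r in
  [/\ K = Kp q,
      h = fun l => if l is [:: a; b; c] then fsum 6 (fun m => K a m * q [:: m; b; c]) else 0,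
      g = Ds L h,
      forall l, size l = 4 -> all (fun i => i < 6)%N l -> Ds L q l = 0
    & (forall i, (i < 6)%N -> fsum 6 (fun m => K i m * K m i) < 0) /\
      (forall a b, (a < 6)%N -> (b < 6)%N -> a != b -> Pc g a (K ^~ a) = 0 ->
        Pc g a (K ^~ b) + Pc g b (K ^~ a) = 0)].
Proof.
move=> L1 L6 nuv mc.
have [r [e [e0 H1 H2 H3]]] :=
  mean_convex_poly (tbr_bil L) (fun a b m _ _ m6 => tbr_sc a b L1 m6) nuv mc.
have gE : Dc (sc L) (Hc (nf r)) = Ds L (Hc (nf r)) by apply: funext => l; rewrite DcE.
(* Passing [K], [h] and [g] as existential witnesses with equations makes them opaque to the user of
   the lemma: later computations unfold only the entries that they need. *)
exists r, (Kp (nf r)), (Hc (nf r)), (Ds L (Hc (nf r))); split=> //.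
  by move=> l sl al; rewrite -DcE // H1.
split=> // a b a6 b6 ab z; rewrite -gE in z *.
apply: (quad_lin (Y := Pc (Dc (sc L) (Hc (nf r))) b (Kp (nf r) ^~ b)) e0) => t.
by have := H3 (pt a b t); rewrite (Qc_pt _ (Kp (nf r))) // z add0r.
Qed.

End Structure.

(** * The exceptional Lie algebras *)

Ltac rf := first [ring | by field].

Ltac prods := repeat match goal with |- prod _ _ => split end.

Ltac closed H :=
  have := H [:: 0; 1; 2; 3]%N erefl isT; have := H [:: 0; 1; 2; 4]%N erefl isT;
  have := H [:: 0; 1; 2; 5]%N erefl isT; have := H [:: 0; 1; 3; 4]%N erefl isT;
  have := H [:: 0; 1; 3; 5]%N erefl isT; have := H [:: 0; 1; 4; 5]%N erefl isT;
  have := H [:: 0; 2; 3; 4]%N erefl isT; have := H [:: 0; 2; 3; 5]%N erefl isT;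
  have := H [:: 0; 2; 4; 5]%N erefl isT; have := H [:: 0; 3; 4; 5]%N erefl isT;
  have := H [:: 1; 2; 3; 4]%N erefl isT; have := H [:: 1; 2; 3; 5]%N erefl isT;
  have := H [:: 1; 2; 4; 5]%N erefl isT; have := H [:: 1; 3; 4; 5]%N erefl isT;
  have := H [:: 2; 3; 4; 5]%N erefl isT;
  rewrite /Ds /= !(mul0r, addr0, add0r, oppr0, subr0, mulr0) => *.

Local Notation cf r a b c := (r [:: a%N; b%N; c%N]).

Ltac tbr_eq := apply: funext => x; apply: funext => y; apply/rowP => -[[|[|[|[|[|[|//]]]]]] hk];
  rewrite !mxE /= ?e2E /coord; ring.

Section Obstructions.
Variable R : realType.
Local Notation entry := (@entry R).

Lemma mono_zero (n x y : R) : n != 0 -> n * x * x * y * y * y = 0 -> x = 0 \/ y = 0.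
Proof.
move=> /negbTE n0 /eqP; rewrite !mulf_eq0 n0 /= orbb -!orbA !orbb.
by case/orP => /eqP; [left|right].
Qed.

Definition L1 := [:: entry 0 1 2 (-1); entry 0 2 3 (-1); entry 0 3 4 (-1);
  entry 1 2 4 (-1); entry 2 3 5 (-1); entry 1 4 5 1].

Lemma g1_tbr : @g1 R = tbr L1. Proof. tbr_eq. Qed.

(** The pattern of all five nonabelian cases. Closedness is solved in [e]; [k], [hh] and [gg]
    tabulate the entries of K, of rho(K ., ., .) and of its differential that the test needs. Here
    the test uses the covectors with indices 0 and 4, counted from 0. *)
Lemma g1_not_mean_convex nu w : is_volume_form nu -> ~ mean_convex (@g1 R) nu w.
Proof.
rewrite g1_tbr => nuv mc.
have [r [K [h [g [KE hE gE H1 [H2 H3]]]]]] := polar_zero (L := L1) isT isT nuv mc.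
have e :
    (cf r 0 1 5 = - (cf r 0 3 4) - cf r 1 2 4) * (cf r 0 2 5 = - (cf r 1 3 4)) *
    (cf r 0 3 5 = - (cf r 2 3 4)) * (cf r 0 4 5 = 0) * (cf r 1 3 5 = 0) * (cf r 1 4 5 = 0) *
    (cf r 2 3 5 = 0) * (cf r 2 4 5 = 0) * (cf r 3 4 5 = 0).
  closed H1; prods; lra.
have k :
    (K 2%N 0%N = 2%:R * cf r 1 2 5 * cf r 2 3 4) * (K 2%N 1%N = 2%:R * cf r 1 3 4 * cf r 2 3 4) *
    (K 2%N 2%N = - (cf r 0 3 4 * cf r 1 2 5) - cf r 0 3 4 * cf r 2 3 4 - 2%:R * cf r 1 2 4 * cf r 2 3 4 - cf r 1 3 4 * cf r 1 3 4) *
    (K 2%N 4%N = - (2%:R * cf r 0 2 3 * cf r 1 2 5) - 2%:R * cf r 1 2 3 * cf r 1 3 4) *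
    (K 3%N 0%N = 0) * (K 3%N 1%N = 2%:R * cf r 2 3 4 * cf r 2 3 4) *
    (K 3%N 2%N = - (2%:R * cf r 1 3 4 * cf r 2 3 4)) *
    (K 3%N 4%N = - (2%:R * cf r 1 2 3 * cf r 2 3 4)) * (K 4%N 0%N = 0) * (K 4%N 1%N = 0) *
    (K 4%N 2%N = 0) * (K 4%N 3%N = 0) *
    (K 4%N 4%N = cf r 0 3 4 * cf r 1 2 5 - cf r 0 3 4 * cf r 2 3 4 - 2%:R * cf r 1 2 4 * cf r 2 3 4 + cf r 1 3 4 * cf r 1 3 4) *
    (K 4%N 5%N = - (2%:R * cf r 0 1 4 * cf r 2 3 4) + 2%:R * cf r 0 2 4 * cf r 1 3 4 - 2%:R * cf r 0 3 4 * cf r 1 2 4) *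
    (K 5%N 0%N = 0) * (K 5%N 1%N = 0) * (K 5%N 2%N = 0) * (K 5%N 3%N = 0) *
    (K 5%N 4%N = - (2%:R * cf r 1 2 5 * cf r 2 3 4)) *
    (K 5%N 5%N = - (cf r 0 3 4 * cf r 1 2 5) + cf r 0 3 4 * cf r 2 3 4 + 2%:R * cf r 1 2 4 * cf r 2 3 4 - cf r 1 3 4 * cf r 1 3 4).
  by prods; rewrite KE /Kp /= ?e; rf.
have hh :
    (h [:: 2; 3; 5]%N = - (2%:R * cf r 1 2 5 * cf r 2 3 4 * cf r 2 3 4)) *
    (h [:: 3; 3; 5]%N = 0) * (h [:: 4; 1; 5]%N = 0) * (h [:: 4; 2; 5]%N = 0) *
    (h [:: 4; 3; 4]%N = 0) * (h [:: 4; 3; 5]%N = 0) * (h [:: 4; 4; 5]%N = 0) *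
    (h [:: 5; 0; 5]%N = 0) * (h [:: 5; 1; 4]%N = 0) * (h [:: 5; 1; 5]%N = 0) *
    (h [:: 5; 2; 3]%N = - (2%:R * cf r 1 2 5 * cf r 2 3 4 * cf r 2 3 4)) *
    (h [:: 5; 2; 5]%N = 0) * (h [:: 5; 3; 5]%N = 0) * (h [:: 5; 4; 5]%N = 0).
  by prods; rewrite hE /fsum /= ?k ?e; rf.
have gg :
    (g [:: 0; 1; 3; 5]%N = - (2%:R * cf r 1 2 5 * cf r 2 3 4 * cf r 2 3 4)) *
    (g [:: 0; 2; 3; 5]%N = 0) *
    (g [:: 1; 2; 3; 4]%N = 2%:R * cf r 1 2 5 * cf r 2 3 4 * cf r 2 3 4) *
    (g [:: 1; 2; 3; 5]%N = 0) * (g [:: 1; 2; 4; 5]%N = 0) * (g [:: 1; 3; 4; 5]%N = 0) *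
    (g [:: 2; 3; 4; 5]%N = 0).
  by prods; rewrite gE /Ds /= ?hh; rf.
have Q0 : Pc g 0 (K ^~ 0%N) = 0 by rewrite /Pc /fsum /= ?k ?gg; rf.
have B : (- 8%:R) * cf r 1 2 5 * cf r 1 2 5 * cf r 2 3 4 * cf r 2 3 4 * cf r 2 3 4 = 0.
  by rewrite -(H3 0%N 4%N isT isT isT Q0) /Pc /fsum /= ?k ?gg; rf.
(* Either vanishing leaves row 5 of K without off-diagonal entries. The sum that definiteness makes
   negative is then the square of [K 5 5]. *)
have [z|z] : cf r 1 2 5 = 0 \/ cf r 2 3 4 = 0 by apply: mono_zero B; rewrite ?oppr_eq0 pnatr_eq0.
- have k0 :
      (K 5%N 0%N = 0) * (K 5%N 1%N = 0) * (K 5%N 2%N = 0) * (K 5%N 3%N = 0) * (K 5%N 4%N = 0).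
    by prods; rewrite KE /Kp /= ?e ?z; rf.
  have := H2 5%N isT; rewrite /fsum /= !k0.
  rewrite !(mul0r, mulr0, addr0, add0r) => hneg.
  by have := sqr_ge0 (K 5%N 5%N); rewrite expr2 leNgt hneg.
- have k0 :
      (K 5%N 0%N = 0) * (K 5%N 1%N = 0) * (K 5%N 2%N = 0) * (K 5%N 3%N = 0) * (K 5%N 4%N = 0).
    by prods; rewrite KE /Kp /= ?e ?z; rf.
  have := H2 5%N isT; rewrite /fsum /= !k0.
  rewrite !(mul0r, mulr0, addr0, add0r) => hneg.
  by have := sqr_ge0 (K 5%N 5%N); rewrite expr2 leNgt hneg.
Qed.

Definition L2 := [:: entry 0 1 2 (-1); entry 0 2 3 (-1); entry 0 3 4 (-1);
  entry 2 3 5 (-1); entry 1 4 5 1].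

Lemma g2_tbr : @g2 R = tbr L2. Proof. tbr_eq. Qed.

Lemma g2_not_mean_convex nu w : is_volume_form nu -> ~ mean_convex (@g2 R) nu w.
Proof.
rewrite g2_tbr => nuv mc.
have [r [K [h [g [KE hE gE H1 [H2 H3]]]]]] := polar_zero (L := L2) isT isT nuv mc.
have e :
    (cf r 0 1 5 = - (cf r 1 2 4)) * (cf r 0 2 5 = - (cf r 1 3 4)) *
    (cf r 0 3 5 = - (cf r 2 3 4)) * (cf r 0 4 5 = 0) * (cf r 1 3 5 = 0) * (cf r 1 4 5 = 0) *
    (cf r 2 3 5 = 0) * (cf r 2 4 5 = 0) * (cf r 3 4 5 = 0).
  closed H1; prods; lra.
have k :
    (K 2%N 0%N = 2%:R * cf r 1 2 5 * cf r 2 3 4) * (K 2%N 1%N = 2%:R * cf r 1 3 4 * cf r 2 3 4) *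
    (K 2%N 2%N = - (cf r 0 3 4 * cf r 1 2 5) - 2%:R * cf r 1 2 4 * cf r 2 3 4 - cf r 1 3 4 * cf r 1 3 4) *
    (K 2%N 4%N = - (2%:R * cf r 0 2 3 * cf r 1 2 5) - 2%:R * cf r 1 2 3 * cf r 1 3 4) *
    (K 3%N 0%N = 0) * (K 3%N 1%N = 2%:R * cf r 2 3 4 * cf r 2 3 4) *
    (K 3%N 2%N = - (2%:R * cf r 1 3 4 * cf r 2 3 4)) *
    (K 3%N 4%N = - (2%:R * cf r 1 2 3 * cf r 2 3 4)) * (K 4%N 0%N = 0) * (K 4%N 1%N = 0) *
    (K 4%N 2%N = 0) * (K 4%N 3%N = 0) *
    (K 4%N 4%N = cf r 0 3 4 * cf r 1 2 5 - 2%:R * cf r 1 2 4 * cf r 2 3 4 + cf r 1 3 4 * cf r 1 3 4) *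
    (K 5%N 0%N = 0) * (K 5%N 1%N = 0) * (K 5%N 2%N = 0) * (K 5%N 3%N = 0) *
    (K 5%N 4%N = - (2%:R * cf r 1 2 5 * cf r 2 3 4)) *
    (K 5%N 5%N = - (cf r 0 3 4 * cf r 1 2 5) + 2%:R * cf r 1 2 4 * cf r 2 3 4 - cf r 1 3 4 * cf r 1 3 4).
  by prods; rewrite KE /Kp /= ?e; rf.
have hh :
    (h [:: 2; 3; 5]%N = - (2%:R * cf r 1 2 5 * cf r 2 3 4 * cf r 2 3 4)) *
    (h [:: 3; 3; 5]%N = 0) * (h [:: 4; 1; 5]%N = 0) * (h [:: 4; 2; 5]%N = 0) *
    (h [:: 5; 0; 5]%N = 0) * (h [:: 5; 1; 4]%N = 0) * (h [:: 5; 1; 5]%N = 0) *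
    (h [:: 5; 2; 3]%N = - (2%:R * cf r 1 2 5 * cf r 2 3 4 * cf r 2 3 4)) *
    (h [:: 5; 2; 5]%N = 0) * (h [:: 5; 3; 5]%N = 0) * (h [:: 5; 4; 5]%N = 0).
  by prods; rewrite hE /fsum /= ?k ?e; rf.
have gg :
    (g [:: 0; 1; 3; 5]%N = - (2%:R * cf r 1 2 5 * cf r 2 3 4 * cf r 2 3 4)) *
    (g [:: 0; 2; 3; 5]%N = 0) *
    (g [:: 1; 2; 3; 4]%N = 2%:R * cf r 1 2 5 * cf r 2 3 4 * cf r 2 3 4) *
    (g [:: 1; 2; 3; 5]%N = 0) * (g [:: 1; 2; 4; 5]%N = 0) * (g [:: 1; 3; 4; 5]%N = 0) *
    (g [:: 2; 3; 4; 5]%N = 0).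
  by prods; rewrite gE /Ds /= ?hh; rf.
have Q0 : Pc g 0 (K ^~ 0%N) = 0 by rewrite /Pc /fsum /= ?k ?gg; rf.
have B : (- 8%:R) * cf r 1 2 5 * cf r 1 2 5 * cf r 2 3 4 * cf r 2 3 4 * cf r 2 3 4 = 0.
  by rewrite -(H3 0%N 4%N isT isT isT Q0) /Pc /fsum /= ?k ?gg; rf.
have [z|z] : cf r 1 2 5 = 0 \/ cf r 2 3 4 = 0 by apply: mono_zero B; rewrite ?oppr_eq0 pnatr_eq0.
- have k0 :
      (K 5%N 0%N = 0) * (K 5%N 1%N = 0) * (K 5%N 2%N = 0) * (K 5%N 3%N = 0) * (K 5%N 4%N = 0).
    by prods; rewrite KE /Kp /= ?e ?z; rf.
  have := H2 5%N isT; rewrite /fsum /= !k0.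
  rewrite !(mul0r, mulr0, addr0, add0r) => hneg.
  by have := sqr_ge0 (K 5%N 5%N); rewrite expr2 leNgt hneg.
- have k0 :
      (K 5%N 0%N = 0) * (K 5%N 1%N = 0) * (K 5%N 2%N = 0) * (K 5%N 3%N = 0) * (K 5%N 4%N = 0).
    by prods; rewrite KE /Kp /= ?e ?z; rf.
  have := H2 5%N isT; rewrite /fsum /= !k0.
  rewrite !(mul0r, mulr0, addr0, add0r) => hneg.
  by have := sqr_ge0 (K 5%N 5%N); rewrite expr2 leNgt hneg.
Qed.

Definition L9 := [:: entry 0 1 3 (-1); entry 0 3 4 (-1); entry 1 2 4 1;
  entry 0 4 5 (-1); entry 2 3 5 (-1)].

Lemma g9_tbr : @g9 R = tbr L9. Proof. tbr_eq. Qed.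

Lemma g9_not_mean_convex nu w : is_volume_form nu -> ~ mean_convex (@g9 R) nu w.
Proof.
rewrite g9_tbr => nuv mc.
have [r [K [h [g [KE hE gE H1 [H2 H3]]]]]] := polar_zero (L := L9) isT isT nuv mc.
have e :
    (cf r 0 1 5 = cf r 0 3 4 - cf r 1 2 4) * (cf r 0 4 5 = 0) * (cf r 1 2 5 = cf r 2 3 4) *
    (cf r 1 3 5 = 0) * (cf r 1 4 5 = 0) * (cf r 2 3 5 = 0) * (cf r 2 4 5 = 0) * (cf r 3 4 5 = 0).
  closed H1; prods; lra.
have k :
    (K 3%N 0%N = 0) * (K 3%N 1%N = - (2%:R * cf r 0 3 5 * cf r 2 3 4)) *
    (K 3%N 2%N = 2%:R * cf r 0 3 5 * cf r 1 3 4) *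
    (K 3%N 3%N = - (cf r 0 2 5 * cf r 1 3 4) + 2%:R * cf r 0 3 4 * cf r 2 3 4 - cf r 0 3 5 * cf r 1 2 4 - cf r 1 2 4 * cf r 2 3 4) *
    (K 3%N 4%N = 2%:R * cf r 0 3 5 * cf r 1 2 3) * (K 4%N 0%N = 0) * (K 4%N 1%N = 0) *
    (K 4%N 2%N = 0) * (K 4%N 3%N = 0) *
    (K 4%N 4%N = - (cf r 0 2 5 * cf r 1 3 4) + 2%:R * cf r 0 3 4 * cf r 2 3 4 + cf r 0 3 5 * cf r 1 2 4 - cf r 1 2 4 * cf r 2 3 4) *
    (K 4%N 5%N = - (2%:R * cf r 0 1 4 * cf r 2 3 4) + 2%:R * cf r 0 2 4 * cf r 1 3 4 - 2%:R * cf r 0 3 4 * cf r 1 2 4) *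
    (K 5%N 0%N = 0) * (K 5%N 1%N = 0) * (K 5%N 2%N = 0) * (K 5%N 3%N = 0) *
    (K 5%N 4%N = 2%:R * cf r 0 3 5 * cf r 2 3 4) *
    (K 5%N 5%N = cf r 0 2 5 * cf r 1 3 4 - 2%:R * cf r 0 3 4 * cf r 2 3 4 - cf r 0 3 5 * cf r 1 2 4 + cf r 1 2 4 * cf r 2 3 4).
  by prods; rewrite KE /Kp /= ?e; rf.
have hh :
    (h [:: 3; 2; 5]%N = - (2%:R * cf r 0 3 5 * cf r 2 3 4 * cf r 2 3 4)) *
    (h [:: 3; 3; 5]%N = 0) * (h [:: 4; 0; 5]%N = 0) * (h [:: 4; 1; 5]%N = 0) *
    (h [:: 4; 2; 4]%N = 0) * (h [:: 4; 2; 5]%N = 0) * (h [:: 4; 3; 5]%N = 0) *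
    (h [:: 4; 4; 5]%N = 0) * (h [:: 5; 0; 4]%N = 0) * (h [:: 5; 0; 5]%N = 0) *
    (h [:: 5; 1; 5]%N = 0) * (h [:: 5; 2; 3]%N = 2%:R * cf r 0 3 5 * cf r 2 3 4 * cf r 2 3 4) *
    (h [:: 5; 2; 5]%N = 0) * (h [:: 5; 3; 5]%N = 0) * (h [:: 5; 4; 5]%N = 0).
  by prods; rewrite hE /fsum /= ?k ?e; rf.
have gg :
    (g [:: 0; 1; 2; 5]%N = - (2%:R * cf r 0 3 5 * cf r 2 3 4 * cf r 2 3 4)) *
    (g [:: 0; 1; 3; 5]%N = 0) *
    (g [:: 0; 2; 3; 4]%N = 2%:R * cf r 0 3 5 * cf r 2 3 4 * cf r 2 3 4) *
    (g [:: 0; 2; 3; 5]%N = 0) * (g [:: 0; 2; 4; 5]%N = 0) * (g [:: 0; 3; 4; 5]%N = 0) *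
    (g [:: 1; 2; 3; 5]%N = 0) * (g [:: 2; 3; 4; 5]%N = 0).
  by prods; rewrite gE /Ds /= ?hh; rf.
have Q0 : Pc g 1 (K ^~ 1%N) = 0 by rewrite /Pc /fsum /= ?k ?gg; rf.
have B : (- 8%:R) * cf r 0 3 5 * cf r 0 3 5 * cf r 2 3 4 * cf r 2 3 4 * cf r 2 3 4 = 0.
  by rewrite -(H3 1%N 4%N isT isT isT Q0) /Pc /fsum /= ?k ?gg; rf.
have [z|z] : cf r 0 3 5 = 0 \/ cf r 2 3 4 = 0 by apply: mono_zero B; rewrite ?oppr_eq0 pnatr_eq0.
- have k0 :
      (K 5%N 0%N = 0) * (K 5%N 1%N = 0) * (K 5%N 2%N = 0) * (K 5%N 3%N = 0) * (K 5%N 4%N = 0).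
    by prods; rewrite KE /Kp /= ?e ?z; rf.
  have := H2 5%N isT; rewrite /fsum /= !k0.
  rewrite !(mul0r, mulr0, addr0, add0r) => hneg.
  by have := sqr_ge0 (K 5%N 5%N); rewrite expr2 leNgt hneg.
- have k0 :
      (K 5%N 0%N = 0) * (K 5%N 1%N = 0) * (K 5%N 2%N = 0) * (K 5%N 3%N = 0) * (K 5%N 4%N = 0).
    by prods; rewrite KE /Kp /= ?e ?z; rf.
  have := H2 5%N isT; rewrite /fsum /= !k0.
  rewrite !(mul0r, mulr0, addr0, add0r) => hneg.
  by have := sqr_ge0 (K 5%N 5%N); rewrite expr2 leNgt hneg.
Qed.

Definition L4 := [:: entry 0 1 2 (-1); entry 0 2 3 (-1); entry 0 3 4 (-1);
  entry 1 2 4 (-1); entry 1 3 5 (-1); entry 0 4 5 (-1)].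

Lemma g4_tbr : @g4 R = tbr L4. Proof. tbr_eq. Qed.

(** The first test, on the covectors 0 and 1, gives a pure fifth power, hence no alternative; a
    second test is then needed to bring K into a contradictory shape. *)
Lemma g4_not_mean_convex nu w : is_volume_form nu -> ~ mean_convex (@g4 R) nu w.
Proof.
rewrite g4_tbr => nuv mc.
have [r [K [h [g [KE hE gE H1 [H2 H3]]]]]] := polar_zero (L := L4) isT isT nuv mc.
have e :
    (cf r 0 2 5 = cf r 0 3 4 + cf r 1 2 4) * (cf r 0 4 5 = - ((1%:R / 2%:R) * cf r 2 3 4)) *
    (cf r 1 2 5 = - (cf r 1 3 4)) * (cf r 1 3 5 = - ((1%:R / 2%:R) * cf r 2 3 4)) *
    (cf r 1 4 5 = 0) * (cf r 2 3 5 = 0) * (cf r 2 4 5 = 0) * (cf r 3 4 5 = 0).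
  closed H1; prods; lra.
have k :
    (K 3%N 0%N = - (cf r 2 3 4 * cf r 2 3 4)) *
    (K 3%N 1%N = - (2%:R * cf r 0 3 5 * cf r 2 3 4)) *
    (K 3%N 2%N = cf r 0 3 4 * cf r 2 3 4 + 2%:R * cf r 0 3 5 * cf r 1 3 4) *
    (K 3%N 3%N = cf r 0 1 5 * cf r 2 3 4 - (1%:R / 2%:R) * cf r 0 2 4 * cf r 2 3 4 - 2%:R * cf r 0 3 4 * cf r 1 3 4 - cf r 0 3 5 * cf r 1 2 4 + (1%:R / 2%:R) * cf r 1 2 3 * cf r 2 3 4 - cf r 1 2 4 * cf r 1 3 4) *
    (K 4%N 0%N = 0) * (K 4%N 1%N = cf r 2 3 4 * cf r 2 3 4) *
    (K 4%N 2%N = - (cf r 1 3 4 * cf r 2 3 4)) * (K 4%N 3%N = cf r 1 2 4 * cf r 2 3 4) *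
    (K 4%N 4%N = cf r 0 1 5 * cf r 2 3 4 + (1%:R / 2%:R) * cf r 0 2 4 * cf r 2 3 4 - 2%:R * cf r 0 3 4 * cf r 1 3 4 + cf r 0 3 5 * cf r 1 2 4 - (1%:R / 2%:R) * cf r 1 2 3 * cf r 2 3 4 - cf r 1 2 4 * cf r 1 3 4) *
    (K 5%N 0%N = 0) * (K 5%N 1%N = 0) * (K 5%N 2%N = (1%:R / 2%:R) * cf r 2 3 4 * cf r 2 3 4) *
    (K 5%N 3%N = - (cf r 1 3 4 * cf r 2 3 4)) *
    (K 5%N 4%N = cf r 0 3 4 * cf r 2 3 4 - 2%:R * cf r 0 3 5 * cf r 1 3 4 + cf r 1 2 4 * cf r 2 3 4).
  by prods; rewrite KE /Kp /= ?e; rf.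
have hh :
    (h [:: 3; 4; 5]%N = (1%:R / 2%:R) * cf r 2 3 4 * cf r 2 3 4 * cf r 2 3 4) *
    (h [:: 4; 3; 5]%N = - ((1%:R / 2%:R) * cf r 2 3 4 * cf r 2 3 4 * cf r 2 3 4)) *
    (h [:: 4; 4; 5]%N = 0) * (h [:: 5; 2; 5]%N = 0) * (h [:: 5; 3; 5]%N = 0) *
    (h [:: 5; 4; 5]%N = 0).
  by prods; rewrite hE /fsum /= ?k ?e; rf.
have gg :
    (g [:: 0; 2; 4; 5]%N = (1%:R / 2%:R) * cf r 2 3 4 * cf r 2 3 4 * cf r 2 3 4) *
    (g [:: 0; 3; 4; 5]%N = 0) *
    (g [:: 1; 2; 3; 5]%N = - ((1%:R / 2%:R) * cf r 2 3 4 * cf r 2 3 4 * cf r 2 3 4)) *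
    (g [:: 1; 2; 4; 5]%N = 0) * (g [:: 1; 3; 4; 5]%N = 0) * (g [:: 2; 3; 4; 5]%N = 0).
  by prods; rewrite gE /Ds /= ?hh; rf.
have Q0 : Pc g 0 (K ^~ 0%N) = 0 by rewrite /Pc /fsum /= ?k ?gg; rf.
have B : 1%:R * cf r 2 3 4 * cf r 2 3 4 * cf r 2 3 4 * cf r 2 3 4 * cf r 2 3 4 = 0.
  by rewrite -(H3 0%N 1%N isT isT isT Q0) /Pc /fsum /= ?k ?gg; rf.
have z : cf r 2 3 4 = 0 by move/eqP: B; rewrite !mulf_eq0 pnatr_eq0 /= !orbb => /eqP.
(* Once this coefficient vanishes, the quadratic form is zero at the covector 2, which opens the
   test on 2 and 4. *)
have kx :
    (K 2%N 0%N = 0) * (K 2%N 1%N = 0) *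
    (K 2%N 2%N = 2%:R * cf r 0 3 4 * cf r 1 3 4 + cf r 0 3 5 * cf r 1 2 4 + cf r 1 2 4 * cf r 1 3 4) *
    (K 2%N 3%N = - (2%:R * cf r 0 2 4 * cf r 1 3 4) - 2%:R * cf r 0 3 4 * cf r 1 2 4 - 2%:R * cf r 1 2 4 * cf r 1 2 4) *
    (K 2%N 4%N = 2%:R * cf r 0 2 3 * cf r 1 3 4 + 2%:R * cf r 0 3 4 * cf r 1 2 3 + 2%:R * cf r 1 2 3 * cf r 1 2 4) *
    (K 2%N 5%N = 2%:R * cf r 0 2 3 * cf r 1 2 4 - 2%:R * cf r 0 2 4 * cf r 1 2 3) *
    (K 3%N 0%N = 0) * (K 3%N 1%N = 0) * (K 3%N 2%N = 2%:R * cf r 0 3 5 * cf r 1 3 4) *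
    (K 3%N 3%N = - (2%:R * cf r 0 3 4 * cf r 1 3 4) - cf r 0 3 5 * cf r 1 2 4 - cf r 1 2 4 * cf r 1 3 4) *
    (K 3%N 4%N = 2%:R * cf r 0 3 5 * cf r 1 2 3) * (K 4%N 0%N = 0) * (K 4%N 1%N = 0) *
    (K 4%N 2%N = 0) * (K 4%N 3%N = 0) *
    (K 4%N 4%N = - (2%:R * cf r 0 3 4 * cf r 1 3 4) + cf r 0 3 5 * cf r 1 2 4 - cf r 1 2 4 * cf r 1 3 4) *
    (K 4%N 5%N = 2%:R * cf r 0 2 4 * cf r 1 3 4 - 2%:R * cf r 0 3 4 * cf r 1 2 4) *
    (K 5%N 0%N = 0) * (K 5%N 1%N = 0) * (K 5%N 2%N = 0) * (K 5%N 3%N = 0) *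
    (K 5%N 4%N = - (2%:R * cf r 0 3 5 * cf r 1 3 4)) *
    (K 5%N 5%N = 2%:R * cf r 0 3 4 * cf r 1 3 4 - cf r 0 3 5 * cf r 1 2 4 + cf r 1 2 4 * cf r 1 3 4).
  by prods; rewrite KE /Kp /= ?e ?z; rf.
have hhx :
    (h [:: 2; 2; 5]%N = 0) * (h [:: 2; 3; 4]%N = 0) * (h [:: 2; 3; 5]%N = 0) *
    (h [:: 2; 4; 5]%N = 0) * (h [:: 3; 1; 5]%N = 2%:R * cf r 0 3 5 * cf r 1 3 4 * cf r 1 3 4) *
    (h [:: 3; 3; 5]%N = 0) * (h [:: 4; 0; 5]%N = 0) * (h [:: 4; 1; 4]%N = 0) *
    (h [:: 4; 1; 5]%N = 0) * (h [:: 4; 2; 5]%N = 0) * (h [:: 4; 3; 5]%N = 0) *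
    (h [:: 4; 4; 5]%N = 0) * (h [:: 5; 0; 4]%N = 0) * (h [:: 5; 0; 5]%N = 0) *
    (h [:: 5; 1; 3]%N = - (2%:R * cf r 0 3 5 * cf r 1 3 4 * cf r 1 3 4)) *
    (h [:: 5; 1; 5]%N = 0) * (h [:: 5; 2; 5]%N = 0) * (h [:: 5; 3; 5]%N = 0) *
    (h [:: 5; 4; 5]%N = 0).
  by prods; rewrite hE /fsum /= ?kx ?e ?z; rf.
have ggx :
    (g [:: 0; 1; 2; 5]%N = - (2%:R * cf r 0 3 5 * cf r 1 3 4 * cf r 1 3 4)) *
    (g [:: 0; 1; 3; 4]%N = - (2%:R * cf r 0 3 5 * cf r 1 3 4 * cf r 1 3 4)) *
    (g [:: 0; 1; 3; 5]%N = 0) * (g [:: 0; 1; 4; 5]%N = 0) * (g [:: 0; 2; 3; 5]%N = 0) *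
    (g [:: 0; 3; 4; 5]%N = 0) * (g [:: 1; 2; 3; 5]%N = 0) * (g [:: 1; 3; 4; 5]%N = 0).
  by prods; rewrite gE /Ds /= ?hhx; rf.
have Q0x : Pc g 2 (K ^~ 2%N) = 0 by rewrite /Pc /fsum /= ?kx ?ggx; rf.
have Bx : 8%:R * cf r 0 3 5 * cf r 0 3 5 * cf r 1 3 4 * cf r 1 3 4 * cf r 1 3 4 = 0.
  by rewrite -(H3 2%N 4%N isT isT isT Q0x) /Pc /fsum /= ?kx ?ggx; rf.
have [y|y] : cf r 0 3 5 = 0 \/ cf r 1 3 4 = 0 by apply: mono_zero Bx; rewrite ?oppr_eq0 pnatr_eq0.
- have k0 :
      (K 5%N 0%N = 0) * (K 5%N 1%N = 0) * (K 5%N 2%N = 0) * (K 5%N 3%N = 0) * (K 5%N 4%N = 0).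
    by prods; rewrite KE /Kp /= ?e ?z ?y; rf.
  have := H2 5%N isT; rewrite /fsum /= !k0.
  rewrite !(mul0r, mulr0, addr0, add0r) => hneg.
  by have := sqr_ge0 (K 5%N 5%N); rewrite expr2 leNgt hneg.
(* In this branch it is column 0, not row 5, that has no off-diagonal entry; the diagonal entry of
   K^2 is again a square. *)
- have k0 :
      (K 1%N 0%N = 0) * (K 2%N 0%N = 0) * (K 3%N 0%N = 0) * (K 4%N 0%N = 0) * (K 5%N 0%N = 0).
    by prods; rewrite KE /Kp /= ?e ?z ?y; rf.
  have := H2 0%N isT; rewrite /fsum /= !k0.
  rewrite !(mul0r, mulr0, addr0, add0r) => hneg.
  by have := sqr_ge0 (K 0%N 0%N); rewrite expr2 leNgt hneg.
Qed.

Definition L12 := [:: entry 0 1 3 (-1); entry 0 3 4 (-1); entry 0 4 5 (-1);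
  entry 1 3 5 (-1)].

Lemma g12_tbr : @g12 R = tbr L12. Proof. tbr_eq. Qed.

Lemma g12_not_mean_convex nu w : is_volume_form nu -> ~ mean_convex (@g12 R) nu w.
Proof.
rewrite g12_tbr => nuv mc.
have [r [K [h [g [KE hE gE H1 [H2 H3]]]]]] := polar_zero (L := L12) isT isT nuv mc.
have e :
    (cf r 0 2 5 = cf r 1 2 4) * (cf r 0 4 5 = - (cf r 1 3 5)) * (cf r 1 2 5 = cf r 2 3 4) *
    (cf r 1 4 5 = 0) * (cf r 2 3 5 = 0) * (cf r 2 4 5 = 0) * (cf r 3 4 5 = 0).
  closed H1; prods; lra.
have k :
    (K 3%N 0%N = 2%:R * cf r 1 3 5 * cf r 2 3 4) *
    (K 3%N 1%N = - (2%:R * cf r 0 3 5 * cf r 2 3 4)) *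
    (K 3%N 2%N = - (2%:R * cf r 0 3 4 * cf r 1 3 5) + 2%:R * cf r 0 3 5 * cf r 1 3 4) *
    (K 3%N 3%N = cf r 0 1 5 * cf r 2 3 4 + cf r 0 2 4 * cf r 1 3 5 + cf r 0 3 4 * cf r 2 3 4 - cf r 0 3 5 * cf r 1 2 4 + cf r 1 2 3 * cf r 1 3 5 - cf r 1 2 4 * cf r 1 3 4) *
    (K 4%N 0%N = 0) * (K 4%N 1%N = 2%:R * cf r 1 3 5 * cf r 2 3 4) *
    (K 4%N 2%N = - (2%:R * cf r 1 3 4 * cf r 1 3 5)) *
    (K 4%N 3%N = 2%:R * cf r 1 2 4 * cf r 1 3 5) * (K 5%N 0%N = 0) * (K 5%N 1%N = 0) *
    (K 5%N 2%N = - (2%:R * cf r 1 3 5 * cf r 1 3 5)) *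
    (K 5%N 3%N = 2%:R * cf r 1 3 5 * cf r 2 3 4) *
    (K 5%N 4%N = 2%:R * cf r 0 3 5 * cf r 2 3 4 - 2%:R * cf r 1 2 4 * cf r 1 3 5) *
    (K 5%N 5%N = - (cf r 0 1 5 * cf r 2 3 4) + cf r 0 2 4 * cf r 1 3 5 - cf r 0 3 4 * cf r 2 3 4 - cf r 0 3 5 * cf r 1 2 4 - cf r 1 2 3 * cf r 1 3 5 + cf r 1 2 4 * cf r 1 3 4).
  by prods; rewrite KE /Kp /= ?e; rf.
have hh :
    (h [:: 3; 4; 5]%N = - (2%:R * cf r 1 3 5 * cf r 1 3 5 * cf r 2 3 4)) *
    (h [:: 4; 4; 5]%N = 0) * (h [:: 5; 1; 5]%N = 0) *
    (h [:: 5; 2; 4]%N = - (2%:R * cf r 1 3 5 * cf r 2 3 4 * cf r 2 3 4)) *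
    (h [:: 5; 2; 5]%N = 0) * (h [:: 5; 3; 5]%N = 0) * (h [:: 5; 4; 5]%N = 0).
  by prods; rewrite hE /fsum /= ?k ?e; rf.
have gg :
    (g [:: 0; 1; 4; 5]%N = - (2%:R * cf r 1 3 5 * cf r 1 3 5 * cf r 2 3 4)) *
    (g [:: 0; 3; 4; 5]%N = 0) *
    (g [:: 1; 2; 3; 4]%N = 2%:R * cf r 1 3 5 * cf r 2 3 4 * cf r 2 3 4) *
    (g [:: 1; 2; 3; 5]%N = 0) * (g [:: 1; 2; 4; 5]%N = 0) * (g [:: 1; 3; 4; 5]%N = 0) *
    (g [:: 2; 3; 4; 5]%N = 0).
  by prods; rewrite gE /Ds /= ?hh; rf.
have Q0 : Pc g 0 (K ^~ 0%N) = 0 by rewrite /Pc /fsum /= ?k ?gg; rf.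
have B : (- 8%:R) * cf r 2 3 4 * cf r 2 3 4 * cf r 1 3 5 * cf r 1 3 5 * cf r 1 3 5 = 0.
  by rewrite -(H3 0%N 2%N isT isT isT Q0) /Pc /fsum /= ?k ?gg; rf.
(* Each alternative requires its own second test, on the covectors 3 and 2 in the first one and on 1
   and 4 in the second one. *)
have [z|z] : cf r 2 3 4 = 0 \/ cf r 1 3 5 = 0 by apply: mono_zero B; rewrite ?oppr_eq0 pnatr_eq0.
- have kx :
      (K 3%N 0%N = 0) * (K 3%N 1%N = 0) *
      (K 3%N 2%N = - (2%:R * cf r 0 3 4 * cf r 1 3 5) + 2%:R * cf r 0 3 5 * cf r 1 3 4) *
      (K 3%N 3%N = cf r 0 2 4 * cf r 1 3 5 - cf r 0 3 5 * cf r 1 2 4 + cf r 1 2 3 * cf r 1 3 5 - cf r 1 2 4 * cf r 1 3 4) *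
      (K 3%N 4%N = - (2%:R * cf r 0 2 3 * cf r 1 3 5) + 2%:R * cf r 0 3 5 * cf r 1 2 3) *
      (K 3%N 5%N = 2%:R * cf r 0 2 3 * cf r 1 3 4 - 2%:R * cf r 0 3 4 * cf r 1 2 3) *
      (K 4%N 0%N = 0) * (K 4%N 1%N = 0) * (K 4%N 2%N = - (2%:R * cf r 1 3 4 * cf r 1 3 5)) *
      (K 4%N 3%N = 2%:R * cf r 1 2 4 * cf r 1 3 5) *
      (K 4%N 4%N = - (cf r 0 2 4 * cf r 1 3 5) + cf r 0 3 5 * cf r 1 2 4 - cf r 1 2 3 * cf r 1 3 5 - cf r 1 2 4 * cf r 1 3 4) *
      (K 5%N 0%N = 0) * (K 5%N 1%N = 0) * (K 5%N 2%N = - (2%:R * cf r 1 3 5 * cf r 1 3 5)) *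
      (K 5%N 3%N = 0) * (K 5%N 4%N = - (2%:R * cf r 1 2 4 * cf r 1 3 5)) *
      (K 5%N 5%N = cf r 0 2 4 * cf r 1 3 5 - cf r 0 3 5 * cf r 1 2 4 - cf r 1 2 3 * cf r 1 3 5 + cf r 1 2 4 * cf r 1 3 4).
    by prods; rewrite KE /Kp /= ?e ?z; rf.
  have hhx :
      (h [:: 3; 2; 4]%N = 0) * (h [:: 3; 2; 5]%N = 0) * (h [:: 3; 3; 5]%N = 0) *
      (h [:: 3; 4; 5]%N = 0) *
      (h [:: 4; 1; 5]%N = - (2%:R * cf r 1 2 4 * cf r 1 3 5 * cf r 1 3 5)) *
      (h [:: 4; 4; 5]%N = 0) * (h [:: 5; 0; 5]%N = 0) *
      (h [:: 5; 1; 2]%N = - (2%:R * cf r 1 2 4 * cf r 1 2 4 * cf r 1 3 5)) *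
      (h [:: 5; 1; 5]%N = 0) * (h [:: 5; 2; 5]%N = 0) * (h [:: 5; 3; 5]%N = 0) *
      (h [:: 5; 4; 5]%N = 0).
    by prods; rewrite hE /fsum /= ?kx ?e ?z; rf.
  have ggx :
      (g [:: 0; 1; 2; 4]%N = - (2%:R * cf r 1 2 4 * cf r 1 2 4 * cf r 1 3 5)) *
      (g [:: 0; 1; 2; 5]%N = 0) *
      (g [:: 0; 1; 3; 5]%N = 2%:R * cf r 1 2 4 * cf r 1 3 5 * cf r 1 3 5) *
      (g [:: 0; 1; 4; 5]%N = 0) * (g [:: 0; 2; 4; 5]%N = 0) * (g [:: 0; 3; 4; 5]%N = 0) *
      (g [:: 1; 2; 4; 5]%N = 0) * (g [:: 1; 3; 4; 5]%N = 0).
    by prods; rewrite gE /Ds /= ?hhx; rf.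
  have Q0x : Pc g 3 (K ^~ 3%N) = 0 by rewrite /Pc /fsum /= ?kx ?ggx; rf.
  have Bx : (- 8%:R) * cf r 1 2 4 * cf r 1 2 4 * cf r 1 3 5 * cf r 1 3 5 * cf r 1 3 5 = 0.
    by rewrite -(H3 3%N 2%N isT isT isT Q0x) /Pc /fsum /= ?kx ?ggx; rf.
  have [y|y] : cf r 1 2 4 = 0 \/ cf r 1 3 5 = 0 by apply: mono_zero Bx; rewrite ?oppr_eq0 pnatr_eq0.
  + have k0 :
        (K 1%N 0%N = 0) * (K 2%N 0%N = 0) * (K 3%N 0%N = 0) * (K 4%N 0%N = 0) * (K 5%N 0%N = 0).
      by prods; rewrite KE /Kp /= ?e ?z ?y; rf.
    have := H2 0%N isT; rewrite /fsum /= !k0.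
    rewrite !(mul0r, mulr0, addr0, add0r) => hneg.
    by have := sqr_ge0 (K 0%N 0%N); rewrite expr2 leNgt hneg.
  + have k0 :
        (K 5%N 0%N = 0) * (K 5%N 1%N = 0) * (K 5%N 2%N = 0) * (K 5%N 3%N = 0) * (K 5%N 4%N = 0).
      by prods; rewrite KE /Kp /= ?e ?z ?y; rf.
    have := H2 5%N isT; rewrite /fsum /= !k0.
    rewrite !(mul0r, mulr0, addr0, add0r) => hneg.
    by have := sqr_ge0 (K 5%N 5%N); rewrite expr2 leNgt hneg.
- have kx :
      (K 3%N 0%N = 0) * (K 3%N 1%N = - (2%:R * cf r 0 3 5 * cf r 2 3 4)) *
      (K 3%N 2%N = 2%:R * cf r 0 3 5 * cf r 1 3 4) *
      (K 3%N 3%N = cf r 0 1 5 * cf r 2 3 4 + cf r 0 3 4 * cf r 2 3 4 - cf r 0 3 5 * cf r 1 2 4 - cf r 1 2 4 * cf r 1 3 4) *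
      (K 3%N 4%N = 2%:R * cf r 0 3 5 * cf r 1 2 3) * (K 4%N 0%N = 0) * (K 4%N 1%N = 0) *
      (K 4%N 2%N = 0) * (K 4%N 3%N = 0) *
      (K 4%N 4%N = cf r 0 1 5 * cf r 2 3 4 + cf r 0 3 4 * cf r 2 3 4 + cf r 0 3 5 * cf r 1 2 4 - cf r 1 2 4 * cf r 1 3 4) *
      (K 4%N 5%N = - (2%:R * cf r 0 1 4 * cf r 2 3 4) + 2%:R * cf r 0 2 4 * cf r 1 3 4 - 2%:R * cf r 0 3 4 * cf r 1 2 4) *
      (K 5%N 0%N = 0) * (K 5%N 1%N = 0) * (K 5%N 2%N = 0) * (K 5%N 3%N = 0) *
      (K 5%N 4%N = 2%:R * cf r 0 3 5 * cf r 2 3 4) *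
      (K 5%N 5%N = - (cf r 0 1 5 * cf r 2 3 4) - cf r 0 3 4 * cf r 2 3 4 - cf r 0 3 5 * cf r 1 2 4 + cf r 1 2 4 * cf r 1 3 4).
    by prods; rewrite KE /Kp /= ?e ?z; rf.
  have hhx :
      (h [:: 3; 2; 5]%N = - (2%:R * cf r 0 3 5 * cf r 2 3 4 * cf r 2 3 4)) *
      (h [:: 3; 3; 5]%N = 0) * (h [:: 4; 1; 5]%N = 0) * (h [:: 4; 2; 4]%N = 0) *
      (h [:: 4; 2; 5]%N = 0) * (h [:: 4; 4; 5]%N = 0) * (h [:: 5; 0; 5]%N = 0) *
      (h [:: 5; 2; 3]%N = 2%:R * cf r 0 3 5 * cf r 2 3 4 * cf r 2 3 4) * (h [:: 5; 2; 5]%N = 0) *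
      (h [:: 5; 3; 5]%N = 0).
    by prods; rewrite hE /fsum /= ?kx ?e ?z; rf.
  have ggx :
      (g [:: 0; 1; 2; 5]%N = - (2%:R * cf r 0 3 5 * cf r 2 3 4 * cf r 2 3 4)) *
      (g [:: 0; 1; 3; 5]%N = 0) *
      (g [:: 0; 2; 3; 4]%N = 2%:R * cf r 0 3 5 * cf r 2 3 4 * cf r 2 3 4) *
      (g [:: 0; 2; 3; 5]%N = 0) * (g [:: 0; 2; 4; 5]%N = 0) * (g [:: 0; 3; 4; 5]%N = 0) *
      (g [:: 1; 2; 3; 5]%N = 0) * (g [:: 2; 3; 4; 5]%N = 0).
    by prods; rewrite gE /Ds /= ?hhx; rf.
  have Q0x : Pc g 1 (K ^~ 1%N) = 0 by rewrite /Pc /fsum /= ?kx ?ggx; rf.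
  have Bx : (- 8%:R) * cf r 0 3 5 * cf r 0 3 5 * cf r 2 3 4 * cf r 2 3 4 * cf r 2 3 4 = 0.
    by rewrite -(H3 1%N 4%N isT isT isT Q0x) /Pc /fsum /= ?kx ?ggx; rf.
  have [y|y] : cf r 0 3 5 = 0 \/ cf r 2 3 4 = 0 by apply: mono_zero Bx; rewrite ?oppr_eq0 pnatr_eq0.
  + have k0 :
        (K 5%N 0%N = 0) * (K 5%N 1%N = 0) * (K 5%N 2%N = 0) * (K 5%N 3%N = 0) * (K 5%N 4%N = 0).
      by prods; rewrite KE /Kp /= ?e ?z ?y; rf.
    have := H2 5%N isT; rewrite /fsum /= !k0.
    rewrite !(mul0r, mulr0, addr0, add0r) => hneg.
    by have := sqr_ge0 (K 5%N 5%N); rewrite expr2 leNgt hneg.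
  + have k0 :
        (K 5%N 0%N = 0) * (K 5%N 1%N = 0) * (K 5%N 2%N = 0) * (K 5%N 3%N = 0) * (K 5%N 4%N = 0).
      by prods; rewrite KE /Kp /= ?e ?z ?y; rf.
    have := H2 5%N isT; rewrite /fsum /= !k0.
    rewrite !(mul0r, mulr0, addr0, add0r) => hneg.
    by have := sqr_ge0 (K 5%N 5%N); rewrite expr2 leNgt hneg.
Qed.

End Obstructions.

(** * The standard form *)

Section Standard.
Variable R : realType.
Local Notation V := 'rV[R]_6.

(** The complex structure for which the forms f_k + i f_(k+3), k < 3, are of type (1,0); as
    everywhere, the matrix acts on rows from the right. *)
Definition J0 : 'M[R]_6 :=
  \matrix_(i, j) if (j == i + 3 :> nat)%N then 1 else if (i == j + 3 :> nat)%N then -1 else 0.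

Lemma mulJ0_l (v : V) (j : 'I_3) : (v *m J0) 0 (lshift 3 j) = - v 0 (rshift 3 j : 'I_6).
Proof.
have j3 := ltn_ord j.
rewrite mxE (bigD1 (rshift 3 j : 'I_6)) //= big1 ?addr0 => [|i ij]; rewrite mxE /=.
  case: eqP => [|_]; first by lia.
  by case: eqP => [_|]; [rewrite mulrN1|lia].
case: eqP => [|_]; first by lia.
case: eqP => [e|]; last by rewrite mulr0.
by case/eqP: ij; apply: val_inj => /=; lia.
Qed.

Lemma mulJ0_r (v : V) (j : 'I_3) : (v *m J0) 0 (rshift 3 j) = v 0 (lshift 3 j : 'I_6).
Proof.
have j3 := ltn_ord j.
rewrite mxE (bigD1 (lshift 3 j : 'I_6)) //= big1 ?addr0 => [|i ij]; rewrite mxE /=.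
  by case: eqP => [_|]; [rewrite mulr1|lia].
have i6 := ltn_ord i.
case: eqP => [e|_]; first by case/eqP: ij; apply: val_inj => /=; lia.
by case: eqP => [|_]; [lia|rewrite mulr0].
Qed.

(** The outer factors of the decomposition are unipotent. Over the complex numbers, with z = i, it
    yields the squared modulus of \det (A + i B), which is why all complex bases induce the same
    orientation. *)
Lemma det_block_sqrtN1 (K : comNzRingType) n (z : K) (A B : 'M[K]_n) : z * z = -1 ->
  \det (block_mx A B (- B) A) = \det (A + z *: B) * \det (A - z *: B).
Proof.
move=> zz; have -> : block_mx A B (- B) A =
    block_mx 1%:M 0 z%:M 1%:M *m block_mx (A + z *: B) B 0 (A - z *: B)
    *m block_mx 1%:M 0 (- z)%:M 1%:M.
  rewrite !mulmx_block !mul1mx !mulmx1 !mul0mx !mulmx0 !addr0 !add0r.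
  rewrite !mul_scalar_mx !mul_mx_scalar; congr block_mx.
  - by rewrite scaleNr addrK.
  - rewrite !scalerDr !scalerN !scalerA !mulNr zz opprK !scaleNr !scale1r.
    by apply/matrixP=> i j; rewrite !mxE; ring.
  - by rewrite addrC subrK.
by rewrite !det_mulmx !det_lblock !det1 !mul1r det_ublock mulr1.
Qed.

Section Positive.
Local Open Scope complex_scope.

Lemma det_block_J (A B : 'M[R]_3) :
  (\det (block_mx A B (- B) A))%:C =
  \det (map_mx (real_complex R) A + 'i *: map_mx (real_complex R) B) *
  (\det (map_mx (real_complex R) A + 'i *: map_mx (real_complex R) B))^*.
Proof.
set cA := map_mx _ A; set cB := map_mx _ B; set X := cA + 'i *: cB.
have ii : 'i * 'i = -1 :> R[i] by apply/eqP; rewrite eq_complex /=; apply/andP; split; apply/eqP; ring.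
have cj : (\det X)^* = \det (cA - 'i *: cB).
  rewrite -det_map_mx; congr (\det _); apply/matrixP=> i j; rewrite !mxE.
  by apply/eqP; rewrite eq_complex /=; apply/andP; split; apply/eqP; ring.
transitivity (\det X * \det (cA - 'i *: cB)); last by congr (_ * _); exact: esym cj.
by rewrite -det_map_mx map_block_mx map_mxN -/cA -/cB (det_block_sqrtN1 _ _ ii).
Qed.

Lemma normc_gt0 (z : R[i]) (x : R) : x%:C = z * z^* -> x != 0 -> 0 < x.
Proof.
case: z => a b /eqP; rewrite eq_complex /= => /andP[/eqP -> _].
rewrite mulrN opprK lt0r => -> /=.
by rewrite addr_ge0 // -expr2 sqr_ge0.
Qed.
End Positive.

(** The reordering of v1, v2, v3, J v1, J v2, J v3 into v1, J v1, v2, J v2, v3, J v3. The first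
    order gives a block determinant, the second one is the order that defines the orientation;
    [tau0] corrects by the sign of this permutation. *)
Lemma interleave_inj :
  injective (fun i : 'I_6 => inord (nth 0%N [:: 0; 3; 1; 4; 2; 5]%N i) : 'I_6).
Proof.
move=> i j /(congr1 val) /=.
have lt6 (k : 'I_6) : (nth 0%N [:: 0; 3; 1; 4; 2; 5]%N k < 6)%N.
  by case: k => [[|[|[|[|[|[|//]]]]]] h].
by rewrite !inordK // => /eqP; rewrite nth_uniq // => /eqP/val_inj.
Qed.

Definition tau0 : kform R R 6 :=
  fun M => (-1) ^+ (perm interleave_inj) * \det M.

Lemma det_kform c : is_kform (fun M : 'M[R]_6 => c * \det M).
Proof.
split=> [i A B C b d Ai Bi Ci|M i j ij Mij].
  by rewrite (determinant_multilinear (A := A) (B := B) (C := C) (i0 := i) (b := b) (c := d)) //; ring.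
rewrite (determinant_alternate ij) ?mulr0 // => k.
by have /rowP/(_ k) := Mij; rewrite !mxE.
Qed.

Lemma tau0_positive : positive_volume J0 tau0.
Proof.
split; first split; first exact: det_kform.
  by rewrite /tau0 det1 mulr1 signr_eq0.
move=> v1 v2 v3 M Mu; rewrite /tau0.
pose A : 'M[R]_3 := \matrix_(i, j) (nth 0 [:: v1; v2; v3] i) 0 (@lshift 3 3 j).
pose B : 'M[R]_3 := \matrix_(i, j) (nth 0 [:: v1; v2; v3] i) 0 (@rshift 3 3 j).
have ME : M = row_perm (perm interleave_inj) (block_mx A B (- B) A).
  have -> : M = mxl 6 [:: v1; v1 *m J0; v2; v2 *m J0; v3; v3 *m J0].
    rewrite /M; move: (v3 *m J0) => y.
    have {1}-> : y = mxl 1 [:: y] by apply/rowP=> j; rewrite !mxE.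
    by rewrite !col_mxl.
  have -> : block_mx A B (- B) A = mxl 6 [:: v1; v2; v3; v1 *m J0; v2 *m J0; v3 *m J0].
    apply/matrixP=> i j; rewrite [RHS]mxE.
    case: (@split_ordP 3 3 i) => a ->; case: (@split_ordP 3 3 j) => b ->.
    - by rewrite block_mxEul [LHS]mxE; case: a => [[|[|[|//]]] ha].
    - by rewrite block_mxEur [LHS]mxE; case: a => [[|[|[|//]]] ha].
    - rewrite block_mxEdl [LHS]mxE [X in - X]mxE.
      by case: a => [[|[|[|//]]] ha]; rewrite /= mulJ0_l.
    - rewrite block_mxEdr [LHS]mxE.
      by case: a => [[|[|[|//]]] ha]; rewrite /= mulJ0_r.
  apply/matrixP=> i j; rewrite !mxE permE inordK.
    by case: i => [[|[|[|[|[|[|//]]]]]] hi].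
  by case: i => [[|[|[|[|[|[|//]]]]]] hi].
rewrite ME row_permE det_mulmx det_perm mulrA -signr_addb addbb mul1r.
apply: (normc_gt0 (det_block_J A B)).
by move: Mu; rewrite unitmxE unitfE ME row_permE det_mulmx mulf_eq0 => /norP[].
Qed.


Lemma kformD k (a b : kform R R k) c d : is_kform a -> is_kform b ->
  is_kform (fun M => c * a M + d * b M).
Proof.
move=> [al aa] [bl ba]; split=> [i A B C x y Ai Bi Ci|M i j ij Mij].
  by rewrite (al i A B C x y) // (bl i A B C x y) //; ring.
by rewrite (aa M i j) // (ba M i j) // !mulr0 addr0.
Qed.

Definition det3 (a b c : nat) : kform R R 3 :=
  fun M => \det (\matrix_(i < 3, j < 3) M i (inord (nth 0%N [:: a; b; c] j))).
Lemma det3_kform a b c : is_kform (det3 a b c).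
Proof.
split=> [i A B C x y Ai Bi Ci|M i j ij Mij].
  rewrite /det3 (determinant_multilinear (i0 := i) (b := x) (c := y)
    (B := \matrix_(i < 3, j < 3) B i (inord (nth 0%N [:: a; b; c] j)))
    (C := \matrix_(i < 3, j < 3) C i (inord (nth 0%N [:: a; b; c] j)))) //.
  - by apply/rowP=> k; move/rowP: Ai => /(_ (inord (nth 0%N [:: a; b; c] k))); rewrite !mxE.
  - by apply/matrixP=> l k; move/matrixP: Bi => /(_ l (inord (nth 0%N [:: a; b; c] k))); rewrite !mxE.
  - by apply/matrixP=> l k; move/matrixP: Ci => /(_ l (inord (nth 0%N [:: a; b; c] k))); rewrite !mxE.
rewrite /det3 (determinant_alternate ij) // => k.
by have /rowP/(_ (inord (nth 0%N [:: a; b; c] k))) := Mij; rewrite !mxE.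
Qed.

Lemma det3E a b c (M : 'M[R]_(3, 6)) :
  let m i k := M (inord i) (inord k) in
  det3 a b c M = m 0%N a * (m 1%N b * m 2%N c - m 1%N c * m 2%N b)
    - m 0%N b * (m 1%N a * m 2%N c - m 1%N c * m 2%N a)
    + m 0%N c * (m 1%N a * m 2%N b - m 1%N b * m 2%N a).
Proof.
move=> m; rewrite /det3 (expand_det_row _ ord0) !big_ord_recl big_ord0 /cofactor.
rewrite !(expand_det_row _ ord0) !big_ord_recl !big_ord0 /cofactor !det_mx11 !mxE /=.
have e0 : ord0 = inord 0 :> 'I_3 by apply: val_inj; rewrite /= inordK.
have e1 : lift (inord 0) ord0 = inord 1 :> 'I_3 by apply: val_inj; rewrite /= !inordK.
have e2 : lift (inord 0) (lift ord0 ord0) = inord 2 :> 'I_3 by apply: val_inj; rewrite /= !inordK.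
rewrite e0 e1 e2 /bump /= /m; ring.
Qed.

(* Real and imaginary part of (x0 + i x3) /\ (x1 + i x4) /\ (x2 + i x5). *)
Definition rho0 : kform R R 3 := fun M =>
  det3 0%N 1%N 2%N M - det3 0%N 4%N 5%N M + det3 1%N 3%N 5%N M - det3 2%N 3%N 4%N M.
Definition sigma0 : kform R R 3 := fun M =>
  det3 0%N 1%N 5%N M - det3 0%N 2%N 4%N M + det3 1%N 2%N 3%N M - det3 3%N 4%N 5%N M.

(** Only increasing triples are listed; [nf] supplies the other orders. *)
Definition rho0c (l : seq nat) : R :=
  match l with
  | [:: 0; 1; 2]%N | [:: 1; 3; 5]%N => 1
  | [:: 0; 4; 5]%N | [:: 2; 3; 4]%N => -1
  | _ => 0 end.
Definition sigma0c (l : seq nat) : R :=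
  match l with
  | [:: 0; 1; 5]%N | [:: 1; 2; 3]%N => 1
  | [:: 0; 2; 4]%N | [:: 3; 4; 5]%N => -1
  | _ => 0 end.

Let det3_lin4 a b c d e f g h k l m n : is_kform (fun M =>
  det3 a b c M - det3 d e f M + det3 g h k M - det3 l m n M).
Proof.
have D := kformD; have k3 := det3_kform.
have := D _ _ _ 1 1 (D _ _ _ 1 (-1) (k3 a b c) (k3 d e f)) (D _ _ _ 1 (-1) (k3 g h k) (k3 l m n)).
by congr is_kform; apply: funext => M; ring.
Qed.
Lemma rho0_kform : is_kform rho0. Proof. exact: det3_lin4. Qed.
Lemma sigma0_kform : is_kform sigma0. Proof. exact: det3_lin4. Qed.

Lemma det3_coef a b c x y z : (a < 6)%N -> (b < 6)%N -> (c < 6)%N ->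
  let m i k := (Nat.eqb i k)%:R : R in
  coef (det3 a b c) [:: x; y; z] = m x a * (m y b * m z c - m y c * m z b)
    - m x b * (m y a * m z c - m y c * m z a)
    + m x c * (m y a * m z b - m y b * m z a).
Proof.
move=> a6 b6 c6 m; rewrite /coef det3E.
have E i k : (i < 3)%N -> (k < 6)%N -> bm R 3 [:: x; y; z] (inord i) (inord k) = m (nth 0%N [:: x; y; z] i) k.
  move=> i3 k6; rewrite /bm mxE inordK // (nth_map 0%N) // evE //.
by rewrite !E.
Qed.

Lemma nf_incr (r r' : seq nat -> R) x y z : (x < 6)%N -> (y < 6)%N -> (z < 6)%N ->
  (forall a b c, (a < b < c)%N -> (c < 6)%N -> r [:: a; b; c] = r' [:: a; b; c]) ->
  nf r [:: x; y; z] = nf r' [:: x; y; z].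
Proof.
move=> x6 y6 z6 H; rewrite /nf.
case: (PeanoNat.Nat.compare_spec x y) => xy; case: (PeanoNat.Nat.compare_spec y z) => yz;
  case: (PeanoNat.Nat.compare_spec x z) => xz //; by rewrite H //; lia.
Qed.

Ltac triples a b c :=
  do 6?[case: c => [|c]]; rewrite ?ltn0 ?andbF // => + _;
  do 5?[case: b => [|b]]; rewrite ?ltn0 ?andbF //; do 4?[case: a => [|a]]; rewrite // => _.

Lemma rho0_coef x y z : (x < 6)%N -> (y < 6)%N -> (z < 6)%N ->
  coef rho0 [:: x; y; z] = nf rho0c [:: x; y; z].
Proof.
move=> x6 y6 z6; rewrite (coefE rho0_kform) //; apply: nf_incr => // a b c.
by rewrite /rho0 {1}/coef -!/(coef _ _) !det3_coef //; triples a b c; rewrite /=; ring.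
Qed.

Lemma sigma0_coef x y z : (x < 6)%N -> (y < 6)%N -> (z < 6)%N ->
  coef sigma0 [:: x; y; z] = nf sigma0c [:: x; y; z].
Proof.
move=> x6 y6 z6; rewrite (coefE sigma0_kform) //; apply: nf_incr => // a b c.
by rewrite /sigma0 {1}/coef -!/(coef _ _) !det3_coef //; triples a b c; rewrite /=; ring.
Qed.

End Standard.

(** * K, J and hat rho for the standard form up to sign *)

Section Standard.
Variable R : realType.
Local Notation V := 'rV[R]_6.

Section Eps.
Variable e : R.
Hypothesis e2 : e ^+ 2 = 1.
Let w : kform R R 3 := fun M => e * rho0 M.
(** The sign of the volume form is the one for which J comes out as [J0] and not as its negative. *)
Let nu : kform R R 6 := fun M => -1 * \det M.

Lemma w_kform : is_kform w.
Proof.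
have := kformD e 0 (rho0_kform R) (rho0_kform R).
by congr is_kform; apply: funext => M; rewrite mul0r addr0.
Qed.

Lemma nu_volume : is_volume_form nu.
Proof. by split; [exact: det_kform|rewrite /nu det1 mulr1 oppr_eq0 oner_neq0]. Qed.

Lemma w_coef x y z : (x < 6)%N -> (y < 6)%N -> (z < 6)%N ->
  coef w [:: x; y; z] = e * nf (@rho0c R) [:: x; y; z].
Proof. by move=> x6 y6 z6; rewrite -rho0_coef. Qed.

(** K is quadratic in the form, so the sign [e] drops out, while hat rho keeps it. *)
Lemma Kp_w (i k : nat) : (i < 6)%N -> (k < 6)%N ->
  Kp (nf (coef w)) i k = 
    if Nat.eqb k (i + 3) then 2%:R else if Nat.eqb i (k + 3) then - 2%:R else 0.
Proof.
have : forall x y z, (x < 6)%N -> (y < 6)%N -> (z < 6)%N ->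
    nf (coef w) [:: x; y; z] = e * nf (@rho0c R) [:: x; y; z].
  by move=> x y z x6 y6 z6; rewrite -w_coef // -coefE //; exact: w_kform.
move: (nf _) => q E.
move=> i6 k6; rewrite -[RHS]mul1r -[X in _ = X * _]e2; move: i6 k6.
do 6?[case: i => [|i]]; rewrite // => _; do 6?[case: k => [|k]]; rewrite // => _;
  rewrite /Kp /= !E //=; ring.
Qed.

Lemma lambda_w : lambda_of nu w = - 4%:R.
Proof.
rewrite (lambda_poly nu_volume w_kform (i := 0)) // /fsum /= !Kp_w //= /nu det1; by field.
Qed.

Lemma J_w : J_of nu w = J0 R.
Proof.
rewrite /J_of lambda_w opprK.
have -> : Num.sqrt 4%:R = 2%:R :> R.
  by rewrite -[2%:R]ger0_norm // -sqrtr_sqr; congr Num.sqrt; ring.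
apply/matrixP=> i j; have := K_entry_poly nu w_kform i j.
rewrite Kp_w // /nu det1; move: (K_of _ _) => K KE; rewrite !mxE {}KE.
have i6 := ltn_ord i; have j6 := ltn_ord j.
case: (PeanoNat.Nat.eqb_spec j (i + 3)) => [->|/eqP/negbTE h]; first by rewrite eqxx; field.
rewrite -plusE h; case: (PeanoNat.Nat.eqb_spec i (j + 3)) => [->|/eqP/negbTE h'].
  by rewrite eqxx; field.
by rewrite [X in _ = if X then _ else _]h'; field.
Qed.

Lemma hat_w M : hat nu w M = e * sigma0 M.
Proof.
rewrite /hat J_w /pullback /w /rho0 /sigma0 !det3E; congr (_ * _).
have E i (k : nat) : (k < 3)%N -> (M *m J0 R) i (inord k) = - M i (inord (k + 3)).
  move=> k3; have := mulJ0_l (row i M) (Ordinal k3); rewrite -row_mul !mxE.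
  have -> : lshift 3 (Ordinal k3) = inord k :> 'I_6.
    by apply: val_inj; rewrite /= inordK //; apply: ltn_trans k3 _.
  have -> // : rshift 3 (Ordinal k3) = inord (k + 3) :> 'I_6.
  by apply: val_inj; rewrite /= inordK addnC // -[6]/(3 + 3)%N ltn_add2l.
have F i (k : nat) : (k < 3)%N -> (M *m J0 R) i (inord (k + 3)) = M i (inord k).
  move=> k3; have := mulJ0_r (row i M) (Ordinal k3); rewrite -row_mul !mxE.
  have -> : lshift 3 (Ordinal k3) = inord k :> 'I_6.
    by apply: val_inj; rewrite /= inordK //; apply: ltn_trans k3 _.
  have -> // : rshift 3 (Ordinal k3) = inord (k + 3) :> 'I_6.
  by apply: val_inj; rewrite /= inordK addnC // -[6]/(3 + 3)%N ltn_add2l.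
have F3 i : (M *m J0 R) i (inord 3) = M i (inord 0) := F i 0%N isT.
have F4 i : (M *m J0 R) i (inord 4) = M i (inord 1) := F i 1%N isT.
have F5 i : (M *m J0 R) i (inord 5) = M i (inord 2) := F i 2%N isT.
by rewrite !F3 !F4 !F5 !E //=; ring.
Qed.
End Eps.
End Standard.

(** * A criterion for mean convexity on structure constants *)

Section Standard.
Variable R : realType.
Local Notation V := 'rV[R]_6.


Definition quads : seq (seq nat) :=
  [:: [:: 0; 1; 2; 3]; [:: 0; 1; 2; 4]; [:: 0; 1; 2; 5]; [:: 0; 1; 3; 4]; [:: 0; 1; 3; 5];
      [:: 0; 1; 4; 5]; [:: 0; 2; 3; 4]; [:: 0; 2; 3; 5]; [:: 0; 2; 4; 5]; [:: 0; 3; 4; 5];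
      [:: 1; 2; 3; 4]; [:: 1; 2; 3; 5]; [:: 1; 2; 4; 5]; [:: 1; 3; 4; 5]; [:: 2; 3; 4; 5]]%N.

Lemma quads_ind (P : seq nat -> Prop) :
  P [:: 0; 1; 2; 3]%N -> P [:: 0; 1; 2; 4]%N -> P [:: 0; 1; 2; 5]%N -> P [:: 0; 1; 3; 4]%N ->
  P [:: 0; 1; 3; 5]%N -> P [:: 0; 1; 4; 5]%N -> P [:: 0; 2; 3; 4]%N -> P [:: 0; 2; 3; 5]%N ->
  P [:: 0; 2; 4; 5]%N -> P [:: 0; 3; 4; 5]%N -> P [:: 1; 2; 3; 4]%N -> P [:: 1; 2; 3; 5]%N ->
  P [:: 1; 2; 4; 5]%N -> P [:: 1; 3; 4; 5]%N -> P [:: 2; 3; 4; 5]%N ->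
  forall l, l \in quads -> P l.
Proof.
move=> p0 p1 p2 p3 p4 p5 p6 p7 p8 p9 p10 p11 p12 p13 p14 l.
by rewrite !inE; do 14?[case/orP]; move=> /eqP ->.
Qed.

Lemma kform4_quads (g : kform R R 4) : is_kform g ->
  (forall l, l \in quads -> coef g l = 0) -> forall M, g M = 0.
Proof.
move=> gk g0; apply: (kform_incr0 gk) => f fi.
pose l := [:: f ord0 : nat; f (inord 1) : nat; f (inord 2) : nat; f (inord 3) : nat].
have lE (i : 'I_4) : nth 0%N l i = f i.
  by case: i => [[|[|[|[|//]]]] hi]; congr (nat_of_ord (f _)); apply: val_inj;
    rewrite /= ?inordK.
have -> : bas R f = bm R 4 l.
  by apply/matrixP=> i j; rewrite !mxE (nth_map 0%N) // mxE lE.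
apply: g0; rewrite /l.
have h01 : (f ord0 < f (inord 1))%N by apply: fi; rewrite inordK.
have h12 : (f (inord 1) < f (inord 2))%N by apply: fi; rewrite !inordK.
have h23 : (f (inord 2) < f (inord 3))%N by apply: fi; rewrite !inordK.
have h3 := ltn_ord (f (inord 3)).
move: (f ord0 : nat) (f (inord 1) : nat) (f (inord 2) : nat) (f (inord 3) : nat) h01 h12 h23 h3.
move=> a b c d; do 6?[case: d => [|d]]; rewrite // => ab bc cd _;
  move: ab bc cd; do 6?[case: c => [|c]]; rewrite // => ab bc _;
  move: ab bc; do 6?[case: b => [|b]]; rewrite // => ab _;
  move: ab; by do 6?[case: a => [|a]].
Qed.

Lemma ce_dZ br k (w : kform R R k.+1) c M : ce_d br (fun N => c * w N) M = c * ce_d br w M.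
Proof.
rewrite /ce_d mulr_sumr; apply: eq_bigr => j _; rewrite mulr_sumr; apply: eq_bigr => i _.
by rewrite mulrCA.
Qed.

(** The form is the same for all tables up to sign, so J is always [J0] and only the two
    differentials depend on [L]. *)
Lemma mean_convex_of_table (L : seq (nat * nat * (nat * R))) :
  all (fun q => (q.1.1 < q.1.2) && (q.1.2 < 6))%N L -> all (fun q => q.2.1 < 6)%N L ->
  Ds L (nf (sigma0c R)) [:: 0; 1; 3; 4]%N != 0 ->
  (forall l, l \in quads -> Ds L (nf (rho0c R)) l = 0) ->
  (forall l, l \in quads -> l != [:: 0; 1; 3; 4]%N -> Ds L (nf (sigma0c R)) l = 0) ->
  exists nu rho, is_volume_form nu /\ mean_convex (tbr L) nu rho.
Proof.
move=> L1 L6; set kap := Ds L _ _ => k0 Lr Ls'.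
have Ls l : l \in quads -> Ds L (nf (sigma0c R)) l = if l == [:: 0; 1; 3; 4]%N then kap else 0.
  by move=> lq; case: eqP => [->//|/eqP]; apply: Ls'.
pose br := tbr L; have brP : bilinear_alt br := tbr_bil L.
have brL a b m (_ : (a < 6)%N) (_ : (b < 6)%N) (m6 : (m < 6)%N) := tbr_sc a b L1 m6.
have q6 l : l \in quads -> size l = 4 /\ all (fun i => i < 6)%N l.
  by have /allP H : all (fun l => (size l == 4) && all (fun i => i < 6)%N l) quads by [];
     move/H => /andP[/eqP].
have T (w : kform R R 3) r l : is_kform w -> (forall x y z, (x < 6)%N -> (y < 6)%N -> (z < 6)%N ->
    coef w [:: x; y; z] = nf r [:: x; y; z]) -> l \in quads ->
    coef (ce_d br w) l = Ds L (nf r) l.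
  move=> wk wr /q6[sl al]; rewrite (ce_d_Dc brP wk brL) // -DcE // (@Dc_scale _ _ 1 _ (nf r)) ?mul1r //.
  by move=> x y z x6 y6 z6; rewrite mul1r wr.
have rc M : ce_d br (@rho0 R) M = 0.
  apply: kform4_quads; first exact: ce_d_kform (rho0_kform R).
  by move=> l lq; rewrite (T _ (rho0c R)) ?Lr //; [exact: rho0_kform|exact: rho0_coef].
have sc l : l \in quads -> coef (ce_d br (@sigma0 R)) l = if l == [:: 0; 1; 3; 4]%N then kap else 0.
  by move=> lq; rewrite (T _ (sigma0c R)) ?Ls //; [exact: sigma0_kform|exact: sigma0_coef].
pose th := tau0 1%:M * kap.
(* [th] carries the sign of the quadratic form of [rho0]. Negating rho negates hat rho and leaves K
   and J unchanged. *)
pose e : R := if 0 <= th then 1 else -1.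
have ee : e ^+ 2 = 1 by rewrite /e; case: ifP => _; rewrite ?sqrrN expr1n.
have e0 : e != 0 by rewrite -sqrf_eq0 ee oner_eq0.
pose w : kform R R 3 := fun M => e * rho0 M.
pose nu : kform R R 6 := fun M => -1 * \det M.
have hE : hat nu w = fun M => e * sigma0 M by apply: funext => M; exact: hat_w.
exists nu, w; split; first exact: nu_volume.
have gk : is_kform (ce_d br (hat nu w)).
  apply: ce_d_kform => //; apply: pullback_kform; exact: w_kform.
have gq l : l \in quads -> coef (ce_d br (hat nu w)) l = if l == [:: 0; 1; 3; 4]%N then e * kap else 0.
  by move=> lq; rewrite hE /coef ce_dZ -/(coef _ _) sc //; case: ifP; rewrite ?mulr0.
split.
- split; [exact: w_kform| |by move=> M; rewrite /w ce_dZ rc mulr0].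
  by rewrite /definite lambda_w // oppr_lt0.
- by exists (bm R 4 [:: 0; 1; 3; 4]%N); rewrite -/(coef _ _) gq ?mulf_neq0.
rewrite J_w //; apply: (semi_pos_intro gk (tau0_positive R)) => al.
rewrite Q_coef //.
(* The complement of 0, 1, 3, 4 is 2, 5, so only these components of [al] and of its image under J
   meet the differential of hat rho. *)
have J2 : (J0 R *m al) (inord 2) 0 = al (inord 5) 0.
  rewrite mxE (bigD1 (inord 5)) //= big1 ?addr0 => [|m m5]; rewrite mxE !inordK //= ?mul1r //.
  case: eqP => [e5|_]; first by case/eqP: m5; apply: val_inj; rewrite /= inordK.
  by case: eqP => [|_]; [lia|rewrite mul0r].
have J5 : (J0 R *m al) (inord 5) 0 = - al (inord 2) 0.
  rewrite mxE (bigD1 (inord 2)) //= big1 ?addr0 => [|m m2]; rewrite mxE !inordK //= ?mulN1r //.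
  have m6 := ltn_ord m; case: eqP => [|_]; first by lia.
  case: eqP => [e5|_]; last by rewrite mul0r.
  by case/eqP: m2; apply: val_inj; rewrite /= inordK //; lia.
rewrite /Qc /fsum /= !gq //= J2 J5.
set a := al (inord 2) 0; set b := al (inord 5) 0.
have : 0 <= e * th by rewrite /e; case: ifP => [|/negbT]; rewrite ?mul1r // -ltNge mulN1r oppr_ge0 => /ltW.
move=> /mulr_ge0/(_ (addr_ge0 (sqr_ge0 a) (sqr_ge0 b))).
by congr (0 <= _); rewrite /th; field.
Qed.

End Standard.

(** * Isomorphisms between tables *)

Section Tables.
Variable R : realType.
Local Notation V := 'rV[R]_6.
Local Notation table := (seq (nat * nat * (nat * R))).

Definition mulc (x : nat -> R) (M : seq (seq R)) (j : nat) : R :=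
  fsum 6 (fun i => x i * nth 0 (nth [::] M i) j).

Definition mx_of (M : seq (seq R)) : 'M[R]_6 := \matrix_(i, j) nth 0 (nth [::] M i) j.

Lemma coord_mul x M i : (i < 6)%N -> coord (x *m mx_of M) i = mulc (coord x) M i.
Proof.
move=> i6; rewrite /coord mxE /mulc fsumE; apply: eq_bigr => k _.
by rewrite mxE inord_val inordK.
Qed.

Lemma tc_ext (L : table) x x' y y' m : all (fun q => (q.1.1 < q.1.2) && (q.1.2 < 6))%N L ->
  (forall i, (i < 6)%N -> x i = x' i) -> (forall i, (i < 6)%N -> y i = y' i) ->
  tc L x y m = tc L x' y' m.
Proof.
move=> + xx yy; elim: L => [//|[[i j] [k s]] L IH] /= /andP[/andP[ij j6] /IH ->].
by rewrite !xx ?yy // (ltn_trans ij).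
Qed.

Lemma lie_iso_mx (br br' : bracket R) (P : 'M[R]_6) : P \in unitmx ->
  (forall x y, br (x *m P) (y *m P) = br' x y *m P) ->
  lie_isomorphic br' br /\ lie_isomorphic br br'.
Proof.
move=> Pu H; split.
  exists (mulmxr P); split; first by exists (mulmxr (invmx P)) => x /=; rewrite ?mulmxK ?mulmxKV.
  by move=> x y /=.
exists (mulmxr (invmx P)); split; first by exists (mulmxr P) => x /=; rewrite ?mulmxK ?mulmxKV.
by move=> x y /=; rewrite -{1}(mulmxKV Pu x) -{1}(mulmxKV Pu y) H mulmxK.
Qed.

Lemma lie_iso_trans (b1 b2 b3 : bracket R) :
  lie_isomorphic b1 b2 -> lie_isomorphic b2 b3 -> lie_isomorphic b1 b3.
Proof.
move=> [f [fb fe]] [g [gb ge]]; exists (g \o f); split; first exact: bij_comp.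
by move=> x y /=; rewrite fe ge.
Qed.

(** The rows of [M] are the basis of [L] in which its bracket reads [L']. Giving the inverse [N]
    explicitly reduces invertibility to identities between entries, which [field] decides even with
    parameters. *)
Lemma tbr_iso (L L' : table) M N :
  all (fun q => (q.1.1 < q.1.2) && (q.1.2 < 6))%N L ->
  (forall i j, (i < 6)%N -> (j < 6)%N ->
    fsum 6 (fun k => nth 0 (nth [::] M i) k * nth 0 (nth [::] N k) j) = (Nat.eqb i j)%:R) ->
  (forall x y m, (m < 6)%N -> tc L (mulc x M) (mulc y M) m = mulc (tc L' x y) M m) ->
  lie_isomorphic (tbr L') (tbr L) /\ lie_isomorphic (tbr L) (tbr L').
Proof.
move=> L6 MN H; apply: (lie_iso_mx (P := mx_of M)).
  have MN1 : mx_of M *m mx_of N = 1%:M.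
    apply/matrixP=> i j; rewrite [LHS]mxE [RHS]mxE.
    have := MN i j (ltn_ord i) (ltn_ord j); rewrite fsumE => E.
    have -> : (i == j)%:R = (Nat.eqb i j)%:R :> R.
      by congr (_%:R); case: PeanoNat.Nat.eqb_spec => [/val_inj ->|e]; rewrite ?eqxx //;
        apply/negbTE/eqP => ij; apply: e; rewrite ij.
    by rewrite -E; apply: eq_bigr => k _; rewrite !mxE.
  by case: (mulmx1_unit MN1).
move=> x y; apply/rowP=> m; rewrite mxE.
rewrite (@tc_ext _ _ (mulc (coord x) M) _ (mulc (coord y) M)) //; try by move=> i /coord_mul ->.
rewrite H ?ltn_ord // mxE /mulc fsumE; apply: eq_bigr => k _.
by rewrite !mxE.
Qed.

(** The dichotomy to be established for every nilpotent bracket. Both alternatives are invariant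
    under isomorphism, so it may be proved after any change of basis. *)
Definition good (br : bracket R) : Prop :=
  (exists nu rho, is_volume_form nu /\ mean_convex br nu rho) \/
  lie_isomorphic br (@g1 R) \/ lie_isomorphic br (@g2 R) \/ lie_isomorphic br (@g4 R) \/
  lie_isomorphic br (@g9 R) \/ lie_isomorphic br (@g12 R) \/ lie_isomorphic br (@g34 R).

Lemma good_iso br br' : lie_isomorphic br' br /\ lie_isomorphic br br' -> good br' -> good br.
Proof.
move=> [h h'] [mc|g]; first by left; exact: mean_convex_iso h mc.
right; do 5?[case: g => [|g]; [by left; exact: lie_iso_trans h' _|right]].
exact: lie_iso_trans h' g.
Qed.

Lemma good_table L :
  all (fun q => (q.1.1 < q.1.2) && (q.1.2 < 6))%N L -> all (fun q => q.2.1 < 6)%N L ->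
  Ds L (nf (sigma0c R)) [:: 0; 1; 3; 4]%N != 0 ->
  (forall l, l \in quads -> Ds L (nf (rho0c R)) l = 0) ->
  (forall l, l \in quads -> l != [:: 0; 1; 3; 4]%N -> Ds L (nf (sigma0c R)) l = 0) ->
  good (tbr L).
Proof. by move=> *; left; exact: mean_convex_of_table. Qed.

End Tables.

(** * Lie algebras with an abelian ideal of dimension 4 *)

Ltac rfield := first [ring | by field | field; do ?[apply/andP; split]; done].

Ltac entries rf :=
  let i := fresh "i" in let j := fresh "j" in move=> i j;
  do 6?[case: i => [|i]]; rewrite // => _; do 6?[case: j => [|j]]; rewrite // => _;
  rewrite /fsum /=; rf.

Ltac coords rf :=
  let x := fresh "x" in let y := fresh "y" in let m := fresh "m" in move=> x y m;
  do 6?[case: m => [|m]]; rewrite // => _; rewrite /mulc /fsum /=; rf.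

Ltac basis_by rf t := t; [by [] | entries rf | coords rf | ].
Ltac basis t := basis_by rfield t.

Ltac table_by rf := apply: good_table; [by [] | by [] | rewrite /Ds /=
  | apply: quads_ind; rewrite /Ds /=; rf
  | apply: quads_ind => //= _; rewrite /Ds /=; rf ].
Ltac table := table_by rfield.

Section Leaves.
Variable R : realType.
Local Notation entry := (@entry R).

(* [e1, e2, w1, .., w4] with W = <w1, .., w4> an abelian ideal:
   [e_i, w1] = a_i w2 + b_i w3 + c_i w4, [e_i, w2] = d_i w3 + f_i w4,
   [e_i, w3] = g_i w4 and [e1, e2] = k1 w1 + .. + k4 w4. *)
Definition abel4 (a1 b1 c1 d1 f1 g1 a2 b2 c2 d2 f2 g2 k1 k2 k3 k4 : R) :=
  [:: entry 0 1 2 k1; entry 0 1 3 k2; entry 0 1 4 k3; entry 0 1 5 k4;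
      entry 0 2 3 a1; entry 0 2 4 b1; entry 0 2 5 c1; entry 0 3 4 d1; entry 0 3 5 f1;
      entry 0 4 5 g1;
      entry 1 2 3 a2; entry 1 2 4 b2; entry 1 2 5 c2; entry 1 3 4 d2; entry 1 3 5 f2;
      entry 1 4 5 g2].

Lemma good_change L L' M N :
  all (fun q => (q.1.1 < q.1.2) && (q.1.2 < 6))%N L ->
  (forall i j, (i < 6)%N -> (j < 6)%N ->
    fsum 6 (fun k => nth 0 (nth [::] M i) k * nth 0 (nth [::] N k) j) = (Nat.eqb i j)%:R :> R) ->
  (forall x y m, (m < 6)%N -> tc L (mulc x M) (mulc y M) m = mulc (tc L' x y) M m) ->
  good (tbr L') -> good (tbr L).
Proof. by move=> L6 MN H; apply: good_iso; apply: tbr_iso MN H. Qed.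

(** In the new basis kap is the inverse of 1 + ga. *)
Lemma good_F1 ga k1 k2 k3 k4 : 1 + ga != 0 ->
  good (tbr (abel4 1 0 0 1 0 1 0 0 ga 0 0 0 k1 k2 k3 k4)).
Proof.
move=> ga1.
basis ltac:(apply: (@good_change _
   [:: entry 0 3 1 ((1 + ga) * k2); entry 0 3 2 k1; entry 0 3 4 k4; entry 0 3 5 k3;
        entry 0 2 1 (1 + ga); entry 0 1 5 (1 + ga)^-1; entry 0 5 4 1; entry 2 3 4 (- ga)]
    [:: [:: 1; 0; 0; 0; 0; 0]; [:: 0; 0; 0; (1 + ga)^-1; 0; 0]; [:: 0; 0; 1; 0; 0; 0];
        [:: 0; 1; 0; 0; 0; 0]; [:: 0; 0; 0; 0; 0; 1]; [:: 0; 0; 0; 0; 1; 0]]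
    [:: [:: 1; 0; 0; 0; 0; 0]; [:: 0; 0; 0; 1; 0; 0]; [:: 0; 0; 1; 0; 0; 0];
        [:: 0; 1 + ga; 0; 0; 0; 0]; [:: 0; 0; 0; 0; 0; 1]; [:: 0; 0; 0; 0; 1; 0]])).
table.
rewrite !(mulr0, add0r, addr0, subr0, sub0r, oppr0, mulr1, opprK) mulrN1 opprK invr_eq0 //.
Qed.

(** In the new basis kap is p q - 1. *)
Lemma good_G p q k1 k2 k3 k4 : q != 0 -> p * q != 1 ->
  good (tbr (abel4 1 0 0 0 1 0 0 p 0 0 0 q k1 k2 k3 k4)).
Proof.
move=> q0 pq.
basis ltac:(apply: (@good_change _
   [:: entry 0 2 1 1; entry 0 4 2 (-1); entry 3 4 5 (- (p * q)); entry 3 5 1 1;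
        entry 0 3 4 (- k1); entry 0 3 2 k2; entry 0 3 5 (k3 * q); entry 0 3 1 k4]
    [:: [:: 1; 0; 0; 0; 0; 0]; [:: 0; 0; 0; 0; 0; 1]; [:: 0; 0; 0; 1; 0; 0];
        [:: 0; 1; 0; 0; 0; 0]; [:: 0; 0; -1; 0; 0; 0]; [:: 0; 0; 0; 0; q^-1; 0]]
    [:: [:: 1; 0; 0; 0; 0; 0]; [:: 0; 0; 0; 1; 0; 0]; [:: 0; 0; 0; 0; -1; 0];
        [:: 0; 0; 1; 0; 0; 0]; [:: 0; 0; 0; 0; 0; q]; [:: 0; 1; 0; 0; 0; 0]])).
table.
rewrite !(mulr0, add0r, addr0, subr0, sub0r, oppr0, mulr1, opprK) mulrN1 opprK; move: pq; apply: contraNneq => h; apply/eqP; lra.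
Qed.

Lemma good_F2 k1 k2 k3 k4 :
  good (tbr (abel4 1 0 0 0 1 0 0 1 0 0 0 0 k1 k2 k3 k4)).
Proof.
basis ltac:(apply: (@good_change _
   [:: entry 0 4 2 (-1); entry 0 5 4 1; entry 3 5 1 (-1);
        entry 0 3 5 (- k1); entry 0 3 4 (- k2); entry 0 3 1 k3; entry 0 3 2 k4]
    [:: [:: 1; 0; 0; 0; 0; 0]; [:: 0; 0; 0; 0; 1; 0]; [:: 0; 0; 0; 0; 0; 1];
        [:: 0; 1; 0; 0; 0; 0]; [:: 0; 0; 0; -1; 0; 0]; [:: 0; 0; -1; 0; 0; 0]]
    [:: [:: 1; 0; 0; 0; 0; 0]; [:: 0; 0; 0; 1; 0; 0]; [:: 0; 0; 0; 0; 0; -1];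
        [:: 0; 0; 0; 0; -1; 0]; [:: 0; 1; 0; 0; 0; 0]; [:: 0; 0; 1; 0; 0; 0]])).
table.
rewrite !(mulr0, add0r, addr0, subr0, sub0r, oppr0, mulr1, opprK).
by rewrite mulrN1 opprK oppr_eq0 oner_neq0.
Qed.

(** The sign of the basis vector made from w2 is free: the two choices give kap = k4 - be - 1 and
    kap = k4 - be + 1, which cannot both vanish. *)
Lemma good_F6 (be k4 : R) : good (tbr (abel4 1 0 0 1 0 0 0 be 0 0 0 0 0 0 0 k4)).
Proof.
have [bk|bk] := eqVneq (be - k4) 1.
  basis ltac:(apply: (@good_change _
   [:: entry 0 1 5 k4; entry 0 3 4 (-1); entry 0 4 2 (-1); entry 1 3 2 be]
    [:: [:: 1; 0; 0; 0; 0; 0]; [:: 0; 1; 0; 0; 0; 0]; [:: 0; 0; 0; 0; 1; 0];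
        [:: 0; 0; 1; 0; 0; 0]; [:: 0; 0; 0; -1; 0; 0]; [:: 0; 0; 0; 0; 0; 1]]
    [:: [:: 1; 0; 0; 0; 0; 0]; [:: 0; 1; 0; 0; 0; 0]; [:: 0; 0; 0; 1; 0; 0];
        [:: 0; 0; 0; 0; -1; 0]; [:: 0; 0; 1; 0; 0; 0]; [:: 0; 0; 0; 0; 0; 1]])).
  table.
  rewrite !(mulr0, add0r, addr0, subr0, sub0r, oppr0, mulr1, opprK) ?mulrN1 ?opprK.
  have -> : k4 - 1 - be = - 2%:R by lra.
  by rewrite oppr_eq0 pnatr_eq0.
  basis ltac:(apply: (@good_change _
   [:: entry 0 1 5 k4; entry 0 3 4 (1); entry 0 4 2 (1); entry 1 3 2 be]
    [:: [:: 1; 0; 0; 0; 0; 0]; [:: 0; 1; 0; 0; 0; 0]; [:: 0; 0; 0; 0; 1; 0];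
        [:: 0; 0; 1; 0; 0; 0]; [:: 0; 0; 0; 1; 0; 0]; [:: 0; 0; 0; 0; 0; 1]]
    [:: [:: 1; 0; 0; 0; 0; 0]; [:: 0; 1; 0; 0; 0; 0]; [:: 0; 0; 0; 1; 0; 0];
        [:: 0; 0; 0; 0; 1; 0]; [:: 0; 0; 1; 0; 0; 0]; [:: 0; 0; 0; 0; 0; 1]])).
  table.
  rewrite !(mulr0, add0r, addr0, subr0, sub0r, oppr0, mulr1, opprK) ?mulrN1 ?opprK.
  by apply/eqP=> h; case/eqP: bk; lra.
Qed.


(* In the dual basis w^j, the coframe is z1 = w^1 + i x w^2 and
   z2 = conj(Z) (w^3 + i y w^4), with signs x, y and Z = zr + i zi; the four
   values of Z only vanish together if all coefficients do. *)
Section F5.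
Variables (x y zr zi b1 c1 d1 f1 b2 c2 d2 f2 k1 k2 k3 k4 : R).
Hypotheses (xx : x * x = 1) (yy : y * y = 1).
Hypothesis zrE : zr = - (x * b2) - x * y * c1 - d1 + y * f2.
Hypothesis ziE : zi = x * b1 - x * y * c2 - d2 - y * f1.
Hypothesis N0 : zr * zr + zi * zi != 0.

Ltac rfield5 := first [ring: xx yy | by field: xx yy].

Lemma good_F5_signs : good (tbr (abel4 0 b1 c1 d1 f1 0 0 b2 c2 d2 f2 0 k1 k2 k3 k4)).
Proof.
basis_by rfield5 ltac:(apply: (@good_change _
  [:: entry 0 1 2 (b1 * zr + y * c1 * zi); entry 0 1 5 (y * c1 * zr - b1 * zi);
      entry 0 4 2 (x * (d1 * zr + y * f1 * zi)); entry 0 4 5 (x * (y * f1 * zr - d1 * zi));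
      entry 1 3 2 (- (b2 * zr + y * c2 * zi)); entry 1 3 5 (- (y * c2 * zr - b2 * zi));
      entry 3 4 2 (x * (d2 * zr + y * f2 * zi)); entry 3 4 5 (x * (y * f2 * zr - d2 * zi));
      entry 0 3 1 k1; entry 0 3 4 (x * k2); entry 0 3 2 (k3 * zr + y * k4 * zi);
      entry 0 3 5 (y * k4 * zr - k3 * zi)]
  [:: [:: 1; 0; 0; 0; 0; 0]; [:: 0; 0; 1; 0; 0; 0];
      [:: 0; 0; 0; 0; zr / (zr * zr + zi * zi); zi * y / (zr * zr + zi * zi)];
      [:: 0; 1; 0; 0; 0; 0]; [:: 0; 0; 0; x; 0; 0];
      [:: 0; 0; 0; 0; - zi / (zr * zr + zi * zi); zr * y / (zr * zr + zi * zi)]]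
  [:: [:: 1; 0; 0; 0; 0; 0]; [:: 0; 0; 0; 1; 0; 0]; [:: 0; 1; 0; 0; 0; 0];
      [:: 0; 0; 0; 0; x; 0]; [:: 0; 0; zr; 0; 0; - zi]; [:: 0; 0; y * zi; 0; 0; y * zr]])).
table_by ltac:(rewrite ?zrE ?ziE; rfield5).
have x0 : x != 0 by apply/eqP=> x0; move: xx; rewrite x0 mulr0 => /eqP; rewrite eq_sym oner_eq0.
set e := (X in X != 0); have -> : e = - x * (zr * zr + zi * zi).
  by rewrite /e zrE ziE; ring: xx yy.
by rewrite mulf_neq0 ?oppr_eq0.
Qed.
End F5.

Lemma good_F5 b1 c1 d1 f1 b2 c2 d2 f2 k1 k2 k3 k4 :
  ~ [/\ [/\ b1 = 0, c1 = 0, d1 = 0 & f1 = 0], b2 = 0, c2 = 0, d2 = 0 & f2 = 0] ->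
  good (tbr (abel4 0 b1 c1 d1 f1 0 0 b2 c2 d2 f2 0 k1 k2 k3 k4)).
Proof.
move=> nz; apply: contrapT => ng; apply: nz.
have H x y : x * x = 1 -> y * y = 1 ->
    - (x * b2) - x * y * c1 - d1 + y * f2 = 0 /\ x * b1 - x * y * c2 - d2 - y * f1 = 0.
  move=> xx yy; set zr := - _ - _ - _ + _; set zi := _ - _ - _ - _.
  have N0 : zr * zr + zi * zi = 0.
    by apply/eqP/negP => /negP N0; apply: ng; apply: (@good_F5_signs x y zr zi).
  have /andP[/eqP r0 /eqP i0] : (zr * zr == 0) && (zi * zi == 0).
    by rewrite -paddr_eq0 -?expr2 ?sqr_ge0 // !expr2 N0.
  by split; apply/eqP; rewrite -sqrf_eq0 expr2 ?r0 ?i0.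
have m1 : -1 * -1 = 1 :> R by ring.
have [r1 i1] := H 1 1 (mulr1 1) (mulr1 1).
have [r2 i2] := H 1 (-1) (mulr1 1) m1.
have [r3 i3] := H (-1) 1 m1 (mulr1 1).
have [r4 i4] := H (-1) (-1) m1 m1.
by split; [split|..]; lra.
Qed.

End Leaves.

(** * Normal forms for two commuting nilpotent maps and a vector *)

Section Tree.
Variable R : realType.
Local Notation entry := (@entry R).

Lemma lie_iso_refl (br : bracket R) : lie_isomorphic br br.
Proof. by exists idfun; split=> //; exists id. Qed.

Lemma good_g1 : good (tbr (L1 R)).
Proof. by right; left; rewrite g1_tbr; exact: lie_iso_refl. Qed.
Lemma good_g2 : good (tbr (L2 R)).
Proof. by right; right; left; rewrite g2_tbr; exact: lie_iso_refl. Qed.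
Lemma good_g4 : good (tbr (L4 R)).
Proof. by right; right; right; left; rewrite g4_tbr; exact: lie_iso_refl. Qed.
Lemma good_g9 : good (tbr (L9 R)).
Proof. by right; right; right; right; left; rewrite g9_tbr; exact: lie_iso_refl. Qed.
Lemma good_g12 : good (tbr (L12 R)).
Proof. by right; right; right; right; right; left; rewrite g12_tbr; exact: lie_iso_refl. Qed.

Lemma good_reg0 (ga k1 k2 k3 k4 : R) :
  good (tbr (abel4 1 0 0 1 0 1 0 0 ga 0 0 0 k1 k2 k3 k4)).
Proof.
have [g1|] := eqVneq (1 + ga) 0; last exact: good_F1.
have h2 : (2%:R : R) != 0 by rewrite pnatr_eq0.
(* Doubling e2 doubles [ga], which moves it from -1 to -2. *)
basis ltac:(apply: (@good_change R _
  (abel4 1 0 0 1 0 1 0 0 (2%:R * ga) 0 0 0 (2%:R * k1) (2%:R * k2) (2%:R * k3) (2%:R * k4))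
  [:: [:: 1; 0; 0; 0; 0; 0];
       [:: 0; 2%:R; 0; 0; 0; 0];
       [:: 0; 0; 1; 0; 0; 0];
       [:: 0; 0; 0; 1; 0; 0];
       [:: 0; 0; 0; 0; 1; 0];
       [:: 0; 0; 0; 0; 0; 1]]
  [:: [:: 1; 0; 0; 0; 0; 0];
       [:: 0; (1) / (2%:R); 0; 0; 0; 0];
       [:: 0; 0; 1; 0; 0; 0];
       [:: 0; 0; 0; 1; 0; 0];
       [:: 0; 0; 0; 0; 1; 0];
       [:: 0; 0; 0; 0; 0; 1]])).
apply: good_F1; have -> : 1 + 2%:R * ga = -1 by lra.
by rewrite oppr_eq0 oner_neq0.
Qed.

(** Here e1 acts on W by a single Jordan block and e2 by its square. Subtracting a vector of W from
    e2 absorbs k2, k3, k4; what is left is g_9 if k1 = 0 and g_4 otherwise. *)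
Lemma good_reg1 (k1 k2 k3 k4 : R) :
  good (tbr (abel4 1 0 0 1 0 1 0 1 0 0 1 0 k1 k2 k3 k4)).
Proof.
have [->|k0] := eqVneq k1 0.
  basis ltac:(apply: (@good_change R _
  (L9 R)
  [:: [:: 1; 0; 0; 0; 0; 0];
       [:: 0; 0; 1; 0; 0; 0];
       [:: 0; -1; k2; k3; k4; 0];
       [:: 0; 0; 0; -1; 0; 0];
       [:: 0; 0; 0; 0; 1; 0];
       [:: 0; 0; 0; 0; 0; -1]]
  [:: [:: 1; 0; 0; 0; 0; 0];
       [:: 0; - (- (k2)); -1; - (- (- (k3))); - (- (k4)); 0];
       [:: 0; 1; 0; 0; 0; 0];
       [:: 0; 0; 0; -1; 0; 0];
       [:: 0; 0; 0; 0; 1; 0];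
       [:: 0; 0; 0; 0; 0; -1]])).
  exact: good_g9.
basis ltac:(apply: (@good_change R _
  (L4 R)
  [:: [:: 1; 0; 0; 0; 0; 0];
       [:: 0; -1; k2; k3; k4; 0];
       [:: 0; 0; k1; 0; 0; 0];
       [:: 0; 0; 0; - k1; 0; 0];
       [:: 0; 0; 0; 0; k1; 0];
       [:: 0; 0; 0; 0; 0; - k1]]
  [:: [:: 1; 0; 0; 0; 0; 0];
       [:: 0; -1; - (- ((k2) * ((1) / (k1)))); - (- ((k3) * ((1) / (- k1)))); - (- ((k4) * ((1) / (k1)))); 0];
       [:: 0; 0; (1) / (k1); 0; 0; 0];
       [:: 0; 0; 0; (1) / (- k1); 0; 0];
       [:: 0; 0; 0; 0; (1) / (k1); 0];
       [:: 0; 0; 0; 0; 0; (1) / (- k1)]])).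
exact: good_g4.
Qed.

(** Let A be the action of e1, so that e2 acts by be A^2 + ga A^3. With s = ga / (2 be), the vector
    e1 + (s / be) e2 acts by A + s A^2 + 2 s^2 A^3, whose square is the action of e2 / be; this
    reduces to be = 1, ga = 0. *)
Lemma good_reg (be ga k1 k2 k3 k4 : R) :
  good (tbr (abel4 1 0 0 1 0 1 0 be ga 0 be 0 k1 k2 k3 k4)).
Proof.
have [->|b0] := eqVneq be 0; first exact: good_reg0.
pose de := ga / be; pose s := de / 2%:R.
have dE : ga = de * be by rewrite /de; field.
have sE : de = s * 2%:R by rewrite /s; field.
rewrite {}dE {}sE; clearbody s; clear de.
basis ltac:(apply: (@good_change R _
  (abel4 1 0 0 1 0 1 0 1 0 0 1 0 (k1 / be) (k2 / be) ((k3 - s * k2) / be) ((k4 - s * 2%:R * k3) / be))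
  [:: [:: 1; s / be; 0; 0; 0; 0];
       [:: 0; be^-1; 0; 0; 0; 0];
       [:: 0; 0; 1; 0; 0; 0];
       [:: 0; 0; 0; 1; s; s * s * 2%:R];
       [:: 0; 0; 0; 0; 1; s * 2%:R];
       [:: 0; 0; 0; 0; 0; 1]]
  [:: [:: 1; - ((s / be) * ((1) / (be^-1))); 0; 0; 0; 0];
       [:: 0; (1) / (be^-1); 0; 0; 0; 0];
       [:: 0; 0; 1; 0; 0; 0];
       [:: 0; 0; 0; 1; - (s); (- (s * s * 2%:R)) - ((s) * (- (s * 2%:R)))];
       [:: 0; 0; 0; 0; 1; - (s * 2%:R)];
       [:: 0; 0; 0; 0; 0; 1]])).
exact: good_reg1.
Qed.

(** If k1 = 0, a shift of e2 by a vector of W removes k2 and k3. The exceptional algebra g_12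
    appears exactly when this proof meets k1 and be both nonzero. *)
Lemma good_F6k (be k1 k2 k3 k4 : R) : good (tbr (abel4 1 0 0 1 0 0 0 be 0 0 0 0 k1 k2 k3 k4)).
Proof.
have [->|k0] := eqVneq k1 0.
  basis ltac:(apply: (@good_change R _
  (abel4 1 0 0 1 0 0 0 be 0 0 0 0 0 0 0 k4)
  [:: [:: 1; 0; 0; 0; 0; 0];
       [:: 0; 1; - k2; - k3; 0; 0];
       [:: 0; 0; 1; 0; 0; 0];
       [:: 0; 0; 0; 1; 0; 0];
       [:: 0; 0; 0; 0; 1; 0];
       [:: 0; 0; 0; 0; 0; 1]]
  [:: [:: 1; 0; 0; 0; 0; 0];
       [:: 0; 1; - (- k2); - (- k3); 0; 0];
       [:: 0; 0; 1; 0; 0; 0];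
       [:: 0; 0; 0; 1; 0; 0];
       [:: 0; 0; 0; 0; 1; 0];
       [:: 0; 0; 0; 0; 0; 1]])).
  exact: good_F6.
(* Since k1 is nonzero, e2 heads a chain of length four under e1. For be = 0 it commutes with W, so
   this chain spans another abelian ideal and the central vector w4 takes the place of e2. *)
have [->|b0] := eqVneq be 0.
  basis ltac:(apply: (@good_change R _
  (abel4 1 0 0 1 0 1 0 0 0 0 0 0 0 0 0 0)
  [:: [:: 1; 0; 0; 0; 0; 0];
       [:: 0; 0; 0; 0; 0; 1];
       [:: 0; 1; - k2; - k3; 0; 0];
       [:: 0; 0; k1; 0; 0; k4];
       [:: 0; 0; 0; k1; 0; 0];
       [:: 0; 0; 0; 0; k1; 0]]
  [:: [:: 1; 0; 0; 0; 0; 0];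
       [:: 0; - ((- k2) * ((- (k4)) / (k1))); 1; - ((- k2) * ((1) / (k1))); - ((- k3) * ((1) / (k1))); 0];
       [:: 0; (- (k4)) / (k1); 0; (1) / (k1); 0; 0];
       [:: 0; 0; 0; 0; (1) / (k1); 0];
       [:: 0; 0; 0; 0; 0; (1) / (k1)];
       [:: 0; 1; 0; 0; 0; 0]])).
  exact: good_reg0.
basis ltac:(apply: (@good_change R _
  (L12 R)
  [:: [:: 1; 0; 0; 0; 0; 0];
       [:: 0; - be^-1; k2 / be; k3 / be; 0; 0];
       [:: 0; 0; 0; 0; 0; 1];
       [:: 0; 0; k1 / be; 0; 0; k4 / be];
       [:: 0; 0; 0; - (k1 / be); 0; 0];
       [:: 0; 0; 0; 0; k1 / be; 0]]
  [:: [:: 1; 0; 0; 0; 0; 0];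
       [:: 0; (1) / (- be^-1); (- ((k2 / be) * ((- (k4 / be)) / (k1 / be)))) / (- be^-1); (- ((k2 / be) * ((1) / (k1 / be)))) / (- be^-1); (- ((k3 / be) * ((1) / (- (k1 / be))))) / (- be^-1); 0];
       [:: 0; 0; (- (k4 / be)) / (k1 / be); (1) / (k1 / be); 0; 0];
       [:: 0; 0; 0; 0; (1) / (- (k1 / be)); 0];
       [:: 0; 0; 0; 0; 0; (1) / (k1 / be)];
       [:: 0; 0; 1; 0; 0; 0]])).
exact: good_g12.
Qed.

(** If g is nonzero, w1 - (c / g) w3 commutes with e2, which leads to the case p = 0 of [good_G]. *)
Lemma good_L3 (c g k1 k2 k3 k4 : R) :
  good (tbr (abel4 1 0 0 0 1 0 0 0 c 0 0 g k1 k2 k3 k4)).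
Proof.
have [->|g0] := eqVneq g 0.
  basis ltac:(apply: (@good_change R _
  (abel4 1 0 0 1 0 0 0 c 0 0 0 0 k1 k2 k4 k3)
  [:: [:: 1; 0; 0; 0; 0; 0];
       [:: 0; 1; 0; 0; 0; 0];
       [:: 0; 0; 1; 0; 0; 0];
       [:: 0; 0; 0; 1; 0; 0];
       [:: 0; 0; 0; 0; 0; 1];
       [:: 0; 0; 0; 0; 1; 0]]
  [:: [:: 1; 0; 0; 0; 0; 0];
       [:: 0; 1; 0; 0; 0; 0];
       [:: 0; 0; 1; 0; 0; 0];
       [:: 0; 0; 0; 1; 0; 0];
       [:: 0; 0; 0; 0; 0; 1];
       [:: 0; 0; 0; 0; 1; 0]])).
  exact: good_F6k.
basis ltac:(apply: (@good_change R _
  (abel4 1 0 0 0 1 0 0 0 0 0 0 g k1 k2 (k3 + k1 * c / g) k4)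
  [:: [:: 1; 0; 0; 0; 0; 0];
       [:: 0; 1; 0; 0; 0; 0];
       [:: 0; 0; 1; 0; - (c / g); 0];
       [:: 0; 0; 0; 1; 0; 0];
       [:: 0; 0; 0; 0; 1; 0];
       [:: 0; 0; 0; 0; 0; 1]]
  [:: [:: 1; 0; 0; 0; 0; 0];
       [:: 0; 1; 0; 0; 0; 0];
       [:: 0; 0; 1; 0; - (- (c / g)); 0];
       [:: 0; 0; 0; 1; 0; 0];
       [:: 0; 0; 0; 0; 1; 0];
       [:: 0; 0; 0; 0; 0; 1]])).
by apply: good_G; rewrite // mul0r eq_sym oner_neq0.
Qed.

Lemma good_sym1 (q k1 k2 k3 k4 : R) :
  good (tbr (abel4 1 0 0 0 1 0 0 1 0 0 0 q k1 k2 k3 k4)).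
Proof.
have [->|q0] := eqVneq q 0; first exact: good_F2.
have [->|q1] := eqVneq q 1; last by apply: good_G; rewrite ?mul1r.
have h2 : (2%:R : R) != 0 by rewrite pnatr_eq0.
(* At q = 1 the criterion of [good_G] fails; doubling e2 gives p = q = 2, hence p q = 4. *)
basis ltac:(apply: (@good_change R _
  (abel4 1 0 0 0 1 0 0 2%:R 0 0 0 2%:R (2%:R * k1) (2%:R * k2) (2%:R * k3) (2%:R * k4))
  [:: [:: 1; 0; 0; 0; 0; 0];
       [:: 0; 2%:R; 0; 0; 0; 0];
       [:: 0; 0; 1; 0; 0; 0];
       [:: 0; 0; 0; 1; 0; 0];
       [:: 0; 0; 0; 0; 1; 0];
       [:: 0; 0; 0; 0; 0; 1]]
  [:: [:: 1; 0; 0; 0; 0; 0];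
       [:: 0; (1) / (2%:R); 0; 0; 0; 0];
       [:: 0; 0; 1; 0; 0; 0];
       [:: 0; 0; 0; 1; 0; 0];
       [:: 0; 0; 0; 0; 1; 0];
       [:: 0; 0; 0; 0; 0; 1]])).
apply: good_G => //; rewrite -subr_eq0; have -> : 2%:R * 2%:R - 1 = 3%:R :> R by ring.
by rewrite pnatr_eq0.
Qed.

(** Here [e_i, w1] = w_(i+1) and [e_i, w_(j+1)] = S_ij w4, where S is symmetric with rows (f, g) and
    (g, q). A change of e1, e2 acts on S by congruence, and f as a pivot makes S diagonal. *)
Lemma good_sym2 (f g q k1 k2 k3 k4 : R) : f != 0 ->
  good (tbr (abel4 1 0 0 0 f g 0 1 0 0 g q k1 k2 k3 k4)).
Proof.
move=> f0.
basis ltac:(apply: (@good_change R _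
  (abel4 1 0 0 0 1 0 0 1 0 0 0 ((q - g / f * g) / f) k1 (k2 + g / f * k3) k3 (k4 / f))
  [:: [:: 1; 0; 0; 0; 0; 0];
       [:: - (g / f); 1; 0; 0; 0; 0];
       [:: 0; 0; 1; 0; 0; 0];
       [:: 0; 0; 0; 1; 0; 0];
       [:: 0; 0; 0; - (g / f); 1; 0];
       [:: 0; 0; 0; 0; 0; f]]
  [:: [:: 1; 0; 0; 0; 0; 0];
       [:: - (- (g / f)); 1; 0; 0; 0; 0];
       [:: 0; 0; 1; 0; 0; 0];
       [:: 0; 0; 0; 1; 0; 0];
       [:: 0; 0; 0; - (- (g / f)); 1; 0];
       [:: 0; 0; 0; 0; 0; (1) / (f)]])).
exact: good_sym1.
Qed.

(** A swap of e1 and e2, or the shear e1 + e2, produces a pivot unless S = 0. In that last case W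
    has a basis in which both maps fall under [good_F5]. *)
Lemma good_sym (f g q k1 k2 k3 k4 : R) :
  good (tbr (abel4 1 0 0 0 f g 0 1 0 0 g q k1 k2 k3 k4)).
Proof.
have [->|f0] := eqVneq f 0; last exact: good_sym2.
have [->|q0] := eqVneq q 0; last first.
  basis ltac:(apply: (@good_change R _
  (abel4 1 0 0 0 q g 0 1 0 0 g 0 (- k1) (- k3) (- k2) (- k4))
  [:: [:: 0; 1; 0; 0; 0; 0];
       [:: 1; 0; 0; 0; 0; 0];
       [:: 0; 0; 1; 0; 0; 0];
       [:: 0; 0; 0; 0; 1; 0];
       [:: 0; 0; 0; 1; 0; 0];
       [:: 0; 0; 0; 0; 0; 1]]
  [:: [:: 0; 1; 0; 0; 0; 0];
       [:: 1; 0; 0; 0; 0; 0];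
       [:: 0; 0; 1; 0; 0; 0];
       [:: 0; 0; 0; 0; 1; 0];
       [:: 0; 0; 0; 1; 0; 0];
       [:: 0; 0; 0; 0; 0; 1]])).
  exact: good_sym2.
have [->|g0] := eqVneq g 0; last first.
  basis ltac:(apply: (@good_change R _
  (abel4 1 0 0 0 (g * 2%:R) g 0 1 0 0 g 0 k1 k2 (k3 - k2) k4)
  [:: [:: 1; 1; 0; 0; 0; 0];
       [:: 0; 1; 0; 0; 0; 0];
       [:: 0; 0; 1; 0; 0; 0];
       [:: 0; 0; 0; 1; 1; 0];
       [:: 0; 0; 0; 0; 1; 0];
       [:: 0; 0; 0; 0; 0; 1]]
  [:: [:: 1; -1; 0; 0; 0; 0];
       [:: 0; 1; 0; 0; 0; 0];
       [:: 0; 0; 1; 0; 0; 0];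
       [:: 0; 0; 0; 1; -1; 0];
       [:: 0; 0; 0; 0; 1; 0];
       [:: 0; 0; 0; 0; 0; 1]])).
  by apply: good_sym2; rewrite mulf_neq0 ?pnatr_eq0.
basis ltac:(apply: (@good_change R _
  (abel4 0 1 0 0 0 0 0 0 1 0 0 0 k1 k4 k2 k3)
  [:: [:: 1; 0; 0; 0; 0; 0];
       [:: 0; 1; 0; 0; 0; 0];
       [:: 0; 0; 1; 0; 0; 0];
       [:: 0; 0; 0; 0; 0; 1];
       [:: 0; 0; 0; 1; 0; 0];
       [:: 0; 0; 0; 0; 1; 0]]
  [:: [:: 1; 0; 0; 0; 0; 0];
       [:: 0; 1; 0; 0; 0; 0];
       [:: 0; 0; 1; 0; 0; 0];
       [:: 0; 0; 0; 0; 1; 0];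
       [:: 0; 0; 0; 0; 0; 1];
       [:: 0; 0; 0; 1; 0; 0]])).
by apply: good_F5 => -[[/eqP]]; rewrite oner_eq0.
Qed.

Lemma good_A2 (f g b c q k1 k2 k3 k4 : R) :
  good (tbr (abel4 1 0 0 0 f g 0 b c 0 (b * g) q k1 k2 k3 k4)).
Proof.
have [->|b0] := eqVneq b 0; last first.
  basis ltac:(apply: (@good_change R _
  (abel4 1 0 0 0 f (b * g) 0 1 0 0 (b * g) (b * q) k1 k2 (k3 / b) (k4 - k3 * c / b))
  [:: [:: 1; 0; 0; 0; 0; 0];
       [:: 0; 1; 0; 0; 0; 0];
       [:: 0; 0; 1; 0; 0; 0];
       [:: 0; 0; 0; 1; 0; 0];
       [:: 0; 0; 0; 0; b; c];
       [:: 0; 0; 0; 0; 0; 1]]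
  [:: [:: 1; 0; 0; 0; 0; 0];
       [:: 0; 1; 0; 0; 0; 0];
       [:: 0; 0; 1; 0; 0; 0];
       [:: 0; 0; 0; 1; 0; 0];
       [:: 0; 0; 0; 0; (1) / (b); (- (c)) / (b)];
       [:: 0; 0; 0; 0; 0; 1]])).
  exact: good_sym.
have [->|f0] := eqVneq f 0.
  basis ltac:(apply: (@good_change R _
  (abel4 0 1 0 0 g 0 0 0 c 0 q 0 k1 k3 k2 k4)
  [:: [:: 1; 0; 0; 0; 0; 0];
       [:: 0; 1; 0; 0; 0; 0];
       [:: 0; 0; 1; 0; 0; 0];
       [:: 0; 0; 0; 0; 1; 0];
       [:: 0; 0; 0; 1; 0; 0];
       [:: 0; 0; 0; 0; 0; 1]]
  [:: [:: 1; 0; 0; 0; 0; 0];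
       [:: 0; 1; 0; 0; 0; 0];
       [:: 0; 0; 1; 0; 0; 0];
       [:: 0; 0; 0; 0; 1; 0];
       [:: 0; 0; 0; 1; 0; 0];
       [:: 0; 0; 0; 0; 0; 1]])).
  by apply: good_F5 => -[[/eqP]]; rewrite oner_eq0.
basis ltac:(apply: (@good_change R _
  (abel4 1 0 0 0 1 0 0 0 (c / f) 0 0 (q / f) k1 (k2 + k3 * g / f) k3 (k4 / f))
  [:: [:: 1; 0; 0; 0; 0; 0];
       [:: 0; 1; 0; 0; 0; 0];
       [:: 0; 0; 1; 0; 0; 0];
       [:: 0; 0; 0; 1; 0; 0];
       [:: 0; 0; 0; - (g / f); 1; 0];
       [:: 0; 0; 0; 0; 0; f]]
  [:: [:: 1; 0; 0; 0; 0; 0];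
       [:: 0; 1; 0; 0; 0; 0];
       [:: 0; 0; 1; 0; 0; 0];
       [:: 0; 0; 0; 1; 0; 0];
       [:: 0; 0; 0; - (- (g / f)); 1; 0];
       [:: 0; 0; 0; 0; 0; (1) / (f)]])).
exact: good_L3.
Qed.

Lemma good_A1 (g b c k1 k2 k3 k4 : R) :
  good (tbr (abel4 1 0 0 1 0 g 0 b c 0 (b * g) 0 k1 k2 k3 k4)).
Proof.
have [->|g0] := eqVneq g 0; last first.
  basis ltac:(apply: (@good_change R _
  (abel4 1 0 0 1 0 1 0 b (c / g) 0 b 0 k1 k2 k3 (k4 / g))
  [:: [:: 1; 0; 0; 0; 0; 0];
       [:: 0; 1; 0; 0; 0; 0];
       [:: 0; 0; 1; 0; 0; 0];
       [:: 0; 0; 0; 1; 0; 0];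
       [:: 0; 0; 0; 0; 1; 0];
       [:: 0; 0; 0; 0; 0; g]]
  [:: [:: 1; 0; 0; 0; 0; 0];
       [:: 0; 1; 0; 0; 0; 0];
       [:: 0; 0; 1; 0; 0; 0];
       [:: 0; 0; 0; 1; 0; 0];
       [:: 0; 0; 0; 0; 1; 0];
       [:: 0; 0; 0; 0; 0; (1) / (g)]])).
  exact: good_reg.
rewrite mulr0; have [->|c0] := eqVneq c 0; first exact: good_F6k.
basis ltac:(apply: (@good_change R _
  (abel4 1 0 0 0 1 0 0 1 0 0 0 0 k1 k2 (k4 / c) (k3 - k4 * b / c))
  [:: [:: 1; 0; 0; 0; 0; 0];
       [:: 0; 1; 0; 0; 0; 0];
       [:: 0; 0; 1; 0; 0; 0];
       [:: 0; 0; 0; 1; 0; 0];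
       [:: 0; 0; 0; 0; b; c];
       [:: 0; 0; 0; 0; 1; 0]]
  [:: [:: 1; 0; 0; 0; 0; 0];
       [:: 0; 1; 0; 0; 0; 0];
       [:: 0; 0; 1; 0; 0; 0];
       [:: 0; 0; 0; 1; 0; 0];
       [:: 0; 0; 0; 0; 0; 1];
       [:: 0; 0; 0; 0; (1) / (c); (- (b)) / (c)]])).
exact: good_F2.
Qed.

Lemma good_A0 (d1 f1 g1 b2 c2 g2 k1 k2 k3 k4 : R) : d1 * g2 = 0 ->
  good (tbr (abel4 1 0 0 d1 f1 g1 0 b2 c2 0 (b2 * g1) g2 k1 k2 k3 k4)).
Proof.
move=> dg; have [->|d0] := eqVneq d1 0; first exact: good_A2.
have -> : g2 = 0 by move/eqP: dg; rewrite mulf_eq0 (negbTE d0) => /eqP.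
basis ltac:(apply: (@good_change R _
  (abel4 1 0 0 1 0 (d1 * g1) 0 (b2 / d1) (c2 - b2 * f1 / d1) 0 (b2 / d1 * (d1 * g1)) 0 k1 k2 (k3 / d1) (k4 - k3 * f1 / d1))
  [:: [:: 1; 0; 0; 0; 0; 0];
       [:: 0; 1; 0; 0; 0; 0];
       [:: 0; 0; 1; 0; 0; 0];
       [:: 0; 0; 0; 1; 0; 0];
       [:: 0; 0; 0; 0; d1; f1];
       [:: 0; 0; 0; 0; 0; 1]]
  [:: [:: 1; 0; 0; 0; 0; 0];
       [:: 0; 1; 0; 0; 0; 0];
       [:: 0; 0; 1; 0; 0; 0];
       [:: 0; 0; 0; 1; 0; 0];
       [:: 0; 0; 0; 0; (1) / (d1); (- (f1)) / (d1)];
       [:: 0; 0; 0; 0; 0; 1]])).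
exact: good_A1.
Qed.

(** The hypotheses say that the two maps on W commute. Scaling e1 and subtracting a multiple of it
    from e2 gives a1 = 1 and a2 = 0; commutation then forces d2 = 0 and determines f2. *)
Lemma good_A (a1 b1 c1 d1 f1 g1 a2 b2 c2 d2 f2 g2 k1 k2 k3 k4 : R) : a1 != 0 ->
  a1 * d2 = a2 * d1 -> a1 * f2 + b1 * g2 = a2 * f1 + b2 * g1 -> d1 * g2 = d2 * g1 ->
  good (tbr (abel4 a1 b1 c1 d1 f1 g1 a2 b2 c2 d2 f2 g2 k1 k2 k3 k4)).
Proof.
move=> a0 h1 h2 h3.
have -> : d2 = a2 * d1 / a1 by rewrite -h1; field.
have -> : f2 = (a2 * f1 + b2 * g1 - b1 * g2) / a1 by rewrite -h2; field.
basis ltac:(apply: (@good_change R _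
  (abel4 1 0 0 (d1 / a1) ((f1 + b1 / a1 * g1) / a1) (g1 / a1) 0 (b2 - a2 * b1 / a1) (c2 - a2 * c1 / a1) 0 ((b2 - a2 * b1 / a1) * (g1 / a1)) (g2 - a2 * g1 / a1) (k1 / a1) (k2 / a1) ((k3 - b1 / a1 * k2) / a1) ((k4 - c1 / a1 * k2) / a1))
  [:: [:: a1^-1; 0; 0; 0; 0; 0];
       [:: - (a2 / a1); 1; 0; 0; 0; 0];
       [:: 0; 0; 1; 0; 0; 0];
       [:: 0; 0; 0; 1; b1 / a1; c1 / a1];
       [:: 0; 0; 0; 0; 1; 0];
       [:: 0; 0; 0; 0; 0; 1]]
  [:: [:: (1) / (a1^-1); 0; 0; 0; 0; 0];
       [:: - ((- (a2 / a1)) * ((1) / (a1^-1))); 1; 0; 0; 0; 0];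
       [:: 0; 0; 1; 0; 0; 0];
       [:: 0; 0; 0; 1; - (b1 / a1); - (c1 / a1)];
       [:: 0; 0; 0; 0; 1; 0];
       [:: 0; 0; 0; 0; 0; 1]])).
apply: good_A0; have -> : d1 / a1 * (g2 - a2 * g1 / a1) = (d1 * g2 - (a2 * d1 / a1) * g1) / a1 by field.
by rewrite -h1 h3; field.
Qed.

Lemma good_B1 (b c d f c2 f2 k1 k2 k3 k4 : R) : b != 0 ->
  good (tbr (abel4 0 b c d f 1 0 0 c2 0 f2 0 k1 k2 k3 k4)).
Proof.
(* [th] is chosen so that w2 - (d / b) w1 - th [e1, w1] commutes with e1. *)
move=> b0; pose th := (f - d * c / b) / b.
have fE : f = th * b + d * c / b by rewrite /th; field.
rewrite {}fE; clearbody th.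
basis ltac:(apply: (@good_change R _
  (abel4 1 0 0 0 1 0 0 0 (c2 / b) 0 0 ((f2 - d * c2 / b) / b) (k1 + k2 * d / b) (k2 * th + k3 / b) k2 (k4 / b - k3 * c / b / b))
  [:: [:: 1; 0; 0; 0; 0; 0];
       [:: 0; 1; 0; 0; 0; 0];
       [:: 0; 0; 1; 0; 0; 0];
       [:: 0; 0; 0; 0; b; c];
       [:: 0; 0; - (d / b); 1; - (th * b); - (th * c)];
       [:: 0; 0; 0; 0; 0; b]]
  [:: [:: 1; 0; 0; 0; 0; 0];
       [:: 0; 1; 0; 0; 0; 0];
       [:: 0; 0; 1; 0; 0; 0];
       [:: 0; 0; - (- (d / b)); - ((- (th * b)) * ((1) / (b))); 1; (- ((- (th * c)) * ((1) / (b)))) - ((- (th * b)) * ((- ((c) * ((1) / (b)))) / (b)))];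
       [:: 0; 0; 0; (1) / (b); 0; (- ((c) * ((1) / (b)))) / (b)];
       [:: 0; 0; 0; 0; 0; (1) / (b)]])).
exact: good_L3.
Qed.

Lemma good_B0 (b c d f c2 f2 k1 k2 k3 k4 : R) :
  good (tbr (abel4 0 b c d f 1 0 0 c2 0 f2 0 k1 k2 k3 k4)).
Proof.
have [->|b0] := eqVneq b 0; last exact: good_B1.
have [->|d0] := eqVneq d 0; last first.
  basis ltac:(apply: (@good_change R _
  (abel4 0 d f 0 c 1 0 0 f2 0 c2 0 k2 k1 k3 k4)
  [:: [:: 1; 0; 0; 0; 0; 0];
       [:: 0; 1; 0; 0; 0; 0];
       [:: 0; 0; 0; 1; 0; 0];
       [:: 0; 0; 1; 0; 0; 0];
       [:: 0; 0; 0; 0; 1; 0];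
       [:: 0; 0; 0; 0; 0; 1]]
  [:: [:: 1; 0; 0; 0; 0; 0];
       [:: 0; 1; 0; 0; 0; 0];
       [:: 0; 0; 0; 1; 0; 0];
       [:: 0; 0; 1; 0; 0; 0];
       [:: 0; 0; 0; 0; 1; 0];
       [:: 0; 0; 0; 0; 0; 1]])).
  exact: good_B1.
have [->|c0] := eqVneq c2 0.
  basis ltac:(apply: (@good_change R _
  (abel4 0 0 0 1 0 0 0 f2 0 0 0 0 k2 (k3 + k1 * c + k2 * f) k4 k1)
  [:: [:: 1; 0; 0; 0; 0; 0];
       [:: 0; 1; 0; 0; 0; 0];
       [:: 0; 0; 0; 1; - f; 0];
       [:: 0; 0; 0; 0; 1; 0];
       [:: 0; 0; 0; 0; 0; 1];
       [:: 0; 0; 1; 0; - c; 0]]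
  [:: [:: 1; 0; 0; 0; 0; 0];
       [:: 0; 1; 0; 0; 0; 0];
       [:: 0; 0; 0; - (- c); 0; 1];
       [:: 0; 0; 1; - (- f); 0; 0];
       [:: 0; 0; 0; 1; 0; 0];
       [:: 0; 0; 0; 0; 1; 0]])).
  by apply: good_F5 => -[[_ _ /eqP]]; rewrite oner_eq0.
basis ltac:(apply: (@good_change R _
  (abel4 0 0 0 1 0 0 0 c2 0 0 0 0 (k1 + k2 * f2 / c2) (k3 + k1 * c + k2 * f) k4 k2)
  [:: [:: 1; 0; 0; 0; 0; 0];
       [:: 0; 1; 0; 0; 0; 0];
       [:: 0; 0; 1; 0; - c; 0];
       [:: 0; 0; 0; 0; 1; 0];
       [:: 0; 0; 0; 0; 0; 1];
       [:: 0; 0; - (f2 / c2); 1; f2 * c / c2 - f; 0]]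
  [:: [:: 1; 0; 0; 0; 0; 0];
       [:: 0; 1; 0; 0; 0; 0];
       [:: 0; 0; 1; - (- c); 0; 0];
       [:: 0; 0; - (- (f2 / c2)); (- (f2 * c / c2 - f)) - ((- (f2 / c2)) * (- (- c))); 0; 1];
       [:: 0; 0; 0; 1; 0; 0];
       [:: 0; 0; 0; 0; 1; 0]])).
by apply: good_F5 => -[[_ _ /eqP]]; rewrite oner_eq0.
Qed.

Lemma good_B (b1 c1 d1 f1 g1 b2 c2 d2 f2 g2 k1 k2 k3 k4 : R) : g1 != 0 ->
  b1 * g2 = b2 * g1 -> d1 * g2 = d2 * g1 ->
  good (tbr (abel4 0 b1 c1 d1 f1 g1 0 b2 c2 d2 f2 g2 k1 k2 k3 k4)).
Proof.
move=> g0 h1 h2.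
have -> : b2 = b1 * g2 / g1 by rewrite h1; field.
have -> : d2 = d1 * g2 / g1 by rewrite h2; field.
basis ltac:(apply: (@good_change R _
  (abel4 0 (b1 / g1) (c1 / g1) (d1 / g1) (f1 / g1) 1 0 0 (c2 - g2 / g1 * c1) 0 (f2 - g2 / g1 * f1) 0 (k1 / g1) (k2 / g1) (k3 / g1) (k4 / g1))
  [:: [:: g1^-1; 0; 0; 0; 0; 0];
       [:: - (g2 / g1); 1; 0; 0; 0; 0];
       [:: 0; 0; 1; 0; 0; 0];
       [:: 0; 0; 0; 1; 0; 0];
       [:: 0; 0; 0; 0; 1; 0];
       [:: 0; 0; 0; 0; 0; 1]]
  [:: [:: (1) / (g1^-1); 0; 0; 0; 0; 0];
       [:: - ((- (g2 / g1)) * ((1) / (g1^-1))); 1; 0; 0; 0; 0];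
       [:: 0; 0; 1; 0; 0; 0];
       [:: 0; 0; 0; 1; 0; 0];
       [:: 0; 0; 0; 0; 1; 0];
       [:: 0; 0; 0; 0; 0; 1]])).
exact: good_B0.
Qed.

(** W is central, so the algebra is abelian, which is the case of g_34, or [e1, e2] is a nonzero
    vector that can be completed to a basis of W. The first nonzero k tells which basis vector it
    replaces. *)
Lemma good_0 (k1 k2 k3 k4 : R) : good (tbr (abel4 0 0 0 0 0 0 0 0 0 0 0 0 k1 k2 k3 k4)).
Proof.
have n1 : ~ [/\ [/\ 1 = 0 :> R, 0 = 0 :> R, 0 = 0 :> R & 0 = 0 :> R], 0 = 0 :> R, 0 = 0 :> R, 0 = 0 :> R & 0 = 0 :> R].
  by move=> [[/eqP]]; rewrite oner_eq0.
have [e1|h1] := eqVneq k1 0; last first.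
  basis ltac:(apply: (@good_change R _
  (abel4 0 1 0 0 0 0 0 0 0 0 0 0 0 0 0 0)
  [:: [:: 1; 0; 0; 0; 0; 0];
       [:: 0; 0; 0; 1; 0; 0];
       [:: 0; 1; 0; 0; 0; 0];
       [:: 0; 0; 0; 0; 1; 0];
       [:: 0; 0; k1; k2; k3; k4];
       [:: 0; 0; 0; 0; 0; 1]]
  [:: [:: 1; 0; 0; 0; 0; 0];
       [:: 0; 0; 1; 0; 0; 0];
       [:: 0; (- (k2)) / (k1); 0; (- (k3)) / (k1); (1) / (k1); (- (k4)) / (k1)];
       [:: 0; 1; 0; 0; 0; 0];
       [:: 0; 0; 0; 1; 0; 0];
       [:: 0; 0; 0; 0; 0; 1]])).
  exact: good_F5.
have [e2|h2] := eqVneq k2 0; last first.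
  rewrite e1.
  basis ltac:(apply: (@good_change R _
  (abel4 0 1 0 0 0 0 0 0 0 0 0 0 0 0 0 0)
  [:: [:: 1; 0; 0; 0; 0; 0];
       [:: 0; 0; 1; 0; 0; 0];
       [:: 0; 1; 0; 0; 0; 0];
       [:: 0; 0; 0; 0; 1; 0];
       [:: 0; 0; 0; k2; k3; k4];
       [:: 0; 0; 0; 0; 0; 1]]
  [:: [:: 1; 0; 0; 0; 0; 0];
       [:: 0; 0; 1; 0; 0; 0];
       [:: 0; 1; 0; 0; 0; 0];
       [:: 0; 0; 0; (- (k3)) / (k2); (1) / (k2); (- (k4)) / (k2)];
       [:: 0; 0; 0; 1; 0; 0];
       [:: 0; 0; 0; 0; 0; 1]])).
  exact: good_F5.
have [e3|h3] := eqVneq k3 0; last first.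
  rewrite e1 e2.
  basis ltac:(apply: (@good_change R _
  (abel4 0 1 0 0 0 0 0 0 0 0 0 0 0 0 0 0)
  [:: [:: 1; 0; 0; 0; 0; 0];
       [:: 0; 0; 1; 0; 0; 0];
       [:: 0; 1; 0; 0; 0; 0];
       [:: 0; 0; 0; 1; 0; 0];
       [:: 0; 0; 0; 0; k3; k4];
       [:: 0; 0; 0; 0; 0; 1]]
  [:: [:: 1; 0; 0; 0; 0; 0];
       [:: 0; 0; 1; 0; 0; 0];
       [:: 0; 1; 0; 0; 0; 0];
       [:: 0; 0; 0; 1; 0; 0];
       [:: 0; 0; 0; 0; (1) / (k3); (- (k4)) / (k3)];
       [:: 0; 0; 0; 0; 0; 1]])).
  exact: good_F5.
have [e4|h4] := eqVneq k4 0; last first.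
  rewrite e1 e2 e3.
  basis ltac:(apply: (@good_change R _
  (abel4 0 1 0 0 0 0 0 0 0 0 0 0 0 0 0 0)
  [:: [:: 1; 0; 0; 0; 0; 0];
       [:: 0; 0; 1; 0; 0; 0];
       [:: 0; 1; 0; 0; 0; 0];
       [:: 0; 0; 0; 1; 0; 0];
       [:: 0; 0; 0; 0; 0; k4];
       [:: 0; 0; 0; 0; 1; 0]]
  [:: [:: 1; 0; 0; 0; 0; 0];
       [:: 0; 0; 1; 0; 0; 0];
       [:: 0; 1; 0; 0; 0; 0];
       [:: 0; 0; 0; 1; 0; 0];
       [:: 0; 0; 0; 0; 0; 1];
       [:: 0; 0; 0; 0; (1) / (k4); 0]])).
  exact: good_F5.
do 6!right; rewrite e1 e2 e3 e4; have -> : tbr (abel4 0 0 0 0 0 0 0 0 0 0 0 0 0 0 0 0) = @g34 R.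
  apply: funext => x; apply: funext => y; apply/rowP => -[[|[|[|[|[|[|//]]]]]] hk];
  rewrite !mxE /=; ring.
exact: lie_iso_refl.
Qed.

(** Up to a swap of e1 and e2, the cases are: a1 nonzero; a1 = a2 = 0 with g1 nonzero; all four
    zero, where both maps send w1 and w2 into <w3, w4> and kill w3 and w4. *)
Lemma good_abel4 (a1 b1 c1 d1 f1 g1 a2 b2 c2 d2 f2 g2 k1 k2 k3 k4 : R) :
  a1 * d2 = a2 * d1 -> a1 * f2 + b1 * g2 = a2 * f1 + b2 * g1 -> d1 * g2 = d2 * g1 ->
  good (tbr (abel4 a1 b1 c1 d1 f1 g1 a2 b2 c2 d2 f2 g2 k1 k2 k3 k4)).
Proof.
move=> h1 h2 h3.
have [A1|a0] := eqVneq a1 0; last exact: good_A.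
have [A2|a0] := eqVneq a2 0; last first.
  basis ltac:(apply: (@good_change R _
  (abel4 a2 b2 c2 d2 f2 g2 a1 b1 c1 d1 f1 g1 (- k1) (- k2) (- k3) (- k4))
  [:: [:: 0; 1; 0; 0; 0; 0];
       [:: 1; 0; 0; 0; 0; 0];
       [:: 0; 0; 1; 0; 0; 0];
       [:: 0; 0; 0; 1; 0; 0];
       [:: 0; 0; 0; 0; 1; 0];
       [:: 0; 0; 0; 0; 0; 1]]
  [:: [:: 0; 1; 0; 0; 0; 0];
       [:: 1; 0; 0; 0; 0; 0];
       [:: 0; 0; 1; 0; 0; 0];
       [:: 0; 0; 0; 1; 0; 0];
       [:: 0; 0; 0; 0; 1; 0];
       [:: 0; 0; 0; 0; 0; 1]])).
  by apply: good_A.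
move: h1 h2; rewrite A1 A2 !mul0r !add0r => _ h2.
have [G1|g0] := eqVneq g1 0; last exact: good_B.
have [G2|g0] := eqVneq g2 0; last first.
  basis ltac:(apply: (@good_change R _
  (abel4 0 b2 c2 d2 f2 g2 0 b1 c1 d1 f1 g1 (- k1) (- k2) (- k3) (- k4))
  [:: [:: 0; 1; 0; 0; 0; 0];
       [:: 1; 0; 0; 0; 0; 0];
       [:: 0; 0; 1; 0; 0; 0];
       [:: 0; 0; 0; 1; 0; 0];
       [:: 0; 0; 0; 0; 1; 0];
       [:: 0; 0; 0; 0; 0; 1]]
  [:: [:: 0; 1; 0; 0; 0; 0];
       [:: 1; 0; 0; 0; 0; 0];
       [:: 0; 0; 1; 0; 0; 0];
       [:: 0; 0; 0; 1; 0; 0];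
       [:: 0; 0; 0; 0; 1; 0];
       [:: 0; 0; 0; 0; 0; 1]])).
  by apply: good_B.
rewrite G1 G2.
have [[[-> -> -> ->] -> -> -> ->]|nz] :=
  EM [/\ [/\ b1 = 0, c1 = 0, d1 = 0 & f1 = 0], b2 = 0, c2 = 0, d2 = 0 & f2 = 0].
  exact: good_0.
exact: good_F5.
Qed.
End Tree.

(** * Nilpotent Lie algebras of dimension 6 *)

Section Engel.
Variable R : realType.
Local Notation V := 'rV[R]_6.

Lemma br_sumr (br : bracket R) (brP : bilinear_alt br) y n (c : 'I_n -> R) (v : 'I_n -> V) :
  br y (\sum_i c i *: v i) = \sum_i c i *: br y (v i).
Proof.
elim/big_ind2: _ => [|a b a' b' <- <-|i _]; rewrite ?(br0r brP) ?(brDr brP) ?(brZr brP) //.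
Qed.

Lemma br_suml (br : bracket R) (brP : bilinear_alt br) y n (c : 'I_n -> R) (v : 'I_n -> V) :
  br (\sum_i c i *: v i) y = \sum_i c i *: br (v i) y.
Proof.
elim/big_ind2: _ => [|a b a' b' <- <-|i _]; rewrite ?(br0l brP) ?(brDl brP) ?(brZl brP) //.
Qed.

Lemma bilinear_eq (b b' : bracket R) : bilinear_alt b -> bilinear_alt b' ->
  (forall i j, (i < j < 6)%N -> b (ev R i) (ev R j) = b' (ev R i) (ev R j)) ->
  forall x y, b x y = b' x y.
Proof.
move=> bP bP' H x y; rewrite (row_sum_delta x) (row_sum_delta y).
rewrite !br_suml //; apply: eq_bigr => i _; rewrite !br_sumr //; congr (_ *: _).
apply: eq_bigr => j _; congr (_ *: _); rewrite -!ev_delta.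
have [ij|ji|->] := ltngtP i j; last by rewrite !brxx.
- by apply: H; rewrite ij ltn_ord.
- by rewrite (brC bP) (brC bP') H // ji ltn_ord.
Qed.

Lemma free_unitmx (s : seq V) : size s = 6%N -> free s -> mxl 6 s \in unitmx.
Proof.
move=> s6 sf; rewrite -row_free_unit; apply: inj_row_free => u u0.
pose X := Tuple (introT eqP s6).
have uX : \sum_(i < 6) u 0 i *: X`_i = 0.
  transitivity (u *m mxl 6 s) => //; rewrite mulmx_sum_row; apply: eq_bigr => i _; congr (_ *: _).
  by apply/rowP=> j; rewrite !mxE.
by have /freeP/(_ _ uX) u0' := sf : free X; apply/rowP=> i; rewrite u0' mxE.
Qed.

Lemma good_frame (br : bracket R) L (s : seq V) : bilinear_alt br ->
  all (fun q => (q.1.1 < q.1.2) && (q.1.2 < 6))%N L -> size s = 6%N -> free s ->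
  (forall i j, (i < j < 6)%N ->
     br (nth 0 s i) (nth 0 s j) = \sum_(k < 6) sc L i j k *: nth 0 s k) ->
  lie_isomorphic (tbr L) br /\ lie_isomorphic br (tbr L).
Proof.
move=> brP L6 s6 sf H; pose P := mxl 6 s.
have evP i : (i < 6)%N -> ev R i *m P = nth 0 s i.
  move=> i6; have /= -> := ev_delta R (Ordinal i6); rewrite -rowE.
  by apply/rowP=> j; rewrite !mxE.
apply: (lie_iso_mx (P := P)); first exact: free_unitmx.
apply: (@bilinear_eq (fun x y => br (x *m P) (y *m P)) (fun x y => tbr L x y *m P)).
- by split=> [a x y z|a x y z|x]; rewrite ?mulmxDl -?scalemxAl ?(brDl brP) ?(brDr brP) ?(brZl brP) ?(brZr brP) ?(brxx brP).
- have tP := tbr_bil L.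
  by split=> [a x y z|a x y z|x]; rewrite ?(brDl tP) ?(brDr tP) ?(brZl tP) ?(brZr tP) ?(brxx tP) ?mulmxDl -?scalemxAl ?mul0mx.
move=> i j /andP[ij j6]; rewrite !evP ?(ltn_trans ij) // H ?ij //.
rewrite mulmx_sum_row; apply: eq_bigr => k _; congr (_ *: _).
  by rewrite -(tbr_sc i j L6 (ltn_ord k)) inord_val.
by apply/rowP=> l; rewrite !mxE.
Qed.

Variables (br : bracket R) (lie : is_lie_bracket br) (nil : nilpotent_lie br).
Let brP := lie_bilin lie.

Lemma lower_central_br n y x : x \in lower_central br n -> br y x \in lower_central br n.+1.
Proof.
move=> /coord_vbasis ->; rewrite (coord_vbasis (memvf y)) br_suml // memv_suml // => i _.
rewrite memvZ // br_sumr // memv_suml // => j _; rewrite memvZ // memv_span //.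
by apply: allpairs_f; apply: mem_nth; rewrite size_tuple.
Qed.

(** If every vector of [J] outside [I] had a bracket outside [I], iterated brackets would give such
    vectors in every term of the lower central series, including the zero one. [J] is a predicate so
    that centralizers can be used directly. *)
Lemma engel_step (J : V -> Prop) (I : {vspace V}) :
  (forall y x, J x -> J (br y x)) -> (exists2 x, J x & x \notin I) ->
  exists x, [/\ J x, x \notin I & forall y, br y x \in I].
Proof.
move=> Jid Jne; apply: contrapT => H; have [n n0] := nil.
have [x [_ xI xm]] : exists x, [/\ J x, x \notin I & x \in lower_central br n].
  elim: {n0} n => [|n [x [Jx xI xn]]]; first by case: Jne => x Jx xI; exists x; rewrite memvf.
  have [y yx] : exists y, br y x \notin I.
    apply: contrapT => Hx; apply: H; exists x; split=> // y.
    by apply/negP => /negP yx; apply: Hx; exists y.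
  by exists (br y x); split; [exact: Jid| |exact: lower_central_br].
by move: xm; rewrite n0 memv0 => /eqP x0; rewrite x0 mem0v in xI.
Qed.

Lemma not_full (U : {vspace V}) : (\dim U < 6)%N -> exists v, v \notin U.
Proof.
move=> dU; apply: contrapT => H; suff : (fullv <= U)%VS.
  by move/dimvS; rewrite dimvf /= /dim /= leqNgt dU.
by apply/subvP => v _; apply: contrapT => /negP vU; apply: H; exists v.
Qed.

Lemma span1E (a v : V) : v \in <<[:: a]>>%VS -> exists c, v = c *: a.
Proof. by rewrite span_seq1 => /vlineP. Qed.

Lemma span2E (a b v : V) : v \in <<[:: a; b]>>%VS -> exists c d, v = c *: a + d *: b.
Proof.
by rewrite span_cons => /memv_addP[_ /vlineP[c ->] [w /span1E[d ->] ->]]; exists c, d.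
Qed.

Lemma span3E (a b c v : V) : v \in <<[:: a; b; c]>>%VS ->
  exists x y z, v = x *: a + y *: b + z *: c.
Proof.
rewrite span_cons => /memv_addP[_ /vlineP[x ->] [w /span2E[y [z ->]] ->]].
by exists x, y, z; rewrite addrA.
Qed.

Lemma span4E (a b c d v : V) : v \in <<[:: a; b; c; d]>>%VS ->
  exists x y z t, v = x *: a + y *: b + z *: c + t *: d.
Proof.
rewrite span_cons => /memv_addP[_ /vlineP[x ->] [w /span3E[y [z [t ->]]] ->]].
by exists x, y, z, t; rewrite !addrA.
Qed.

Lemma jacobi_leibniz x y z : br x (br y z) = br (br x y) z + br y (br x z).
Proof.
case: lie => _ _ _ /(_ x y z) /eqP.
rewrite -addrA addr_eq0 => /eqP ->; rewrite (brC brP z (br x y)) (brC brP z x).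
by rewrite (brNr brP) opprD addrC.
Qed.

Lemma abelian_ideal3 : exists x4 x5 x6,
  [/\ free [:: x4; x5; x6],
      forall y, br y x6 = 0,
      forall y, br y x5 \in <<[:: x6]>>%VS,
      forall y, br y x4 \in <<[:: x5; x6]>>%VS
    & br x4 x5 = 0].
Proof.
have [x6 [_ x60 c6]] : exists x, [/\ True, x \notin 0%VS & forall y, br y x \in 0%VS].
  apply: engel_step => //; have [|v v0] := not_full (U := 0%VS); first by rewrite dimv0.
  by exists v.
have {}c6 y : br y x6 = 0 by apply/eqP; rewrite -memv0.
rewrite memv0 in x60.
have d1 : (\dim <<[:: x6]>> < 6)%N by rewrite (leq_ltn_trans (dim_span _)).
have [x5 [_ x5n c5]] : exists x, [/\ True, x \notin <<[:: x6]>>%VS & forall y, br y x \in <<[:: x6]>>%VS].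
  by apply: engel_step => //; have [v v0] := not_full d1; exists v.
have f2 : free [:: x5; x6] by rewrite free_cons x5n seq1_free.
have [x4 [c45 x4n c4]] : exists x, [/\ br x x5 = 0, x \notin <<[:: x5; x6]>>%VS
    & forall y, br y x \in <<[:: x5; x6]>>%VS].
  apply: engel_step => [y x x0|].
    (* The centralizer of x5 is stable under all brackets because [y, x5] is central. *)
    have [s ys] := span1E (c5 y).
    have := jacobi_leibniz y x x5; rewrite x0 (br0r brP) ys (brZr brP) c6 scaler0 addr0.
    by move=> <-.
  have d2 : (\dim <<[:: x5; x6]>> < 6)%N by rewrite (leq_ltn_trans (dim_span _)).
  have [y1 y1n] := not_full d2.
  have d3 : (\dim <<[:: y1; x5; x6]>> < 6)%N by rewrite (leq_ltn_trans (dim_span _)).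
  have [y2 y2n] := not_full d3.
  have [s s1] := span1E (c5 y1); have [t t1] := span1E (c5 y2).
  have [s0|s0] := eqVneq s 0; first by exists y1; rewrite // s1 s0 scale0r.
  (* [y1, x5] = s x6 and [y2, x5] = t x6, so this combination commutes with x5: the centralizer of
     x5 is too large to lie in <x5, x6>. *)
  exists (t *: y1 - s *: y2).
    by rewrite (brDl brP) (brNl brP) !(brZl brP) s1 t1 !scalerA mulrC subrr.
  apply: contra y2n => h; have -> : y2 = s^-1 *: (t *: y1 - (t *: y1 - s *: y2)).
    by rewrite opprB addrC subrK scalerA mulVf // scale1r.
  rewrite memvZ // memvB //; first by rewrite memvZ // memv_span // mem_head.
  by rewrite span_cons; apply: subvP (addvSr _ _) _ h.
by exists x4, x5, x6; split=> //; rewrite free_cons x4n.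
Qed.

End Engel.

(** * Jacobi relations of the tables and the self-centralizing family *)

Section Classify.
Variable R : realType.
Local Notation V := 'rV[R]_6.
Local Notation entry := (@entry R).

Lemma jacobi_iso (br br' : bracket R) : lie_isomorphic br br' -> is_lie_bracket br ->
  forall x y z, br' x (br' y z) + br' y (br' z x) + br' z (br' x y) = 0.
Proof.
move=> [f [[g gf fg] fbr]] [_ _ _ jac] x y z.
by rewrite -[x]fg -[y]fg -[z]fg -!fbr -!linearD jac linear0.
Qed.

Lemma coord_tbr (L : seq (nat * nat * (nat * R))) x y i : (i < 6)%N -> coord (tbr L x y) i = tc L (coord x) (coord y) i.
Proof. by move=> i6; rewrite /coord mxE inordK. Qed.

Lemma abel4_relations (a1 b1 c1 d1 f1 g1 a2 b2 c2 d2 f2 g2 k1 k2 k3 k4 : R) :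
  let br := tbr (abel4 a1 b1 c1 d1 f1 g1 a2 b2 c2 d2 f2 g2 k1 k2 k3 k4) in
  (forall x y z, br x (br y z) + br y (br z x) + br z (br x y) = 0) ->
  [/\ a1 * d2 = a2 * d1, a1 * f2 + b1 * g2 = a2 * f1 + b2 * g1 & d1 * g2 = d2 * g1].
Proof.
move=> br jac.
set L := abel4 _ _ _ _ _ _ _ _ _ _ _ _ _ _ _ _ in br jac.
pose e (i n : nat) : R := (Nat.eqb i n)%:R.
have E i j k m : (m < 6)%N ->
    coord (br (ev R i) (br (ev R j) (ev R k))) m = tc L (e i) (tc L (e j) (e k)) m.
  move=> m6; rewrite coord_tbr //; apply: tc_ext => // n n6; first exact: coord_ev.
  by rewrite coord_tbr //; apply: tc_ext => // l l6; exact: coord_ev.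
have coordD (x y : V) n : coord x n + coord y n = coord (x + y) n by rewrite /coord mxE.
have H i j k m : (m < 6)%N -> tc L (e i) (tc L (e j) (e k)) m +
    tc L (e j) (tc L (e k) (e i)) m + tc L (e k) (tc L (e i) (e j)) m = 0.
  by move=> m6; rewrite -!E // !coordD jac /coord mxE.
(* The Jacobi identity on e1, e2, w1 along w3 and w4, and on e1, e2, w2 along w4. *)
have h1 := H 0%N 1%N 2%N 4%N isT.
have h2 := H 0%N 1%N 2%N 5%N isT.
have h3 := H 0%N 1%N 3%N 5%N isT.
rewrite /L /e /= in h1 h2 h3.
have q1 : a2 * d1 - a1 * d2 = 0 by rewrite -[RHS]h1; ring.
have q2 : a2 * f1 + b2 * g1 - (a1 * f2 + b1 * g2) = 0 by rewrite -[RHS]h2; ring.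
have q3 : d2 * g1 - d1 * g2 = 0 by rewrite -[RHS]h3; ring.
by split; apply/eqP; rewrite -subr_eq0 -opprB oppr_eq0; apply/eqP.
Qed.

(* The case of a self-centralizing abelian ideal <a1, a2, a3>, in the basis
   x, y, z = [x, y], a1, a2, a3. *)
Definition selfcent (p q : R) :=
  [:: entry 0 1 2 1; entry 0 3 4 1; entry 1 4 5 1; entry 2 3 5 (-1);
      entry 0 2 3 p; entry 1 2 4 q].

(** For p = 0 the vectors x, z, a2, a3 span an abelian ideal of dimension 4. For p nonzero,
    rescaling the basis gives g_2 if q = 0 and g_1 otherwise. *)
Lemma good_selfcent (p q : R) : good (tbr (selfcent p q)).
Proof.
have [->|p0] := eqVneq p 0.
  basis ltac:(apply: (@good_change R _ (abel4 (-1) 0 0 q 0 1 0 (-1) 0 0 1 0 0 0 0 0)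
   [:: [:: 0; 1; 0; 0; 0; 0]; [:: 0; 0; 0; 1; 0; 0]; [:: 1; 0; 0; 0; 0; 0];
       [:: 0; 0; 1; 0; 0; 0]; [:: 0; 0; 0; 0; 1; 0]; [:: 0; 0; 0; 0; 0; 1]]
   [:: [:: 0; 0; 1; 0; 0; 0]; [:: 1; 0; 0; 0; 0; 0]; [:: 0; 0; 0; 1; 0; 0];
       [:: 0; 1; 0; 0; 0; 0]; [:: 0; 0; 0; 0; 1; 0]; [:: 0; 0; 0; 0; 0; 1]])).
  by apply: good_abel4; ring.
have [->|q0] := eqVneq q 0.
  basis ltac:(apply: (@good_change R _ (L2 R)
   [:: [:: 1; 0; 0; 0; 0; 0]; [:: 0; 1; 0; 0; 0; 0]; [:: 0; 0; -1; 0; 0; 0];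
       [:: 0; 0; 0; p; 0; 0]; [:: 0; 0; 0; 0; - p; 0]; [:: 0; 0; 0; 0; 0; - p]]
   [:: [:: 1; 0; 0; 0; 0; 0]; [:: 0; 1; 0; 0; 0; 0]; [:: 0; 0; -1; 0; 0; 0];
       [:: 0; 0; 0; p^-1; 0; 0]; [:: 0; 0; 0; 0; - p^-1; 0]; [:: 0; 0; 0; 0; 0; - p^-1]])).
  exact: good_g2.
basis ltac:(apply: (@good_change R _ (L1 R)
   [:: [:: 1; 0; 0; 0; 0; 0]; [:: 0; - p / q; 0; 0; 0; 0]; [:: 0; 0; p / q; 0; 0; 0];
       [:: 0; 0; 0; - p * p / q; 0; 0]; [:: 0; 0; 0; 0; p * p / q; 0]; [:: 0; 0; 0; 0; 0; - p * p * p / q / q]]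
   [:: [:: 1; 0; 0; 0; 0; 0]; [:: 0; - q / p; 0; 0; 0; 0]; [:: 0; 0; q / p; 0; 0; 0];
       [:: 0; 0; 0; - q / p / p; 0; 0]; [:: 0; 0; 0; 0; q / p / p; 0]; [:: 0; 0; 0; 0; 0; - q * q / p / p / p]])).
exact: good_g1.
Qed.
End Classify.

(** * From a nilpotent bracket to one of the tables *)

Section Nilpotent.
Variables (R : realType) (br : bracket R).
Local Notation V := 'rV[R]_6.
Hypotheses (lie : is_lie_bracket br) (nil : nilpotent_lie br).
Let brP := lie_bilin lie.

Ltac pairs := let i := fresh "i" in let j := fresh "j" in
  move=> i j; do 6?[case: j => [|j]]; rewrite ?ltn0 ?andbF // => /andP[+ _];
  do 6?[case: i => [|i]]; rewrite // => _; rewrite !big_ord_recl big_ord0 /=.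

Ltac vec := rewrite ?(scale0r, addr0, add0r, scale1r, scaleN1r, addrA) //.

Lemma good_abelian4 (x3 x4 x5 x6 : V) : free [:: x3; x4; x5; x6] ->
  (forall y, br y x6 = 0) ->
  (forall y, br y x5 \in <<[:: x6]>>%VS) -> (forall y, br y x4 \in <<[:: x5; x6]>>%VS) ->
  (forall y, br y x3 \in <<[:: x4; x5; x6]>>%VS) ->
  br x4 x5 = 0 -> br x3 x5 = 0 -> br x3 x4 = 0 -> good br.
Proof.
move=> f4 c6 c5 c4 c3 h45 h35 h34.
pose W := <<[:: x3; x4; x5; x6]>>%VS.
have dW : (\dim W < 6)%N by rewrite (leq_ltn_trans (dim_span _)).
(* By this choice of x2 the bracket [x1, x2] lies in W, and its coordinates are the parameters [k1]
   to [k4]. *)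
have [x2 [_ x2n c2]] : exists x : V, [/\ True, x \notin W & forall y, br y x \in W].
  by apply: (engel_step lie nil) => //; have [v v0] := not_full dW; exists v.
have f5 : free [:: x2; x3; x4; x5; x6] by rewrite free_cons x2n.
have d5 : (\dim <<[:: x2; x3; x4; x5; x6]>> < 6)%N by rewrite (leq_ltn_trans (dim_span _)).
have [x1 x1n] := not_full d5.
have f6 : free [:: x1; x2; x3; x4; x5; x6] by rewrite free_cons x1n.
have [k1 [k2 [k3 [k4 kE]]]] := span4E (c2 x1).
have [a1 [b1 [n1 e13]]] := span3E (c3 x1); have [a2 [b2 [n2 e23]]] := span3E (c3 x2).
have [d1 [f1 e14]] := span2E (c4 x1); have [d2 [f2 e24]] := span2E (c4 x2).
have [g1 e15] := span1E (c5 x1); have [g2 e25] := span1E (c5 x2).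
have iso : lie_isomorphic (tbr (abel4 a1 b1 n1 d1 f1 g1 a2 b2 n2 d2 f2 g2 k1 k2 k3 k4)) br /\
    lie_isomorphic br (tbr (abel4 a1 b1 n1 d1 f1 g1 a2 b2 n2 d2 f2 g2 k1 k2 k3 k4)).
  apply: (good_frame brP _ _ f6); [by [] | by [] | ]; pairs; rewrite ?c6 ?h45 ?h35 ?h34 ?kE ?e13 ?e23 ?e14 ?e24 ?e15 ?e25; vec.
apply: (good_iso iso); have [] := abel4_relations (jacobi_iso iso.2 lie); exact: good_abel4.
Qed.

Section Centralizer.
Variables x4 x5 x6 : V.
Hypotheses (f3 : free [:: x4; x5; x6]) (c6 : forall y, br y x6 = 0).
Hypothesis h45 : br x4 x5 = 0.

Let c6' y : br x6 y = 0. Proof. by rewrite (brC brP) c6 oppr0. Qed.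
Let h54 : br x5 x4 = 0. Proof. by rewrite (brC brP) h45 oppr0. Qed.

Let brE := (brDl brP, brDr brP, brZl brP, brZr brP, brNl brP, brNr brP, brxx brP, c6, c6', h45, h54).

Let x60 : x6 != 0.
Proof. by move: f3; rewrite !free_cons => /and4P[_ _ + _]; rewrite span_nil memv0. Qed.

(** A linear relation expressing x, y or z through the vectors after it is refuted by taking
    brackets with x4 or x5. *)
Lemma free_selfcent x y z : br x x4 = x5 -> br x x5 = 0 -> br y x4 = 0 -> br y x5 = x6 ->
  br z x4 = - x6 -> br z x5 = 0 -> free [:: x; y; z; x4; x5; x6].
Proof.
move=> x_4 x_5 y_4 y_5 z_4 z_5; rewrite free_cons (free_cons y) (free_cons z) f3 andbT.
apply/and3P; split; apply/negP.
- rewrite span_cons => /memv_addP[_ /vlineP[s ->] [w /span4E[t [a [b [c ->]]]] xE]].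
  move: f3; rewrite [free _]free_cons => /andP[_]; rewrite free_cons => /andP[/negP + _]; apply.
  rewrite -x_4 xE !brE y_4 z_4 !scaler0 !addr0 add0r scalerN rpredN memvZ //.
  by rewrite memv_span // mem_head.
- move=> /span4E[t [a [b [c yE]]]]; move: x60; rewrite -y_5 yE !brE z_5.
  by rewrite !scaler0 !addr0 eqxx.
- move=> /span3E[a [b [c zE]]]; move: x60; rewrite -oppr_eq0 -z_4 zE !brE.
  by rewrite !scaler0 !addr0 eqxx.
Qed.

Hypothesis c5 : forall y, br y x5 \in <<[:: x6]>>%VS.
Hypothesis c4 : forall y, br y x4 \in <<[:: x5; x6]>>%VS.
Hypothesis cent : forall v, br v x4 = 0 -> br v x5 = 0 -> v \in <<[:: x4; x5; x6]>>%VS.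

(* The action of br on <x4, x5, x6> is faithful modulo <x4, x5, x6>, hence, by
   dimension, onto the strictly upper triangular matrices. *)
Lemma action_onto : exists x y,
  [/\ br x x4 = x5, br x x5 = 0, br y x4 = 0 & br y x5 = x6].
Proof.
have hal v : exists a : R * R, br v x4 = a.1 *: x5 + a.2 *: x6.
  by have [a [b]] := span2E (c4 v); exists (a, b).
have [al alP] := choice hal.
have [de deP] := choice (fun v => span1E (c5 v)).
pose U := <<[:: x4; x5; x6]>>%VS.
have dU : (\dim U < 6)%N by rewrite (leq_ltn_trans (dim_span _)).
have [y3 y3n] := not_full dU.
have d4 : (\dim <<[:: y3; x4; x5; x6]>> < 6)%N by rewrite (leq_ltn_trans (dim_span _)).
have [y2 y2n] := not_full d4.
have d5 : (\dim <<[:: y2; y3; x4; x5; x6]>> < 6)%N by rewrite (leq_ltn_trans (dim_span _)).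
have [y1 y1n] := not_full d5.
have f6 : free [:: y1; y2; y3; x4; x5; x6] by rewrite free_cons y1n free_cons y2n free_cons y3n.
pose y (i : 'I_3) : V := nth 0 [:: y1; y2; y3] i.
(* Row [i] holds the three strictly upper triangular entries of the action of [y i]; the assumption
   on the centralizer makes this matrix invertible. *)
pose N : 'M[R]_3 := \matrix_(i, j) nth 0 [:: (al (y i)).1; (al (y i)).2; de (y i)] j.
pose v (u : 'rV[R]_3) : V := \sum_i u 0 i *: y i.
have v4 u : br (v u) x4 = (u *m N) 0 (inord 0) *: x5 + (u *m N) 0 (inord 1) *: x6.
  rewrite /v br_suml // !mxE !scaler_suml -big_split; apply: eq_bigr => i _ /=.
  by rewrite alP !mxE !inordK //= scalerDr !scalerA.
have v5 u : br (v u) x5 = (u *m N) 0 (inord 2) *: x6.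
  rewrite /v br_suml // !mxE !scaler_suml; apply: eq_bigr => i _ /=.
  by rewrite deP !mxE !inordK //= scalerA.
have Nu : N \in unitmx.
  rewrite -row_free_unit; apply: inj_row_free => u u0.
  have /span3E[p [q [r vE]]] : v u \in U by apply: cent; rewrite ?v4 ?v5 u0 !mxE !scale0r ?addr0.
  pose i1 : 'I_3 := lift ord0 ord0; pose i2 : 'I_3 := lift ord0 (lift ord0 ord0).
  pose w : 'rV[R]_6 := \row_i nth 0 [:: u 0 ord0; u 0 i1; u 0 i2; - p; - q; - r] i.
  have w0 : w = 0.
    have Pu := free_unitmx (erefl : size [:: y1; y2; y3; x4; x5; x6] = 6%N) f6.
    rewrite -(mulmxK Pu w); suff -> : w *m mxl 6 [:: y1; y2; y3; x4; x5; x6] = 0 by rewrite mul0mx.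
    rewrite mulmx_sum_row !big_ord_recl big_ord0 !row_mxl !mxE /=.
    transitivity (v u - (p *: x4 + q *: x5 + r *: x6)); last by rewrite vE subrr.
    rewrite /v /y !big_ord_recl big_ord0 /= -/i1 -/i2; apply/rowP=> k; rewrite !mxE; ring.
  have wi (i : 'I_6) : nth 0 [:: u 0 ord0; u 0 i1; u 0 i2; - p; - q; - r] i = 0.
    by have /rowP/(_ i) := w0; rewrite !mxE.
  apply/rowP=> -[[|[|[|//]]] hi]; rewrite mxE.
  - by rewrite -[RHS](wi ord0); congr (u _ _); apply: val_inj.
  - by rewrite -[RHS](wi (inord 1)) inordK //; congr (u _ _); apply: val_inj.
  - by rewrite -[RHS](wi (inord 2)) inordK //; congr (u _ _); apply: val_inj.
exists (v (row (inord 0) (invmx N))), (v (row (inord 2) (invmx N))).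
have rN i : row i (invmx N) *m N = delta_mx 0 i by rewrite -row_mul mulVmx // row1.
rewrite !v4 !v5 !rN !mxE !eqxx /=.
have ne (i j : nat) : (i < 3)%N -> (j < 3)%N -> ((inord i : 'I_3) == inord j) = (i == j).
  by move=> i3 j3; rewrite -val_eqE /= !inordK.
by rewrite !ne //= !scale0r !scale1r ?addr0.
Qed.

Lemma good_centralizer : good br.
Proof.
have [x [y [x_4 x_5 y_4 y_5]]] := action_onto.
pose z := br x y.
have J := jacobi_leibniz lie.
have Jl u v w : br (br u v) w = br u (br v w) - br v (br u w) by rewrite J addrK.
have z_4 : br z x4 = - x6 by rewrite /z Jl y_4 x_4 y_5 (br0r brP) add0r.
have z_5 : br z x5 = 0 by rewrite /z Jl y_5 x_5 c6 (br0r brP) subr0.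
(* Strictly upper triangular 3 x 3 matrices have central commutators, so [x, z] acts trivially on
   the ideal and belongs to it; the same holds for [y, z]. *)
have [p [p2 [p3 xz]]] : exists a b c, br x z = a *: x4 + b *: x5 + c *: x6.
  apply: span3E; apply: cent; rewrite Jl ?z_4 ?z_5 ?x_4 ?x_5 ?(brNr brP) ?c6 ?(br0r brP) ?z_5 ?oppr0 ?addr0 //.
have [q1 [q [q3 yz]]] : exists a b c, br y z = a *: x4 + b *: x5 + c *: x6.
  apply: span3E; apply: cent; rewrite Jl ?z_4 ?z_5 ?y_4 ?y_5 ?(brNr brP) ?c6 ?(br0r brP) ?z_5 ?oppr0 ?addr0 //.
have x5n : x5 \notin <<[:: x6]>>%VS by move: f3; rewrite !free_cons => /and4P[].
(* Jacobi with z = [x, y] and [z, z] = 0. The two sides are q1 x5 and p2 x6, so both coefficients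
   vanish. *)
have : br x (br y z) = br y (br x z) by rewrite J (brxx brP) add0r.
rewrite xz yz !brE x_4 x_5 y_4 y_5 !scaler0 !addr0 add0r => qp.
have q10 : q1 = 0.
  apply/eqP/negP => /negP q10; case/negP: x5n.
  by rewrite -[x5](scalerK q10) qp !memvZ // memv_span // mem_head.
have p20 : p2 = 0.
  by move: qp => /eqP; rewrite q10 scale0r eq_sym scaler_eq0 (negbTE x60) orbF => /eqP.
(* These shifts cancel the x6-components of [x, z] and [y, z]. In the second one both [y, t x5] and
   [t x4, z] contribute t x6, whence the half. *)
pose s := - p3; pose t := - (q3 / 2%:R).
have x4y : br x4 y = 0 by rewrite (brC brP) y_4 oppr0.
have x4z : br x4 z = x6 by rewrite (brC brP) z_4 opprK.
have f6 : free [:: x + s *: x4; y + t *: x4; z + t *: x5; x4; x5; x6].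
  by apply: free_selfcent; rewrite !brE ?x_4 ?x_5 ?y_4 ?y_5 ?z_4 ?z_5 ?scaler0 ?addr0.
apply: (@good_iso _ _ (tbr (selfcent p q))); last exact: good_selfcent.
have xy : br x y = z by [].
have x5x : br x5 x = 0 by rewrite (brC brP) x_5 oppr0.
have x5z : br x5 z = 0 by rewrite (brC brP) z_5 oppr0.
apply: (good_frame brP _ _ f6); [by [] | by [] | ]; pairs;
  rewrite !brE ?x_4 ?x_5 ?y_4 ?y_5 ?z_4 ?z_5 ?x4y ?x4z ?x5x ?x5z ?xz ?yz ?xy ?q10 ?p20 /s /t;
  apply/rowP=> k; rewrite !mxE; by field.
Qed.
End Centralizer.

Theorem nilpotent_good : good br.
Proof.
have [x4 [x5 [x6 [f3 c6 c5 c4 h45]]]] := abelian_ideal3 lie nil.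
have brE := (c6, br0r brP, scaler0, addr0).
have [[v [v4 v5 vn]]|nex] :=
    EM (exists v, [/\ br v x4 = 0, br v x5 = 0 & v \notin <<[:: x4; x5; x6]>>%VS]); last first.
  apply: (good_centralizer f3 c6 h45 c5 c4) => v v4 v5; apply: contrapT => /negP vn.
  by apply: nex; exists v.
pose J v := br v x4 = 0 /\ br v x5 = 0.
(* The centralizer of <x4, x5, x6> is an ideal that is not contained in this span, so an Engel step
   inside it supplies the fourth vector of an abelian ideal. *)
have [x3 [[x34 x35] x3n c3]] : exists x, [/\ J x, x \notin <<[:: x4; x5; x6]>>%VS
    & forall y, br y x \in <<[:: x4; x5; x6]>>%VS].
  apply: (engel_step lie nil); last by exists v.
  move=> y x [x_4 x_5]; have JL := jacobi_leibniz lie y x; split.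
    have := JL x4; rewrite x_4 (br0r brP); have [a [b ->]] := span2E (c4 y).
    by rewrite (brDr brP) !(brZr brP) x_5 c6 !scaler0 !addr0 => <-.
  have := JL x5; rewrite x_5 (br0r brP); have [a ->] := span1E (c5 y).
  by rewrite (brZr brP) c6 scaler0 addr0 => <-.
apply: (good_abelian4 (x3 := x3) _ c6 c5 c4 c3 h45 x35 x34).
by rewrite free_cons x3n.
Qed.
End Nilpotent.

(** * The abelian algebra and the equivalence *)

Section Final.
Variable R : realType.

Lemma g34_tbr : @g34 R = tbr [::].
Proof.
apply: funext => x; apply: funext => y; apply/rowP => -[[|[|[|[|[|[|//]]]]]] hk];
  by rewrite !mxE /= oppr0.
Qed.

Lemma g34_not_mean_convex nu w : ~ mean_convex (@g34 R) nu w.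
Proof.
rewrite g34_tbr => -[[wk _ _] [M /eqP ne] _]; apply: ne.
have hk : is_kform (hat nu w) by apply: pullback_kform.
have bP := tbr_bil (R := R) [::].
apply: kform4_quads M; first exact: ce_d_kform.
have q6 : all (fun l => (size l == 4) && all (fun i => i < 6)%N l) quads by [].
move=> l /(allP q6) /andP[/eqP sl al].
rewrite (ce_d_Dc bP hk (c := sc [::])) //; last by move=> a b m _ _ m6; exact: tbr_sc.
by rewrite DcE //; case: l sl {al} => [|? [|? [|? [|? []]]]] //= _; rewrite !(oppr0, addr0, subr0).
Qed.

End Final.
Local Close Scope ring_scope.
Theorem theoremA (R : realType) (br : bracket R) (Gamma : set 'rV[R]_6)
    (br_lie : is_lie_bracket br) (br_nil : nilpotent_lie br)
    (Gamma_lattice : is_lattice br Gamma) :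
  (exists (nu : kform R R 6) (rho : kform R R 3),
      is_volume_form nu /\ mean_convex br nu rho)
  <->
  [/\ ~ lie_isomorphic br (@g1 R),
      ~ lie_isomorphic br (@g2 R)
    & [/\ ~ lie_isomorphic br (@g4 R),
          ~ lie_isomorphic br (@g9 R),
          ~ lie_isomorphic br (@g12 R)
        & ~ lie_isomorphic br (@g34 R)]].
Proof.
split=> [mc|[n1 n2 [n4 n9 n12 n34]]].
  have no (b : bracket R) : (forall nu w, is_volume_form nu -> ~ mean_convex b nu w) ->
      ~ lie_isomorphic br b.
    by move=> nb /mean_convex_iso/(_ mc)[nu [w [nuv]]]; exact: nb.
  split; [exact: no (@g1_not_mean_convex R)|exact: no (@g2_not_mean_convex R)|split].
  - exact: no (@g4_not_mean_convex R).
  - exact: no (@g9_not_mean_convex R).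
  - exact: no (@g12_not_mean_convex R).
  - by apply: no => nu w _; exact: g34_not_mean_convex.
by case: (nilpotent_good br_lie br_nil) => [//|[|[|[|[|[]]]]]].
Qed.
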